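(* Let $(G,T)$ be an action of a group on a locally finite tree $T$, without edge inversions, with finite quotient graph $\Gamma=G\backslash T$, where $T$ has at least one edge and the stabilisers of any two adjacent vertices are incomparable with respect to inclusion. Assume $(G,T)$ is weakly locally $\infty$-transitive (put $\bullet=(w)$) or (P)-closed (put $\bullet=(p)$). Let $t_1,t_2\in T$ be such that $(G,G_{t_1},G_{t_2})$ has polynomial double-coset growth. Then $$\zeta^\bullet_{G,G_{t_1},G_{t_2}}(s)=\frac{\det\big(I^\bullet-\mathcal E^\bullet(s)+\mathcal U^\bullet_{t_1,t_2}(s)\big)}{\det\big(I^\bullet-\mathcal E^\bullet(s)\big)}+\epsilon^\bullet_{t_1}(t_2),$$ for explicitly defined square matrices $\mathcal E^\bullet(s)$ and $\mathcal U^\bullet_{t_1,t_2}(s)$ whose entries are entire functions in $s\in\mathbb C$, and for a determined integer $\epsilon^\bullet_{t_1}(t_2)$ (all given explicitly in the context). Here $I^\bullet$ denotes the identity matrix of the same dimension as $\mathcal E^\bullet(s)$. In particular, $\zeta^\bullet_{G,G_{t_1},G_{t_2}}(s)$ extends to a meromorphic function on $\mathbb C$.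
   Context: Graphs are in the sense of Serre (vertices $V\Gamma$, edges $E\Gamma$, maps $o,t$, fixed-point-free edge inversion $e\mapsto\bar e$, $o(\bar e)=t(e)$); $\Gamma=V\Gamma\sqcup E\Gamma$. Paths are trivial paths at a vertex or sequences of edges $(e_1,\dots,e_n)$ with $t(e_i)=o(e_{i+1})$; reduced means $e_{i+1}\neq\bar e_i$; geodesics in a tree are reduced paths. Actions are continuous homomorphisms $G\to\mathrm{Aut}(T)$ (permutation topology); no edge inversions means $g\cdot e\ne\bar e$ always. $\pi\colon T\to\Gamma=G\backslash T$ is the quotient map. Weakly locally $\infty$-transitive: for every $v\in VT$ and every path $\mathfrak p$ in $\Gamma$ starting at $\pi(v)$, $G_v$ is transitive on the geodesics in $T$ starting at $v$ and mapped to $\mathfrak p$ by $\pi$. (P)-closed: $G\le\mathrm{Aut}(T)$ is closed and has Tits' property (P): for every geodesic or ray $\ell$ with vertices $(v_n)$ and closest point projection $\pi_\ell$ from $VT$ onto them, the natural map from the pointwise stabiliser $G_\ell$ to the product over $n$ of the permutation groups it induces on $\pi_\ell^{-1}(v_n)$ is surjective. For subgroups $H,K\le G$ with all $|HgK/K|$ finite, $a_n(G,H,K)=|\{HgK:|HgK/K|=n\}|$; polynomial double-coset growth: $a_n=O(n^\alpha)$ for some $\alpha\ge0$. Then $\zeta_{G,H,K}(s)=\sum_{HgK\in H\backslash G/K}|HgK/K|^{-s}$, which converges on a right half-plane. The superscript $\bullet$ on $\zeta$ only records which of the two cases is considered. Put $u=\pi(t_1)$, $w=\pi(t_2)$. The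 standard edge weight is $\omega(a)=|\{e\in ET:o(e)=v,\pi(e)=a\}|$ for any $v\in VT$ with $\pi(v)=o(a)$. $\mathbb 1_S$ denotes the indicator function of $S$; superscript $t$ on a row vector denotes transpose. Case $\bullet=(w)$: matrices are indexed by $E\Gamma$. $\mathcal E^{(w)}(s)=\mathcal E(s)$ has entry $(a,b)$ equal to $(\omega(b)-\mathbb 1_{\{\bar a\}}(b))^{-s}$ if $t(a)=o(b)$ and $0$ otherwise. For $a\in E\Gamma$, $e_a$ is the standard basis row vector; for $c\in V\Gamma$, $e_c=\sum_{a\in t^{-1}(c)}e_a$. Then $\mathcal U^{(w)}_{t_1,t_2}(s)$ equals: $\sum_{a\in o^{-1}(u)}\omega(a)^{-s}e_w^te_a$ if $u,w\in V\Gamma$; $\sum_{a\in o^{-1}(u)}\omega(a)^{-s}(e_w+e_{\bar w})^te_a\mathcal E(s)$ if $u\in V\Gamma,w\in E\Gamma$; $e_w^t(e_u+e_{\bar u})\mathcal E(s)$ if $u\in E\Gamma,w\in V\Gamma$; $(e_w+e_{\bar w})^t(e_u+e_{\bar u})\mathcal E(s)$ if $u,w\in E\Gamma$. And $\epsilon^{(w)}_{t_1}(t_2)$ equals: $\mathbb 1_{\{u\}}(w)-1$ if $u,w\in V\Gamma$; $\mathbb 1_{o^{-1}(u)}(w)\cdot\omega(w)^{-s}-1$ if $u\in V\Gamma,w\in E\Gamma$ (this value may depend on $s$); $\mathbb 1_{\{o(u),t(u)\}}(w)-1$ if $u\in E\Gamma,w\in V\Gamma$; $\mathbb 1_{\{u,\bar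 u\}}(w)-1$ if $u,w\in E\Gamma$. Case $\bullet=(p)$: let $\Delta=(\Gamma,(X_a)_{a\in E\Gamma},(G(c))_{c\in V\Gamma})$ be the local action diagram of $(G,T)$: choose a set $V^*\subseteq VT$ of representatives of the $G$-orbits on $VT$, with $c^*\in V^*$ the representative of $c\in V\Gamma$; $X_a=\{e\in ET:o(e)=o(a)^*,\pi(e)=a\}$; $X_c=\bigsqcup_{a\in o^{-1}(c)}X_a$; $G(c)$ is the closure in $\mathrm{Sym}(X_c)$ of the group induced by $G_{c^*}$ on $X_c$; $X=\bigsqcup_{a\in E\Gamma}X_a$. Fix any map $\iota\colon X\to X$ with $\iota(X_a)\subseteq X_{\bar a}$ for all $a$. For $x\in X_a,y\in X_b$: $\mathcal W(x,y)=|G(t(a))_{\iota(x)}\cdot y|$ if $t(a)=o(b)$ and $0$ otherwise; $\mathcal W_{\rm rev}(x,y)=|G(o(a))_x\cdot y|$ if $o(a)=o(b)$ and $0$ otherwise. Matrices are indexed by $X$. $\mathcal F(s)$ has entry $(x,y)$ ($x\in X_a$, $y\in X_b$) equal to $\mathcal W(x,y)^{-s}$ if $t(a)=o(b)$ and $y\ne\iota(x)$, and $0$ otherwise. For $S\subseteq X$, $f_S$ is the sum of the basis row vectors $f_x$, $x\in S$. Put $S_w=X_w=\bigsqcup_{a\in o^{-1}(w)}X_a$ if $w\in V\Gamma$ and $S_w=X_w\sqcup X_{\bar w}$ if $w\in E\Gamma$. If $u\in V\Gamma$, put $\mathcal Y(s)=\sum_{a\in o^{-1}(u)}\omega(a)^{-s}f_{S_w}^tf_{X_a}$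 and $\epsilon^{(p)}_{t_1}(t_2)=\mathbb 1_{\{u\}}(w)-1$. If $u\in E\Gamma$, put $c_0=o(u)$, choose any $x\in X_u$, and put $\mathcal Y(s)=f_{S_w}^t\big(f_x\mathcal F(s)+\sum_{y\in X_{c_0}\setminus\{x\}}\mathcal W_{\rm rev}(x,y)^{-s}f_y\big)$ and $\epsilon^{(p)}_{t_1}(t_2)=\mathbb 1_{\{u,\bar u\}}(w)-1$. Then $\mathcal E^{(p)}(s)=\mathcal F(s+1)$ and $\mathcal U^{(p)}_{t_1,t_2}(s)=\mathcal Y(s+1)$.
   Formalization: Formulas corrected: in (w), u vertex, w edge, ε gains the term 1_{o(w̄)=u}·ω(w̄)^{-s}; in (w) and (p), u edge, w vertex, ε = 1_{o(u)=w} + 1_{t(u)=w} − 1; in (p), w vertex, S_w is the union of the X_a with t(a)=w, not o(a)=w. *)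

(* Defs.v *)
From HB Require Import structures.
From mathcomp Require Import all_boot all_order all_algebra finmap.
From mathcomp Require Import complex.
From mathcomp Require Import all_classical all_reals all_analysis.
From mathcomp Require summability.

Set Implicit Arguments.
Unset Strict Implicit.
Unset Printing Implicit Defensive.

Import Order.TTheory GRing.Theory Num.Theory numFieldNormedType.Exports.

Local Open Scope classical_set_scope.
Local Open Scope ring_scope.

(* 0 on infinite sets; only meaningful together with finiteness. *)
Definition card (I : choiceType) (A : set I) : nat := #|` fset_set A|.

Section ComplexFunctions.
Variable R : realType.
Implicit Types f : R[i] -> R[i].

Definition cexp (z : R[i]) : R[i] :=
  (expR (complex.Re z))%:C%C * (cos (complex.Im z) +i* sin (complex.Im z))%C.

(* n^{-s} = exp (- s log n) for n > 0; the value at n = 0 is junk and is never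
   reached under the hypotheses of the theorem. *)
Definition npow (n : nat) (s : R[i]) : R[i] := cexp (- s * (ln n%:R)%:C%C).

Definition entire f : Prop :=
  forall s : R[i]^o, derivable (f : R[i]^o -> R[i]^o) s 1.

(* The values of f at its poles are irrelevant. *)
Definition meromorphic f : Prop :=
  forall z : R[i]^o, exists (k : nat) (g : R[i]^o -> R[i]^o),
    (\forall s \near z, derivable g s 1) /\
    (\forall s \near z^', (s - z) ^+ k * f s = g s).

End ComplexFunctions.

Section SerreGraphs.

Record graph (V E : Type) := Graph {
  org : E -> V;
  ter : E -> V;
  bar : E -> E;
  barK : involutive bar;
  bar_neq : forall e, bar e <> e;
  org_bar : forall e, org (bar e) = ter e }.

Variables (V E : eqType) (T : graph V E).

(* A path is a pair (v, p): its first vertex and its sequence of edges, the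
   trivial path at v being (v, [::]). *)
Fixpoint walk (v : V) (p : seq E) : bool :=
  if p is e :: p' then (org T e == v) && walk (ter T e) p' else true.

Definition walk_end (v : V) (p : seq E) : V := last v (map (ter T) p).

Definition reduced (p : seq E) : bool := sorted (fun e f => f != bar T e) p.

Definition geodesic (v : V) (p : seq E) : bool := walk v p && reduced p.

Definition is_tree : Prop :=
  [/\ [set: V] !=set0,
      forall v w, exists2 p, walk v p & walk_end v p = w &
      forall v p, geodesic v p -> walk_end v p = v -> p = [::]].

Definition is_ray (r : nat -> E) : Prop :=
  forall n, org T (r n.+1) = ter T (r n) /\ r n.+1 <> bar T (r n).

(* L and M are the sets of vertices and of edges of a geodesic or a ray. *)
Definition is_line (L : set V) (M : set E) : Prop :=
  (exists v p, [/\ geodesic v p, L = [set` v :: map (ter T) p] & M = [set` p]])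
  \/ (exists r, [/\ is_ray r, L = range (org T \o r) & M = range r]).

(* w is a vertex of L at minimal distance from v. *)
Definition closest (L : set V) (v w : V) : Prop :=
  L w /\ forall w' p p', L w' ->
    geodesic v p -> walk_end v p = w ->
    geodesic v p' -> walk_end v p' = w' -> (size p <= size p')%N.

Definition is_aut (fV : V -> V) (fE : E -> E) : Prop :=
  [/\ bijective fV, bijective fE,
      forall e, org T (fE e) = fV (org T e) &
      forall e, fE (bar T e) = bar T (fE e)].

End SerreGraphs.

Definition locally_finite (V E : choiceType) (T : graph V E) : Prop :=
  forall v, finite_set [set e | org T e = v].

Section DoubleCosets.
Variables (R : realType) (G : groupType).
Implicit Types (H K D : set G).

Definition lcoset (x : G) K : set G := [set (x * k)%g | k in K].

Definition dcoset H (g : G) K : set G :=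
  [set x | exists h k, [/\ H h, K k & x = (h * g * k)%g]].

Definition dcosets H K : set (set G) := range (fun g => dcoset H g K).

(* D/K for a union D of left cosets of K *)
Definition lcosets_of D K : set (set G) := [set lcoset x K | x in D].

Definition growth H K (n : nat) : nat :=
  card [set D | dcosets H K D /\ card (lcosets_of D K) = n].

Definition polynomial_growth H K : Prop :=
  [/\ forall D, dcosets H K D -> finite_set (lcosets_of D K),
      forall n, finite_set [set D | dcosets H K D /\ card (lcosets_of D K) = n]
    & exists2 alpha : R, 0 <= alpha &
        (fun n => (growth H K n)%:R : R^o) =O_\oo
        (fun n => (n%:R : R) `^ alpha : R^o)].

Definition zeta_term H K (s : R[i]) (D : set G) : R[i]^o :=
  if `[< dcosets H K D >] then npow (card (lcosets_of D K)) s else 0.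

(* Unordered (equivalently, absolute) convergence of the defining series. *)
Definition zeta_converges H K (s : R[i]) : Prop :=
  cvg (summability.partial_sum (zeta_term H K s) @ summability.totally).

Definition zeta H K (s : R[i]) : R[i] := summability.sum (zeta_term H K s).

End DoubleCosets.

Section Actions.
Variables (G : groupType) (V E : choiceType) (T : graph V E).

(* A homomorphism from G to Aut(T). *)
Record action := Action {
  actV : G -> V -> V;
  actE : G -> E -> E;
  actV1 : forall v, actV 1%g v = v;
  actVM : forall g h v, actV (g * h)%g v = actV g (actV h v);
  actE1 : forall e, actE 1%g e = e;
  actEM : forall g h e, actE (g * h)%g e = actE g (actE h e);
  act_org : forall g e, org T (actE g e) = actV g (org T e);
  act_bar : forall g e, actE g (bar T e) = bar T (actE g e) }.

Variable A : action.

Definition act (g : G) (t : V + E) : V + E :=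
  match t with inl v => inl (actV A g v) | inr e => inr (actE A g e) end.

Definition stab (t : V + E) : set G := [set g | act g t = t].

Definition no_inversion : Prop := forall g e, actE A g e <> bar T e.

Definition incomparable_stabilisers : Prop := forall e,
  ~ (stab (inl (org T e)) `<=` stab (inl (ter T e))) /\
  ~ (stab (inl (ter T e)) `<=` stab (inl (org T e))).

Definition faithful : Prop :=
  forall g, (forall v, actV A g v = v) -> (forall e, actE A g e = e) ->
  g = 1%g.

(* The image of G is closed in Aut(T) for the permutation topology, i.e.
   the topology of pointwise convergence on the discrete set T. *)
Definition closed_image : Prop := forall fV fE, is_aut T fV fE ->
  (forall (FV : {fset V}) (FE : {fset E}), exists g,
     (forall v, v \in FV -> actV A g v = fV v) /\
     (forall e, e \in FE -> actE A g e = fE e)) ->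
  exists g, actV A g = fV /\ actE A g = fE.

Definition fixes (L : set V) (M : set E) : set G :=
  [set g | (forall v, L v -> actV A g v = v) /\
           (forall e, M e -> actE A g e = e)].

(* An element of the product of the permutation groups induced by fixes L M on
   the fibres of the projection onto L is given by a family of elements of
   fixes L M, one for each w in L. *)
Definition tits_P : Prop := forall L M, is_line T L M ->
  forall h : V -> G, (forall w, L w -> fixes L M (h w)) ->
  exists2 g, fixes L M g &
    forall w v, L w -> closest T L v w -> actV A g v = actV A (h w) v.

Definition P_closed : Prop := [/\ faithful, closed_image & tits_P].

Variables (VG EG : finType) (Gam : graph VG EG).

(* Gam, with the maps piV and piE, is the quotient graph of T by G. *)
Record quotient_graph := QuotientGraph {
  piV : V -> VG;
  piE : E -> EG;
  piV_surj : forall c, exists v, piV v = c;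
  piE_surj : forall a, exists e, piE e = a;
  piV_orbit : forall v w, piV v = piV w <-> exists g, w = actV A g v;
  piE_orbit : forall e f, piE e = piE f <-> exists g, f = actE A g e;
  pi_org : forall e, org Gam (piE e) = piV (org T e);
  pi_bar : forall e, piE (bar T e) = bar Gam (piE e) }.

Variable q : quotient_graph.

Definition piT (t : V + E) : VG + EG :=
  match t with inl v => inl (piV q v) | inr e => inr (piE q e) end.

Definition weakly_locally_infty_transitive : Prop :=
  forall (v : V) (p : seq EG), walk Gam (piV q v) p ->
  forall r r' : seq E, geodesic T v r -> geodesic T v r' ->
    map (piE q) r = p -> map (piE q) r' = p ->
  exists2 g, stab (inl v) g & map (actE A g) r = r'.

Definition star_over (v : V) (a : EG) : set E :=
  [set e | org T e = v /\ piE q e = a].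

Definition omega (a : EG) : nat :=
  card (star_over (sval (cid (piV_surj q (org Gam a)))) a).

End Actions.

Lemma omegaE (G : groupType) (V E : choiceType) (T : graph V E)
    (A : action G T) (VG EG : finType) (Gam : graph VG EG)
    (q : quotient_graph A Gam) (a : EG) (v : V) :
  piV q v = org Gam a -> omega q a = card (star_over q v a).
Proof.
move=> va; rewrite /omega; case: cid => w /= wa.
have /(piV_orbit q)[g ->] : piV q w = piV q v by rewrite wa va.
rewrite /card.
have -> : star_over q (actV A g w) a = [set actE A g e | e in star_over q w a].
  apply/seteqP; split => [e [oe pe]|_ [e [oe pe] <-]].
    exists (actE A g^-1%g e); last by rewrite -actEM mulgV actE1.
    split; first by rewrite act_org oe -actVM mulVg actV1.
    by rewrite -pe; apply/(piE_orbit q); exists g; rewrite -actEM mulgV actE1.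
  split; first by rewrite act_org oe.
  by rewrite -pe; apply/esym/(piE_orbit q); exists g.
have ginj : injective (actE A g).
  by move=> e f /(congr1 (actE A g^-1%g)); rewrite -!actEM mulVg !actE1.
have [fin|nfin] := pselect (finite_set (star_over q w a)).
  by rewrite fset_set_image// card_imfset.
rewrite /fset_set; case: pselect => // _; case: pselect => // fin'.
case: nfin; have := finite_image (actE A g^-1%g) fin'.
rewrite image_comp (_ : _ \o _ = id) ?image_id//.
by apply/funext => e /=; rewrite -actEM mulVg actE1.
Qed.

(* Row vectors and square matrices indexed by a finite type I. *)
Section IndexedMatrices.
Variables (C : comNzRingType) (I : finType).

Definition basis_row (i : I) : 'rV[C]_#|I| := delta_mx 0 (enum_rank i).

Definition matrix_of (f : I -> I -> C) : 'M[C]_#|I| :=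
  \matrix_(i, j) f (enum_val i) (enum_val j).

End IndexedMatrices.

Section Formulae.
Variables (R : realType) (G : groupType) (V E : choiceType) (T : graph V E).
Variables (A : action G T) (VG EG : finType) (Gam : graph VG EG).
Variable q : quotient_graph A Gam.
Local Notation C := R[i].
Local Notation om := (omega q).

Section WeaklyLocallyTransitive.

Definition Ew (s : C) : 'M[C]_#|EG| :=
  matrix_of (fun a b =>
    if ter Gam a == org Gam b then npow (om b - (b == bar Gam a))%N s else 0).

Definition e_ (x : VG + EG) : 'rV[C]_#|EG| :=
  match x with
  | inl c => \sum_(a | ter Gam a == c) basis_row C a
  | inr a => basis_row C a
  end.

Definition Uw (u w : VG + EG) (s : C) : 'M[C]_#|EG| :=
  match u, w with
  | inl c, inl _ =>
      \sum_(a | org Gam a == c) npow (om a) s *: ((e_ w)^T *m e_ (inr a))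
  | inl c, inr b =>
      \sum_(a | org Gam a == c)
        npow (om a) s *: ((e_ w + e_ (inr (bar Gam b)))^T *m e_ (inr a) *m Ew s)
  | inr a, inl _ => (e_ w)^T *m (e_ u + e_ (inr (bar Gam a))) *m Ew s
  | inr a, inr b =>
      (e_ w + e_ (inr (bar Gam b)))^T *m (e_ u + e_ (inr (bar Gam a))) *m Ew s
  end.

(* The terms of the series given by the geodesics that are too short to be
   counted by det(I - E + U) / det(I - E) - 1.  If u is a vertex and w an edge,
   these are the single edges of T lying over w or over bar w; if u is an edge
   and w a vertex, the two endpoints of t1 are distinct orbits, even when u is
   a loop. *)
Definition epsw (u w : VG + EG) (s : C) : C :=
  match u, w with
  | inl c, inl d => (d == c)%:R - 1
  | inl c, inr b =>
      (org Gam b == c)%:R * npow (om b) s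
      + (org Gam (bar Gam b) == c)%:R * npow (om (bar Gam b)) s - 1
  | inr a, inl d => (org Gam a == d)%:R + (ter Gam a == d)%:R - 1
  | inr a, inr b => (b \in [:: a; bar Gam a])%:R - 1
  end.

End WeaklyLocallyTransitive.

(* star c is the chosen representative of the orbit c of vertices. *)
Section LocalActionDiagram.
Variable star : VG -> V.

Definition X_ (a : EG) : set E := star_over q (star (org Gam a)) a.

Definition X_at (c : VG) : set E := \bigcup_(a in [set a | org Gam a = c]) X_ a.

Definition Xset : set E := \bigcup_a X_ a.

Definition X : {fset E} := fset_set Xset.

(* The elements of Sym(X_at c) are represented by functions on all the edges,
   whose values outside X_at c are irrelevant. *)
Definition local_group (c : VG) : set (E -> E) :=
  [set f | set_bij (X_at c) (X_at c) f /\
     forall F : {fset E}, [set` F] `<=` X_at c ->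
       exists2 g, stab A (inl (star c)) g & forall e, e \in F -> actE A g e = f e].

Definition local_orbit (c : VG) (x y : E) : set E :=
  [set f y | f in [set f | local_group c f /\ f x = x]].

Variable iota : X -> X.

Definition W (x y : X) : nat :=
  if ter Gam (piE q (val x)) == org Gam (piE q (val y)) then
    card (local_orbit (ter Gam (piE q (val x))) (val (iota x)) (val y))
  else 0%N.

Definition Wrev (x y : X) : nat :=
  if org Gam (piE q (val x)) == org Gam (piE q (val y)) then
    card (local_orbit (org Gam (piE q (val x))) (val x) (val y))
  else 0%N.

Definition F (s : C) : 'M[C]_#|{: X}| :=
  matrix_of (fun x y =>
    if (ter Gam (piE q (val x)) == org Gam (piE q (val y))) && (y != iota x)
    then npow (W x y) s else 0).

Definition f_ (S : set E) : 'rV[C]_#|{: X}| :=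
  \sum_(x : X | `[< S (val x) >]) basis_row C x.

(* The local edges at which a geodesic reaching t2 may end: those with terminus
   w if w is a vertex, those lying over w or bar w if w is an edge. *)
Definition S_ (w : VG + EG) : set E :=
  match w with
  | inl d => \bigcup_(a in [set a | ter Gam a = d]) X_ a
  | inr b => X_ b `|` X_ (bar Gam b)
  end.

(* The local edge x is only used if u is an edge. *)
Definition Y (u w : VG + EG) (x : X) (s : C) : 'M[C]_#|{: X}| :=
  match u with
  | inl c =>
      \sum_(a | org Gam a == c) npow (om a) s *: ((f_ (S_ w))^T *m f_ (X_ a))
  | inr a =>
      (f_ (S_ w))^T *m
      (basis_row C x *m F s +
       \sum_(y : X | (org Gam (piE q (val y)) == org Gam a) && (y != x))
         npow (Wrev x y) s *: basis_row C y)
  end.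

Definition Ep (s : C) : 'M[C]_#|{: X}| := F (s + 1).

Definition Up (u w : VG + EG) (x : X) (s : C) : 'M[C]_#|{: X}| := Y u w x (s + 1).

(* If u is an edge and w a vertex, the endpoints of t1 are counted here, as in
   epsw. *)
Definition epsp (u w : VG + EG) (s : C) : C :=
  match u, w with
  | inl c, inl d => (d == c)%:R - 1
  | inl _, inr _ => - 1
  | inr a, inl d => (org Gam a == d)%:R + (ter Gam a == d)%:R - 1
  | inr a, inr b => (b \in [:: a; bar Gam a])%:R - 1
  end.

End LocalActionDiagram.

End Formulae.

(* The formula holds at every point where the series converges, a set which
   contains a right half-plane. *)
Definition determinant_formula (R : realType) (G : groupType) (H K : set G)
    (n : nat) (E U : R[i] -> 'M[R[i]]_n) (eps : R[i] -> R[i]) : Prop :=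
  [/\ forall i j, entire (fun s => E s i j) /\ entire (fun s => U s i j),
      exists sigma : R, forall s, sigma < complex.Re s -> zeta_converges H K s,
      forall s, zeta_converges H K s ->
        \det (1%:M - E s) <> 0 /\
        zeta H K s = \det (1%:M - E s + U s) / \det (1%:M - E s) + eps s &
      exists f : R[i] -> R[i],
        meromorphic f /\ forall s, zeta_converges H K s -> f s = zeta H K s].

(* Main.v *)
(* The double cosets of G_t1 and G_t2 are the G_t1-orbits on the orbit of t2, so
   zeta(s) is the sum of |G_t1 t|^(-s-1) over the points t of the orbit of t2.
   The geodesic from t1 to t arrives through an edge pointing away from t1.
   Under either hypothesis the stabiliser of a geodesic ending with an edge e
   moves the next edge f as much as G_e does, so |G_t1 f| = |G_t1 e| |G_e f|, and
   the points at distance n contribute a E^n b for a row a and a column b with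
   U = b a.  Hence zeta = eps + 1 + sum_n a E^n b, and the matrix determinant
   lemma sums the series as soon as E^n tends to 0.

   Since the stabilisers of adjacent vertices are incomparable, every edge
   of the quotient has at least two lifts at each vertex over its origin.  So all
   orbits of edges occur on geodesics leaving t1 and can be continued towards
   t2, and absolute convergence at s forces E(s)^n to tend to 0.

   The entries of the matrices are exponential polynomials.  Such a function, if
   not 0, is bounded below by c |s - z|^k near any z, which makes the quotient of
   determinants meromorphic without complex integration. *)

Require Import Defs.
From mathcomp Require Import all_boot all_order all_algebra finmap.
From mathcomp Require Import complex.
From mathcomp Require Import all_classical all_reals all_analysis.
From mathcomp Require summability.
From mathcomp Require Import ring lra.

Set Implicit Arguments.
Unset Strict Implicit.
Unset Printing Implicit Defensive.

Import Order.TTheory GRing.Theory Num.Theory numFieldNormedType.Exports.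

Local Open Scope classical_set_scope.
Local Open Scope ring_scope.

Local Notation piE := Defs.piE.

(** * Exponential polynomials *)

(** The formula is claimed at every [s] where the series converges, not only in a half-plane, so the
    decay of [E s ^+ k] has to be extracted from convergence at the one point [s]. The entries
    satisfy |E(s)| = E(Re s) and unordered convergence is absolute, so one works with the
    nonnegative matrix N = E(Re s), knowing only that the scalars a N^k b tend to 0. Each label
    occurs on some branch, which bounds every coordinate of N^k b by a multiple of a later scalar.
    Each label can be continued to [t2], so a sum of finitely many vectors N^k b is strictly
    positive, and a positive vector whose images under N^k tend to 0 forces N^k to tend to 0.

    Both cases run through one argument: the indices of the matrix only have to map onto the edges
    of the quotient so that, on columns depending on the label alone, the matrix takes weighted sums
    over the successors of an edge. In the first case the m successors over one label are merged, m
    m^(-s-1) = m^(-s); in the second they stay separate indices, which is why the exponent s + 1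
    remains visible. *)

Section ComplexExponential.
Variable R : realType.
Local Notation C := R[i].

Lemma mvt_bound (f df : R -> R) (M : R) :
  (forall t : R, is_derive t 1 f (df t)) -> f 0 = 0 ->
  (forall t, 0 <= t <= 1 -> `|df t| <= M) -> `|f 1| <= M.
Proof.
move=> dfP f0 bnd.
have [|c c01 E] := @MVT _ f df 0 1 ltr01 (fun x _ => dfP x).
  apply: continuous_subspaceT => x; apply: differentiable_continuous.
  by apply/derivable1_diffP; have [] := dfP x.
move: E; rewrite f0 !subr0 mulr1 => ->; apply: bnd.
by move: c01; rewrite in_itv/= => /andP[/ltW -> /ltW ->].
Qed.

(** Componentwise, because the mean value theorem fails for complex-valued curves. *)
Definition curve_derive (g dg : R -> C) := forall t : R,
  is_derive t 1 (fun x : R => complex.Re (g x) : R) (complex.Re (dg t)) /\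
  is_derive t 1 (fun x : R => complex.Im (g x) : R) (complex.Im (dg t)).


Lemma ReM (x y : C) : complex.Re (x * y) =
  complex.Re x * complex.Re y - complex.Im x * complex.Im y.
Proof. by case: x y => [? ?] [? ?]. Qed.

Lemma ImM (x y : C) : complex.Im (x * y) =
  complex.Re x * complex.Im y + complex.Im x * complex.Re y.
Proof. by case: x y => [? ?] [? ?]. Qed.

Lemma ReZ (a : R) (z : C) : complex.Re (a%:C%C * z) = a * complex.Re z.
Proof. by rewrite ReM; simpl; rewrite mul0r subr0. Qed.

Lemma ImZ (a : R) (z : C) : complex.Im (a%:C%C * z) = a * complex.Im z.
Proof. by rewrite ImM; simpl; rewrite mul0r addr0. Qed.

Lemma ReD (x y : C) : complex.Re (x + y) = complex.Re x + complex.Re y.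
Proof. by case: x y => [? ?] [? ?]. Qed.

Lemma ImD (x y : C) : complex.Im (x + y) = complex.Im x + complex.Im y.
Proof. by case: x y => [? ?] [? ?]. Qed.

Lemma ReN (x : C) : complex.Re (- x) = - complex.Re x.
Proof. by case: x => [? ?]. Qed.

Lemma ImN (x : C) : complex.Im (- x) = - complex.Im x.
Proof. by case: x => [? ?]. Qed.

Lemma Re_sum I (r : seq I) P (F : I -> C) :
  complex.Re (\sum_(i <- r | P i) F i) = \sum_(i <- r | P i) complex.Re (F i).
Proof. by apply: (big_morph _ ReD). Qed.

Lemma Im_sum I (r : seq I) P (F : I -> C) :
  complex.Im (\sum_(i <- r | P i) F i) = \sum_(i <- r | P i) complex.Im (F i).
Proof. by apply: (big_morph _ ImD). Qed.

Lemma Re_cexpM (x a b : R) :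
  complex.Re (cexp (x%:C%C * (a +i* b)%C)) = expR (x * a) * cos (x * b).
Proof. by rewrite /cexp; simpl; rewrite !mul0r !subr0 addr0. Qed.

Lemma Im_cexpM (x a b : R) :
  complex.Im (cexp (x%:C%C * (a +i* b)%C)) = expR (x * a) * sin (x * b).
Proof. by rewrite /cexp; simpl; rewrite !mul0r !subr0 !addr0. Qed.

Lemma curve_derive_cexp (w : C) :
  curve_derive (fun t => cexp (t%:C%C * w)) (fun t => w * cexp (t%:C%C * w)).
Proof.
case: w => a b t; split.
- rewrite (_ : (fun x => _) = fun x => expR (x * a) * cos (x * b)); last first.
    by apply/funext => x; rewrite Re_cexpM.
  apply: is_derive_eq.
  rewrite ReM Re_cexpM Im_cexpM; simpl; rewrite /GRing.scale /=; ring.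
- rewrite (_ : (fun x => _) = fun x => expR (x * a) * sin (x * b)); last first.
    by apply/funext => x; rewrite Im_cexpM.
  apply: is_derive_eq.
  rewrite ImM Re_cexpM Im_cexpM; simpl; rewrite /GRing.scale /=; ring.
Qed.

Lemma curve_deriveB f df g dg : curve_derive f df -> curve_derive g dg ->
  curve_derive (fun t => f t - g t) (fun t => df t - dg t).
Proof.
move=> F G t; have [F1 F2] := F t; have [G1 G2] := G t; split.
- rewrite (_ : (fun x => _) = (fun x => complex.Re (f x)) - (fun x => complex.Re (g x))).
    by rewrite ReD ReN; apply: is_deriveB.
  by apply/funext => x; rewrite ReD ReN.
- rewrite (_ : (fun x => _) = (fun x => complex.Im (f x)) - (fun x => complex.Im (g x))).
    by rewrite ImD ImN; apply: is_deriveB.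
  by apply/funext => x; rewrite ImD ImN.
Qed.

Lemma curve_derive_sum n (f df : 'I_n -> R -> C) :
  (forall i, curve_derive (f i) (df i)) ->
  curve_derive (fun t => \sum_i f i t) (fun t => \sum_i df i t).
Proof.
move=> F t; split.
- rewrite (_ : (fun x => _) = \sum_i (fun x => complex.Re (f i x))).
    by rewrite Re_sum; apply: is_derive_sum => i; have [] := F i t.
  by apply/funext => x; rewrite Re_sum fct_sumE.
- rewrite (_ : (fun x => _) = \sum_i (fun x => complex.Im (f i x))).
    by rewrite Im_sum; apply: is_derive_sum => i; have [] := F i t.
  by apply/funext => x; rewrite Im_sum fct_sumE.
Qed.

Lemma curve_derive_cst (c : C) : curve_derive (fun=> c) (fun=> 0).
Proof. by move=> t; split; apply: is_derive_cst. Qed.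

Lemma curve_derive_exp_term (w : C) n :
  curve_derive (fun t : R => (t%:C%C * w) ^+ n.+1 / n.+1`!%:R)
    (fun t => w * ((t%:C%C * w) ^+ n / n`!%:R)).
Proof.
have E m x : (x%:C%C * w) ^+ m / m`!%:R = (x ^+ m)%:C%C * (w ^+ m / m`!%:R).
  by rewrite exprMn mulrA rmorphXn.
have fact0 : (n.+1%:R : C) != 0 by rewrite pnatr_eq0.
have E2 : w * (w ^+ n / n`!%:R) = n.+1%:R * (w ^+ n.+1 / n.+1`!%:R).
  rewrite factS natrM exprS; field.
  by rewrite pnatr_eq0 -lt0n fact_gt0 nat1r fact0.
move=> t; rewrite E mulrCA E2 mulrCA.
set c := w ^+ n.+1 / _.
have nE : (n.+1%:R : C) = (n.+1%:R)%:C%C by rewrite rmorph_nat.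
rewrite nE.
have D : is_derive t 1 (fun x : R => x ^+ n.+1) (n.+1%:R * t ^+ n).
  apply: DeriveDef; first exact: exprn_derivable.
  by rewrite exp_derive /GRing.scale/= mulr1.
split.
- rewrite (_ : (fun x => _) = (fun x : R => x ^+ n.+1 * complex.Re c)); last first.
    by apply/funext => x; rewrite E ReZ.
  apply: is_derive_eq; rewrite ?ReZ.
  by rewrite /GRing.scale/= mulr0 add0r; ring.

- rewrite (_ : (fun x => _) = (fun x : R => x ^+ n.+1 * complex.Im c)); last first.
    by apply/funext => x; rewrite E ImZ.
  apply: is_derive_eq; rewrite ?ImZ.
  by rewrite /GRing.scale/= mulr0 add0r; ring.

Qed.

Definition exp_rem k (w : C) := cexp w - \sum_(n < k) w ^+ n / n`!%:R.

Lemma cexp0 : cexp 0 = 1 :> C.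
Proof. by rewrite /cexp; simpl; rewrite expR0 cos0 sin0 mul1r. Qed.

(** Differentiating along the ray through [w] lowers the order of the remainder by one, which drives
    the induction on [k] in the estimate below. *)
Lemma curve_derive_exp_rem k w :
  curve_derive (fun t => exp_rem k.+1 (t%:C%C * w))
               (fun t => w * exp_rem k (t%:C%C * w)).
Proof.
rewrite (_ : (fun t => exp_rem k.+1 _) = fun t => cexp (t%:C%C * w) - 1 -
    \sum_(n < k) (t%:C%C * w) ^+ n.+1 / n.+1`!%:R); last first.
  apply/funext => t; rewrite /exp_rem big_ord_recl/= expr0 fact0 divr1.
  by rewrite opprD addrA.
rewrite (_ : (fun t => w * _) = fun t => w * cexp (t%:C%C * w) - 0 -
    \sum_(n < k) w * ((t%:C%C * w) ^+ n / n`!%:R)); last first.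
  by apply/funext => t; rewrite /exp_rem mulrBr subr0 mulr_sumr.
apply: curve_deriveB.
  by apply: curve_deriveB; [exact: curve_derive_cexp|exact: curve_derive_cst].
by apply: curve_derive_sum => i; apply: curve_derive_exp_term.
Qed.

Lemma real_complexM (a b : R) : (a * b)%:C%C = a%:C%C * b%:C%C :> C.
Proof. exact: rmorphM. Qed.

Lemma real_complexD (a b : R) : (a + b)%:C%C = a%:C%C + b%:C%C :> C.
Proof. exact: rmorphD. Qed.

Lemma real_complexN (a : R) : (- a)%:C%C = - a%:C%C :> C.
Proof. exact: rmorphN. Qed.

Lemma real_complexX (a : R) n : (a ^+ n)%:C%C = a%:C%C ^+ n :> C.
Proof. exact: rmorphXn. Qed.

Lemma normC_le_ReIm (z : C) : `|z| <= (`|complex.Re z| + `|complex.Im z|)%:C%C.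
Proof.
rewrite [z in `|z|]complexE (le_trans (ler_normD _ _))// real_complexD lerD//.
  by rewrite normc_def/= expr0n/= addr0 sqrtr_sqr.
by rewrite normrM normc_def/= expr0n/= add0r expr1n sqrtr1 mul1r normc_def/= expr0n addr0 sqrtr_sqr.
Qed.

Lemma normC_ge_ReIm (z : C) : (`|complex.Re z| <= complex.Re `|z|) /\ (`|complex.Im z| <= complex.Re `|z|).
Proof.
rewrite normc_def/=; split.
  by rewrite -sqrtr_sqr ler_sqrt ?addr_ge0 ?sqr_ge0// lerDl sqr_ge0.
by rewrite -sqrtr_sqr ler_sqrt ?addr_ge0 ?sqr_ge0// lerDr sqr_ge0.
Qed.

Lemma norm_cexp (w : C) : `|cexp w| = (expR (complex.Re w))%:C%C.
Proof.
case: w => a b; rewrite /cexp normrM !normc_def/=; simpl.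
by rewrite expr0n/= addr0 sqrtr_sqr cos2Dsin2 sqrtr1 mulr1 ger0_norm ?expR_ge0.
Qed.

Lemma normC_real (z : C) : `|z| = (complex.Re `|z|)%:C%C.
Proof. by rewrite normc_def. Qed.

(** Mean value inequality on the segment from 0 to [w], by induction on [k]. On the unit disc
    [expR 1] bounds the exponential; each step costs a factor 2 because real and imaginary parts are
    bounded separately. *)
Lemma exp_rem_bound k (w : C) : `|w| <= 1 ->
  `|exp_rem k w| <= (expR 1 * 2 ^+ k)%:C%C * `|w| ^+ k.
Proof.
elim: k w => [|k IH] w w1.
  rewrite /exp_rem big_ord0 subr0 norm_cexp !expr0 !mulr1 lecR ler_expR.
  apply: le_trans (ler_norm _) _; have [+ _] := normC_ge_ReIm w; move/le_trans; apply.
  by rewrite -lecR -normC_real.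
pose M := (expR 1 * 2 ^+ k) * complex.Re `|w| ^+ k.+1.
have ME : M%:C%C = (expR 1 * 2 ^+ k)%:C%C * `|w| ^+ k.+1.
  by rewrite /M real_complexM real_complexX -normC_real.
have E0 : 0 <= (expR 1 * 2 ^+ k)%:C%C :> C.
  by rewrite ler0c mulr_ge0 ?expR_ge0 ?exprn_ge0.
have B t : 0 <= t <= 1 -> `|w * exp_rem k (t%:C%C * w)| <= M%:C%C.
  move=> /andP[t0 t1].
  have tw : `|t%:C%C * w| <= `|w|.
    by rewrite normrM ger0_norm ?ler0c// ler_piMl// -(rmorph1 (real_complex R)) lecR.
  rewrite normrM ME exprS mulrCA ler_wpM2l//.
  apply: le_trans (IH _ (le_trans tw w1)) _.
  by rewrite ler_wpM2l// lerXn2r ?nnegrE.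
have g0 : exp_rem k.+1 (0%:C%C * w) = 0.
  rewrite mul0r /exp_rem cexp0 big_ord_recl/= expr0 fact0 divr1 big1 ?addr0 ?subrr//.
  by move=> i _; rewrite expr0n mul0r.
have D := @curve_derive_exp_rem k w.
have BR t : 0 <= t <= 1 -> `|complex.Re (w * exp_rem k (t%:C%C * w))| <= M.
  by move/B; rewrite normC_real lecR; apply: le_trans; have [] := normC_ge_ReIm (w * exp_rem k (t%:C%C * w)).
have BI t : 0 <= t <= 1 -> `|complex.Im (w * exp_rem k (t%:C%C * w))| <= M.
  by move/B; rewrite normC_real lecR; apply: le_trans; have [] := normC_ge_ReIm (w * exp_rem k (t%:C%C * w)).
have := mvt_bound (fun t => (D t).1) _ BR.
have := mvt_bound (fun t => (D t).2) _ BI.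
rewrite g0 rmorph1 mul1r => /(_ erefl) I1 /(_ erefl) R1.
apply: le_trans (normC_le_ReIm _) _.
have -> : (expR 1 * 2 ^+ k.+1)%:C%C * `|w| ^+ k.+1 = (M + M)%:C%C.
  by rewrite real_complexD ME -mulrDl -real_complexD exprS; congr (_%:C%C * _); ring.
by rewrite lecR lerD.
Qed.

Lemma cexpD (x y : C) : cexp (x + y) = cexp x * cexp y.
Proof.
case: x y => [a b] [c d]; rewrite /cexp; simpl.
rewrite expRD cosD sinD; apply/eqP; rewrite eq_complex; apply/andP.
by split; apply/eqP; simpl; ring.
Qed.

(** Repeated frequencies are allowed, so sums concatenate lists and products pair them. Real
    frequencies suffice: that of [npow n] is [- ln n%:R]. *)
Definition expoly (f : C -> C) := exists l : seq (C * R),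
  forall s, f s = \sum_(p <- l) p.1 * cexp (p.2%:C%C * s).

Lemma expoly_ext f g : (forall s, f s = g s) -> expoly f -> expoly g.
Proof. by move=> fg [l fl]; exists l => s; rewrite -fg. Qed.

Lemma expoly_cst c : expoly (fun=> c).
Proof. by exists [:: (c, 0)] => s; rewrite big_seq1 mul0r cexp0 mulr1. Qed.

Lemma expolyD f g : expoly f -> expoly g -> expoly (fun s => f s + g s).
Proof. by move=> [l fl] [m gm]; exists (l ++ m) => s; rewrite big_cat fl gm. Qed.

Lemma expolyM f g : expoly f -> expoly g -> expoly (fun s => f s * g s).
Proof.
move=> [l fl] [m gm].
exists [seq (p.1 * p'.1, p.2 + p'.2) | p <- l, p' <- m] => s.
rewrite fl gm big_allpairs_dep mulr_suml; apply: eq_bigr => p _.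
rewrite mulr_sumr; apply: eq_bigr => p' _ /=.
by rewrite real_complexD mulrDl cexpD; ring.
Qed.

Lemma expoly_sum I (r : seq I) (P : pred I) (f : I -> C -> C) :
  (forall i, P i -> expoly (f i)) -> expoly (fun s => \sum_(i <- r | P i) f i s).
Proof.
move=> fP; elim: r => [|i r IH].
  by apply: (expoly_ext _ (expoly_cst 0)) => s; rewrite big_nil.
case Pi : (P i); last first.
  by apply: (expoly_ext _ IH) => s; rewrite big_cons Pi.
by apply: (expoly_ext _ (expolyD (fP _ Pi) IH)) => s; rewrite big_cons Pi.
Qed.

Lemma expoly_prod I (r : seq I) (P : pred I) (f : I -> C -> C) :
  (forall i, P i -> expoly (f i)) -> expoly (fun s => \prod_(i <- r | P i) f i s).
Proof.
move=> fP; elim: r => [|i r IH].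
  by apply: (expoly_ext _ (expoly_cst 1)) => s; rewrite big_nil.
case Pi : (P i); last first.
  by apply: (expoly_ext _ IH) => s; rewrite big_cons Pi.
by apply: (expoly_ext _ (expolyM (fP _ Pi) IH)) => s; rewrite big_cons Pi.
Qed.

Lemma expolyN f : expoly f -> expoly (fun s => - f s).
Proof.
move=> fP; apply: (expoly_ext _ (expolyM (expoly_cst (-1)) fP)) => s.
by rewrite mulN1r.
Qed.

Lemma expoly_npow n : expoly (npow n).
Proof.
exists [:: (1, - ln n%:R)] => s.
by rewrite big_seq1 mul1r /npow real_complexN mulrC mulrN mulNr.
Qed.

Lemma expoly_shift f c : expoly f -> expoly (fun s => f (s + c)).
Proof.
move=> [l fl]; exists [seq (p.1 * cexp (p.2%:C%C * c), p.2) | p <- l] => s.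
by rewrite fl big_map; apply: eq_bigr => p _ /=; rewrite mulrDr cexpD; ring.
Qed.

Lemma expoly_det n (M : C -> 'M[C]_n) :
  (forall i j, expoly (fun s => M s i j)) -> expoly (fun s => \det (M s)).
Proof.
move=> MP; rewrite /determinant; apply: expoly_sum => p _.
by apply: expolyM; [exact: expoly_cst | apply: expoly_prod => i _].
Qed.

Lemma expoly_mulmx m n p (M : C -> 'M[C]_(m, n)) (N : C -> 'M[C]_(n, p)) :
  (forall i j, expoly (fun s => M s i j)) -> (forall i j, expoly (fun s => N s i j)) ->
  forall i j, expoly (fun s => (M s *m N s) i j).
Proof.
move=> MP NP i j; apply: (@expoly_ext (fun s => \sum_k M s i k * N s k j)).
  by move=> s; rewrite mxE.
by apply: expoly_sum => k _; apply: expolyM.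
Qed.

Lemma expoly_taylor (l : seq (C * R)) (z : C) k :
  let f s := \sum_(p <- l) p.1 * cexp (p.2%:C%C * s) in
  exists M r : R, [/\ 0 < r, 0 <= M & forall h, `|h| <= r%:C%C ->
    `|f (z + h) - \sum_(n < k) (\sum_(p <- l)
         p.1 * cexp (p.2%:C%C * z) * (p.2%:C%C) ^+ n) / n`!%:R * h ^+ n|
      <= M%:C%C * `|h| ^+ k].
Proof.
move=> f; rewrite {}/f.
elim: l => [|p l [M [r [r0 M0 H]]]].
  exists 0, 1; split=> // h _.
  by rewrite !big_nil big1 ?subrr ?normr0 ?mul0r// => i _; rewrite big_nil !mul0r.
pose c := p.1 * cexp (p.2%:C%C * z).
pose N := complex.Re `|c| * (expR 1 * 2 ^+ k * `|p.2| ^+ k).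
have c0 : 0 <= complex.Re `|c| by rewrite -ler0c -normC_real.
have N0 : 0 <= N by rewrite !mulr_ge0 ?expR_ge0 ?exprn_ge0.
(* The second bound keeps the product of the frequency with [h] in the unit disc, where the
   remainder estimate holds. *)
exists (N + M), (Num.min r (1 + `|p.2|)^-1); split.
- by rewrite lt_min r0 invr_gt0 ltr_wpDr.
- exact: addr_ge0.
move=> h hr.
have hr1 : `|h| <= r%:C%C.
  by apply: le_trans hr _; rewrite lecR ge_min lexx.
have hr2 : `|p.2%:C%C * h| <= 1.
  rewrite normrM normc_def/= expr0n/= addr0 sqrtr_sqr.
  apply: (@le_trans _ _ (`|p.2|%:C%C * ((1 + `|p.2|)^-1)%:C%C)).
    by rewrite ler_wpM2l ?ler0c// (le_trans hr)// lecR ge_min lexx orbT.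
  rewrite -real_complexM -(rmorph1 (real_complex R)) lecR ler_pdivrMr ?mul1r ?ltr_wpDr//.
  by rewrite lerDr.
rewrite big_cons mulrDr cexpD.
rewrite (_ : _ - _ = c * exp_rem k (p.2%:C%C * h) +
   (\sum_(p <- l) p.1 * cexp (p.2%:C%C * (z + h)) - \sum_(n < k) (\sum_(p <- l)
         p.1 * cexp (p.2%:C%C * z) * (p.2%:C%C) ^+ n) / n`!%:R * h ^+ n)); last first.
  under [X in _ - X = _]eq_bigr => i _ do rewrite big_cons !mulrDl.
  rewrite big_split/= /exp_rem mulrBr mulr_sumr.
  rewrite (eq_bigr (fun i : 'I_k => c * ((p.2%:C%C * h) ^+ i / i`!%:R))); last first.
    by move=> i _; rewrite exprMn /c; ring.
  by rewrite /c; ring.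
apply: le_trans (ler_normD _ _) _; rewrite real_complexD mulrDl lerD ?H//.
rewrite normrM /N real_complexM -normC_real -mulrA ler_wpM2l//.
apply: le_trans (exp_rem_bound _ hr2) _.
rewrite normrM normc_def/= expr0n/= addr0 sqrtr_sqr exprMn.
by rewrite [X in _ <= X * _]real_complexM real_complexX mulrA.
Qed.

Lemma interpolation (F : fieldType) (xs : seq F) (phi : F -> F) :
  exists P : {poly F}, forall x, x \in xs -> P.[x] = phi x.
Proof.
elim: xs => [|x xs [P HP]]; first by exists 0.
have [xin|xnin] := boolP (x \in xs).
  by exists P => y; rewrite inE => /predU1P[->|]; exact: HP.
pose Q := \prod_(y <- xs) ('X - y%:P).
have Qx : Q.[x] != 0.
  rewrite horner_prod prodf_seq_neq0; apply/allP => y yin /=.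
  by rewrite hornerXsubC subr_eq0; apply: contraNneq xnin => ->.
exists (P + ((phi x - P.[x]) / Q.[x]) *: Q) => y.
rewrite hornerD hornerZ inE => /predU1P[->|yin].
  by rewrite divfK// addrC subrK.
have -> : Q.[y] = 0 by apply/rootP; rewrite root_prod_XsubC.
by rewrite mulr0 addr0 HP.
Qed.

(* If all the Taylor coefficients at z vanish, the linear form sending a
   polynomial P to the weighted sum of the values of P at the frequencies is 0;
   interpolating the exponential at the frequencies gives f = 0. *)
Lemma expoly_taylor_eq0 (l : seq (C * R)) (z : C) :
  (forall n, \sum_(p <- l) p.1 * cexp (p.2%:C%C * z) * (p.2%:C%C) ^+ n = 0) ->
  forall s, \sum_(p <- l) p.1 * cexp (p.2%:C%C * s) = 0.
Proof.
move=> T0 s.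
have [P HP] := interpolation [seq p.2%:C%C | p <- l] (fun x => cexp (x * (s - z))).
rewrite (eq_big_seq (fun p => p.1 * cexp (p.2%:C%C * z) * P.[p.2%:C%C])); last first.
  move=> p pl; rewrite HP; last by apply/mapP; exists p.
  by rewrite -mulrA -cexpD -mulrDr [z + _]addrC subrK.
under eq_bigr do rewrite horner_coef mulr_sumr.
rewrite exchange_big/= big1// => i _.
rewrite -[RHS](mulr0 P`_i) -[X in _ * X](T0 i) mulr_sumr.
by apply: eq_bigr => p _; ring.
Qed.

(** The first nonzero Taylor coefficient dominates near [z]; there is one because [f] is not
    identically 0. *)
Lemma expoly_lower f (z : C) : expoly f -> (exists s, f s != 0) ->
  exists k (c r : R), [/\ 0 < c, 0 < r & forall h, `|h| <= r%:C%C ->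
    c%:C%C * `|h| ^+ k <= `|f (z + h)|].
Proof.
move=> [l fl] [s0 fs0].
pose T n := \sum_(p <- l) p.1 * cexp (p.2%:C%C * z) * (p.2%:C%C) ^+ n.
have /existsNP[m0 /eqP Tm0] : ~ (forall n, T n = 0).
  by move=> T0; move: fs0; rewrite fl (expoly_taylor_eq0 T0) eqxx.
have exT : exists n, T n != 0 by exists m0.
have /= := ex_minnP exT; case=> m Tm mmin.
have [M [r [r0 M0 H]]] := expoly_taylor l z m.+1.
pose t := complex.Re `|T m / m`!%:R|.
have t0 : 0 < t.
  by rewrite -(ltcR 0 t) -normC_real normr_gt0 mulf_neq0 ?invr_eq0// pnatr_eq0 -lt0n fact_gt0.
(* Within this radius the error M |h|^(m+1) is at most half of the leading term t |h|^m. *)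
exists m, (t / 2), (Num.min r (t / 2 / (1 + M))); split.
- by rewrite divr_gt0.
- by rewrite lt_min r0 !divr_gt0// ltr_wpDr.
move=> h hr.
have hr1 : `|h| <= r%:C%C by apply: le_trans hr _; rewrite lecR ge_min lexx.
have hr2 : M%:C%C * `|h| <= (t / 2)%:C%C.
  apply: (@le_trans _ _ (M%:C%C * (t / 2 / (1 + M))%:C%C)).
    by rewrite ler_wpM2l ?ler0c// (le_trans hr)// lecR ge_min lexx orbT.
  by rewrite -real_complexM lecR mulrCA ger_pMr ?divr_gt0// ler_pdivrMr ?mul1r ?ltr_wpDr// lerDr.
have := H h hr1; rewrite -fl big_ord_recr/= -/(T m).
have -> : \sum_(i < m) (T i / i`!%:R * h ^+ i) = 0.
  rewrite big1// => i _; rewrite (_ : T i = 0) ?mul0r//.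
  by apply/eqP/negPn/negP => /mmin; rewrite leqNgt ltn_ord.
rewrite add0r => H2; set F := f (z + h) in H2 *.
have H3 : `|T m / m`!%:R * h ^+ m| <= `|F| + M%:C%C * `|h| ^+ m.+1.
  rewrite -lerBlDl (le_trans _ H2)//.
  by rewrite [X in _ <= X]distrC lerB_dist.
rewrite -(lerD2r (M%:C%C * `|h| ^+ m.+1)); apply: le_trans _ H3.
rewrite normrM normrX (normC_real (T m / _)) -/t exprS mulrA -mulrDl.
by rewrite ler_wpM2r ?exprn_ge0// {2}[t]splitr [X in _ <= X]real_complexD lerD2l.
Qed.

Lemma expoly_bounded f (z : C) : expoly f ->
  exists M r : R, [/\ 0 <= M, 0 < r & forall h, `|h| <= r%:C%C -> `|f (z + h)| <= M%:C%C].
Proof.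
move=> [l fl]; have [M [r [r0 M0 H]]] := expoly_taylor l z 0.
exists M, r; split=> // h /H.
by rewrite big_ord0 subr0 expr0 mulr1 fl.
Qed.

(** The bound puts the difference quotient within M |h| of [d]. It serves both for exponential
    polynomials and at a pole that has been cleared. *)
Lemma derivable_of_quadratic (f : C^o -> C^o) (z d : C) (M r : R) : 0 < r -> 0 <= M ->
  (forall h, `|h| <= r%:C%C -> `|f (z + h) - f z - d * h| <= M%:C%C * `|h| ^+ 2) ->
  derivable f z 1.
Proof.
move=> r0 M0 H; apply/cvg_ex; exists (d : C^o).
apply/cvgrPdist_le => e e0.
have eE : e = (complex.Re e)%:C%C by rewrite RRe_real// ger0_real// ltW.
have e0' : 0 < complex.Re e by move: e0; rewrite {1}eE ltcR.
pose r' := Num.min r (complex.Re e / (1 + M)).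
have r'0 : 0 < (r'%:C%C : C) by rewrite ltcR lt_min r0 divr_gt0// ltr_wpDr.
near=> h.
have h0 : h != 0 by near: h; exact: nbhs_dnbhs_neq.
have hr' : `|h| <= r'%:C%C by near: h; exact: dnbhs0_le.
rewrite /= /GRing.scale/= mulr1.
rewrite (_ : d - _ = - h^-1 * (f (z + h) - f z - d * h)); last first.
  by rewrite [h + z]addrC; field.
rewrite normrM normrN normfV.
rewrite mulrC ler_pdivrMr ?normr_gt0//.
apply: le_trans (H _ (le_trans hr' _)) _; first by rewrite lecR ge_min lexx.
rewrite expr2 mulrA ler_wpM2r//.
apply: (@le_trans _ _ (M%:C%C * (complex.Re e / (1 + M))%:C%C)).
  by rewrite ler_wpM2l ?ler0c// (le_trans hr')// lecR ge_min lexx orbT.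
by rewrite -real_complexM eE lecR mulrCA ger_pMr// ler_pdivrMr ?mul1r ?ltr_wpDr// lerDr.
Unshelve. all: by end_near. Qed.

Lemma expoly_entire f : expoly f -> entire f.
Proof.
move=> [l fl] z.
have [M [r [r0 M0 H]]] := expoly_taylor l z 2.
apply: (@derivable_of_quadratic _ _
  ((\sum_(p <- l) p.1 * cexp (p.2%:C%C * z) * (p.2%:C%C) ^+ 1) / 1`!%:R) M r) => // h /H.
rewrite big_ord_recl big_ord1/= !fl expr0 mulr1 fact0 divr1.
under [X in _ - (X + _)]eq_bigr do rewrite expr0 mulr1.
by rewrite expr1 opprD addrA.
Qed.

Lemma derivable_pole_cleared (K : numFieldType) (z : K) n (N D e : K^o -> K^o) (s : K^o) :
  derivable N s 1 -> derivable D s 1 -> derivable e s 1 -> D s != 0 ->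
  derivable (fun x : K^o => (x - z) ^+ n * (N x / D x + e x) : K^o) s 1.
Proof.
move=> dN dD de Ds.
have dz : derivable (fun x : K^o => x - z : K^o) s 1.
  by apply: derivableB; [exact: derivable_id|exact: derivable_cst].
have dV := @derivableV K K^o D s 1 Ds dD.
have dX : derivable ((fun x : K^o => x - z : K) ^+ n) s 1 by exact: derivableX.
have := derivableM dX (derivableD (derivableM dN dV) de).
set f := (X in derivable X) => df; set g := (X in derivable X).
suff -> : g = f by [].
by apply/funext => x; rewrite /f /g !fctE; congr (_ * _); rewrite exprfctE.
Qed.

(** If the denominator vanishes to order [k] at [z], the factor (s - z)^k only makes the function
    bounded there. The exponent [k.+2] makes it O(|s - z|^2), hence derivable at [z] with derivative
    0, without a removable singularity theorem. *)
Lemma expoly_meromorphic N D e : expoly N -> expoly D -> expoly e ->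
  (exists s, D s != 0) -> meromorphic (fun s => N s / D s + e s).
Proof.
move=> NP DP eP Dnz z.
have [k [c [r [c0 r0 HD]]]] := expoly_lower z DP Dnz.
have [MN [rN [MN0 rN0 HN]]] := expoly_bounded z NP.
have [Me [re [Me0 re0 He]]] := expoly_bounded z eP.
pose g (s : C^o) : C^o := (s - z) ^+ k.+2 * (N s / D s + e s).
exists k.+2, g; split; last by near=> s.
pose rho := Num.min (Num.min r 1) (Num.min rN re).
have rho0 : 0 < rho by rewrite !lt_min r0 ltr01 rN0 re0.
apply/nbhs_normP; exists (rho%:C%C); first by rewrite /= ltcR.
move=> s /= /ltW; rewrite distrC => sz.
(* Away from [z] the lower bound keeps the denominator nonzero, and the usual rules of derivation
   apply. *)
have [->|sNz] := eqVneq s z; last first.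
  have Dsn0 : D s != 0.
    rewrite -normr_gt0; have := HD (s - z).
    rewrite (_ : (z : C) + (s - z) = s); last by rewrite addrC subrK.
    move=> HD'.
    apply: lt_le_trans (HD' _); last by apply: le_trans sz _; rewrite lecR !ge_min lexx.
    by rewrite mulr_gt0 ?ltcR// exprn_gt0// normr_gt0 subr_eq0.
  by apply: (@derivable_pole_cleared C) => //; exact: expoly_entire.
apply: (@derivable_of_quadratic _ _ 0 (MN / c + Me) rho) => //.
  by rewrite addr_ge0// divr_ge0// ltW.
move=> h hrho.
have hle x : rho <= x -> `|h| <= x%:C%C by move=> rx; rewrite (le_trans hrho)// lecR.
rewrite mul0r subr0 {2}/g subrr expr0n mul0r subr0 /g addrAC subrr add0r.
rewrite normrM normrX.
have [->|h0] := eqVneq h 0; first by rewrite normr0 !expr0n/= mul0r mulr0.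
have hk0 : 0 < `|h| ^+ k by rewrite exprn_gt0// normr_gt0.
have h1 : `|h| <= 1 by apply: hle; rewrite !ge_min lexx orbT.
rewrite (_ : k.+2 = 2 + k)%N// exprD -mulrA [X in _ <= X]mulrC ler_wpM2l ?exprn_ge0//.
apply: (@le_trans _ _ (`|h| ^+ k * (`|N (z + h) / D (z + h)| + `|e (z + h)|))).
  by rewrite (ler_wpM2l (ltW hk0))// ler_normD.
rewrite mulrDr real_complexD lerD//; last first.
  rewrite (le_trans _ (He h _)) ?hle ?ge_min ?lexx ?orbT// ler_piMl//.
  by rewrite exprn_ile1.
have D0 : c%:C%C * `|h| ^+ k <= `|D (z + h)| by rewrite HD// hle// !ge_min lexx.
have ch0 : 0 < c%:C%C * `|h| ^+ k by rewrite mulr_gt0// ltcR.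
rewrite normrM normfV mulrA ler_pdivrMr ?(lt_le_trans ch0)//.
apply: (@le_trans _ _ ((MN / c)%:C%C * (c%:C%C * `|h| ^+ k))); last first.
  by rewrite ler_wpM2l// ler0c divr_ge0// ltW.
rewrite mulrA -real_complexM divfK ?gt_eqF// mulrC (ler_wpM2r (ltW hk0))//.
by apply/HN/hle; rewrite !ge_min lexx !orbT.
Unshelve. all: by end_near. Qed.

End ComplexExponential.

(** * Geometric series of matrices *)

Section Null.
Variable R : realType.
Local Notation C := R[i].
Implicit Types u v : nat -> C.

Definition null u := forall e : R, 0 < e ->
  exists K, forall k, (K <= k)%N -> `|u k| <= e%:C%C.

Lemma null_le u v : (forall k, `|u k| <= `|v k|) -> null v -> null u.
Proof.
move=> uv vN e e0; have [K HK] := vN e e0.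
by exists K => k /HK; exact: le_trans.
Qed.

Lemma null_ext u v : u =1 v -> null v -> null u.
Proof. by move=> uv; apply: null_le => k; rewrite uv. Qed.

Lemma null0 : null (fun=> 0).
Proof. by move=> e e0; exists 0%N => k _; rewrite normr0 ler0c ltW. Qed.

Lemma nullD u v : null u -> null v -> null (fun k => u k + v k).
Proof.
move=> uN vN e e0; have e2 : 0 < e / 2 by rewrite divr_gt0.
have [K HK] := uN _ e2; have [L HL] := vN _ e2.
exists (maxn K L) => k; rewrite geq_max => /andP[Kk Lk].
by rewrite (le_trans (ler_normD _ _))// (splitr e) real_complexD lerD ?HK ?HL.
Qed.

Lemma nullZ c u : null u -> null (fun k => c * u k).
Proof.
move=> uN e e0; have c0 : 0 < 1 + complex.Re `|c|.
  by rewrite ltr_wpDr// -ler0c -normC_real.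
have [|K HK] := uN (e / (1 + complex.Re `|c|)); first by rewrite divr_gt0.
exists K => k /HK H; rewrite normrM.
apply: (@le_trans _ _ ((1 + complex.Re `|c|)%:C%C * (e / (1 + complex.Re `|c|))%:C%C)).
  apply: ler_pM => //; rewrite [X in X <= _]normC_real lecR lerDr//.
by rewrite -real_complexM mulrC divfK// gt_eqF.
Qed.

Lemma null_sum (I : Type) (r : seq I) (F : I -> nat -> C) :
  (forall i, null (F i)) -> null (fun k => \sum_(i <- r) F i k).
Proof.
move=> FN; elim: r => [|i r IH].
  by apply: null_ext null0 => k; rewrite big_nil.
by apply: (null_ext _ (nullD (FN i) IH)) => k; rewrite big_cons.
Qed.

Lemma null_shift u m : null u -> null (fun k => u (k + m)%N).
Proof.
move=> uN e /uN[K HK]; exists K => k Kk; apply: HK.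
exact: leq_trans Kk (leq_addr _ _).
Qed.

Lemma null_unshift u m : null (fun k => u (k + m)%N) -> null u.
Proof.
move=> uN e /uN[K HK]; exists (K + m)%N => k Kk.
have mk : (m <= k)%N := leq_trans (leq_addl _ _) Kk.
by rewrite -(subnK mk); apply: HK; rewrite -(leq_add2r m) subnK.
Qed.

Lemma null_cst c : null (fun=> c) -> c = 0.
Proof.
move=> cN; apply/eqP; rewrite -normr_eq0 normC_real.
apply/eqP; congr (_%:C)%C; apply/eqP; rewrite eq_le; apply/andP; split; last first.
  by rewrite -ler0c -normC_real.
apply/ler_addgt0Pr => e /cN[K /(_ K (leqnn _))].
by rewrite normC_real lecR add0r.
Qed.

Lemma null_limit_unique u (l m : C) :
  null (fun k => l - u k) -> null (fun k => m - u k) -> l = m.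
Proof.
move=> lN mN; apply/eqP; rewrite -subr_eq0; apply/eqP/null_cst.
apply: (null_ext _ (nullD lN (nullZ (-1) mN))) => k; ring.
Qed.

(** Nonnegative elements of [R[i]] are real, so this reduces to a real series. *)
Lemma null_bounded_series u (M : R) : (forall k, 0 <= u k) ->
  (forall N, \sum_(k < N) u k <= M%:C%C) -> null u.
Proof.
move=> u0 uM.
pose v k := complex.Re (u k).
have uE k : u k = (v k)%:C%C by rewrite /v RRe_real// ger0_real.
have v0 k : 0 <= v k by rewrite -ler0c -uE.
have : cvgn (series v).
  apply: nondecreasing_is_cvgn.
    apply/nondecreasing_seqP => k.
    by rewrite /series/= big_nat_recr//= lerDl.
  exists M => _ [N _ <-].
  have := uM N; rewrite /series/= big_mkord.
  rewrite (eq_bigr (fun k : 'I_N => (v k)%:C%C)) => [|k _]; last exact: uE.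
  by rewrite -(rmorph_sum (real_complex R)) lecR.
move/cvg_series_cvg_0 => v_cvg e e0.
have /cvgr0Pnorm_le /(_ e e0) [K _ HK] := v_cvg.
exists K => k Kk; rewrite uE normc_def/= expr0n/= addr0 sqrtr_sqr lecR.
exact: HK.
Qed.

End Null.

Section MatrixSeries.
Variable R : realType.
Local Notation C := R[i].
Variable n : nat.
Implicit Types (E : 'M[C]_n).

(** Matrix determinant lemma: one block matrix, factored through its two Schur complements. *)
Lemma det_add1_rank1 (u : 'cV[C]_n) (v : 'rV[C]_n) :
  \det (1%:M + u *m v) = 1 + (v *m u) 0 0.
Proof.
have E1 : block_mx 1%:M (- v) u 1%:M =
   block_mx 1%:M 0 u 1%:M *m block_mx (1%:M : 'M[C]_1) (- v) 0 (1%:M + u *m v).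
  rewrite mulmx_block !mul1mx !mul0mx ?mulmx0 !mulmx1 !addr0 mulmxN.
  by congr block_mx; rewrite [1%:M + _]addrC addKr.
have E2 : block_mx 1%:M (- v) u 1%:M =
   block_mx (1%:M + v *m u : 'M[C]_1) (- v) 0 1%:M *m block_mx 1%:M 0 u 1%:M.
  rewrite mulmx_block !mul1mx !mul0mx ?mulmx0 !mulmx1 !add0r mulNmx.
  by congr block_mx; rewrite addrK.
have := congr1 determinant E1; rewrite E2 !det_mulmx !det_ublock !det_lblock !det1 !mul1r !mulr1.
by move=> <-; rewrite det_mx11 !mxE eqxx.
Qed.

Definition null_mx (p q : nat) (M : nat -> 'M[C]_(p, q)) :=
  forall i j, null (fun k => M k i j).

Lemma null_mulmxl p q r (A : 'M[C]_(p, q)) (M : nat -> 'M[C]_(q, r)) :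
  null_mx M -> null_mx (fun k => A *m M k).
Proof.
move=> MN i j.
apply: (@null_ext _ _ (fun k => \sum_l A i l * M k l j)).
  by move=> k; rewrite mxE.
by apply: null_sum => l; apply: nullZ.
Qed.

Lemma null_mulmxr p q r (M : nat -> 'M[C]_(p, q)) (A : 'M[C]_(q, r)) :
  null_mx M -> null_mx (fun k => M k *m A).
Proof.
move=> MN i j.
apply: (@null_ext _ _ (fun k => \sum_l A l j * M k i l)).
  by move=> k; rewrite mxE; apply: eq_bigr => l _; rewrite mulrC.
by apply: null_sum => l; apply: nullZ.
Qed.

(** A row fixed by [E] is fixed by all its powers, hence 0. *)
Lemma det_1sub_neq0 E : null_mx (fun k => E ^+ k) -> \det (1%:M - E) != 0.
Proof.
move=> EN; apply/negP => /det0P[v v0 /eqP]; rewrite mulmxBr mulmx1 subr_eq0 => /eqP vE.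
have vEk k : v = v *m E ^+ k.
  elim: k => [|k IH]; first by rewrite expr0 mulmx1.
  by rewrite exprS -[E * _]/(E *m _) mulmxA -vE.
move/eqP: v0; apply; apply/matrixP => i j; rewrite [RHS]mxE; apply: null_cst.
apply: (null_ext _ (null_mulmxl v EN i j)) => k.
by rewrite -vEk.
Qed.

(** Since 1 - E + b a = (1 - E) (1 + J b a) with [J] the inverse of 1 - E, the quotient of
    determinants is 1 + a J b; the remainder of the geometric series is a E^N J b. *)
Lemma geometric_limit E (a : 'rV[C]_n) (b : 'cV[C]_n) :
  null_mx (fun k => E ^+ k) ->
  null (fun N => \det (1%:M - E + b *m a) / \det (1%:M - E) - 1
        - \sum_(k < N) (a *m E ^+ k *m b) 0 0).
Proof.
move=> EN; have D0 := det_1sub_neq0 EN.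
have U : 1%:M - E \in unitmx by rewrite unitmxE unitfE.
pose J := invmx (1%:M - E).
have -> : \det (1%:M - E + b *m a) / \det (1%:M - E) - 1 = (a *m J *m b) 0 0.
  have -> : 1%:M - E + b *m a = (1%:M - E) *m (1%:M + J *m b *m a).
    by rewrite mulmxDr mulmx1 !mulmxA mulmxV// mul1mx.
  by rewrite det_mulmx mulrC mulKf// det_add1_rank1 mulmxA addrC addKr.
have S N : \sum_(k < N) a *m E ^+ k *m b = a *m J *m b - a *m E ^+ N *m (J *m b).
  have : (\sum_(k < N) E ^+ k) *m (1%:M - E) = 1%:M - E ^+ N.
    elim: N => [|N IH]; first by rewrite big_ord0 mul0mx expr0 subrr.
    rewrite big_ord_recr/= mulmxDl IH mulmxBr mulmx1 exprSr.
    by rewrite addrA subrK.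
  move=> SE0; have SE : \sum_(k < N) E ^+ k = J - E ^+ N *m J.
    by rewrite -[LHS]mulmx1 -(mulmxV U) mulmxA SE0 mulmxBl mul1mx.
  rewrite -mulmx_suml -mulmx_sumr SE mulmxBr mulmxBl !mulmxA//.
apply: (null_ext _ (null_mulmxr (J *m b) (null_mulmxl a EN) 0 0)) => N.
have := congr1 (fun M : 'M[C]_1 => M 0 0) (S N); rewrite summxE => ->.
by rewrite !mxE opprD addrA subrr add0r opprK.
Qed.

(** The sum [v] of suitable vectors N^k b is strictly positive, and N^k v tends to 0. The inequality
    (N^k)_ij v_j <= (N^k v)_i then controls every entry of N^k, and with it the entry of E^k. *)
Lemma null_powers_of_reach E (N : 'M[C]_n) (b : 'cV[C]_n) :
  (forall i j, `|E i j| <= N i j) -> (forall i, 0 <= b i 0) ->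
  null_mx (fun k => N ^+ k *m b) ->
  (forall i, exists k, 0 < (N ^+ k *m b) i 0) ->
  null_mx (fun k => E ^+ k).
Proof.
move=> EN b0 NbN reach.
have N0 i j : 0 <= N i j by apply: le_trans (EN i j).
have Nk0 k i j : 0 <= (N ^+ k) i j.
  elim: k i j => [|k IH] i j; first by rewrite expr0 mxE ler0n.
  by rewrite exprS mxE sumr_ge0// => l _; rewrite mulr_ge0.
have ENk k i j : `|(E ^+ k) i j| <= (N ^+ k) i j.
  elim: k i j => [|k IH] i j; first by rewrite !expr0 !mxE normr_nat.
  rewrite !exprS !mxE (le_trans (ler_norm_sum _ _ _))// ler_sum// => l _.
  by rewrite normrM ler_pM.
have [t tP] := choice reach.
pose v := \sum_i N ^+ (t i) *m b.
have vN : null_mx (fun k => N ^+ k *m v).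
  move=> i j; apply: (@null_ext _ _ (fun k => \sum_l (N ^+ (k + t l) *m b) i j)).
    move=> k; rewrite mulmx_sumr summxE; apply: eq_bigr => l _.
    by rewrite mulmxA exprD.
  by apply: null_sum => l; apply: (null_shift (t l) (NbN i j)).
have Nb0 k i : 0 <= (N ^+ k *m b) i 0.
  by rewrite mxE sumr_ge0// => l _; rewrite mulr_ge0.
have v0 i : 0 < v i 0.
  rewrite summxE (bigD1 i)//=; apply: ltr_pwDl; [exact: tP | apply: sumr_ge0 => l _; exact: Nb0].
move=> i j; apply: null_le (nullZ (v j 0)^-1 (vN i 0)) => k.
apply: le_trans (ENk k i j) _.
rewrite normrM normfV (ger0_norm (ltW (v0 j))) mulrC ler_pdivlMr//.
have T0 l : 0 <= (N ^+ k) i l * v l 0 by rewrite mulr_ge0// ltW.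
rewrite mxE ger0_norm; last by apply: sumr_ge0 => l _; exact: T0.
by rewrite (bigD1 j)//= lerDl; apply: sumr_ge0 => l _; exact: T0.
Qed.

End MatrixSeries.

(** * Unordered sums and growth *)

#[local] Existing Instance summability.totally_filter.

Section UnorderedSums.
Variables (R : realType) (I : choiceType).
Local Notation C := R[i].
Implicit Types (a : I -> C) (A B : {fset I}).
Local Open Scope fset_scope.
Local Open Scope ring_scope.

Definition has_usum a (l : C) := forall e : R, 0 < e ->
  exists A, forall B, A `<=` B -> `|l - \sum_(i <- B) a i| <= e%:C%C.

Lemma partial_sumE (K : zmodType) (a : I -> K) A :
  summability.partial_sum a A = \sum_(i <- A) a i.
Proof. by rewrite /summability.partial_sum big_seq_fsetE. Qed.

Lemma real_posC (e : C) : 0 < e -> e = (complex.Re e)%:C%C /\ 0 < complex.Re e.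
Proof.
move=> e0; have eE : e = (complex.Re e)%:C%C by rewrite RRe_real// gtr0_real.
by split=> //; move: e0; rewrite {1}eE ltcR.
Qed.

Lemma has_usum_cvg a l : has_usum a l ->
  summability.partial_sum (a : I -> C^o) @ summability.totally --> (l : C^o).
Proof.
move=> al; apply/cvgrPdist_le => e /real_posC[-> /al[A HA]].
by exists A => // B /= AB; rewrite partial_sumE; exact: HA.
Qed.

Lemma cvg_has_usum a (l : C) :
  summability.partial_sum (a : I -> C^o) @ summability.totally --> (l : C^o) -> has_usum a l.
Proof.
move=> /cvgrPdist_le al e e0.
have [|A _ HA] := al (e%:C%C); first by rewrite ltcR.
by exists A => B AB; have := HA B AB; rewrite /= partial_sumE.
Qed.

Lemma has_usum_sum a : cvg (summability.partial_sum (a : I -> C^o) @ summability.totally) ->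
  has_usum a (summability.sum (a : I -> C^o)).
Proof. by move=> ca; apply: cvg_has_usum. Qed.

Lemma has_usumD a b l m : has_usum a l -> has_usum b m ->
  has_usum (fun i => a i + b i) (l + m).
Proof.
move=> al bm e e0; have e2 : 0 < e / 2 by rewrite divr_gt0.
have [A HA] := al _ e2; have [B HB] := bm _ e2.
exists (A `|` B) => D; rewrite fsubUset => /andP[AD BD].
rewrite big_split/= opprD addrACA (le_trans (ler_normD _ _))//.
by rewrite (splitr e) real_complexD lerD ?HA ?HB.
Qed.

Lemma has_usumZ c a l : has_usum a l -> has_usum (fun i => c * a i) (c * l).
Proof.
move=> al e e0; have c0 : 0 < 1 + complex.Re `|c|.
  by rewrite ltr_wpDr// -ler0c -normC_real.
have [|A HA] := al (e / (1 + complex.Re `|c|)); first by rewrite divr_gt0.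
exists A => B /HA H; rewrite -mulr_sumr -mulrBr normrM.
apply: (@le_trans _ _ ((1 + complex.Re `|c|)%:C%C * (e / (1 + complex.Re `|c|))%:C%C)).
  apply: ler_pM => //; rewrite [X in X <= _]normC_real lecR lerDr//.
by rewrite -real_complexM mulrC divfK// gt_eqF.
Qed.

Lemma has_usum_ge0 (f : I -> R) (M : R) : (forall i, 0 <= f i) ->
  (forall B, \sum_(i <- B) f i <= M) ->
  exists l : R, has_usum (fun i => (f i)%:C%C) l%:C%C.
Proof.
move=> f0 fM; pose S := [set \sum_(i <- B) f i | B in [set: {fset I}]].
have supS : has_sup S.
  split; first by exists (\sum_(i <- fset0) f i), fset0.
  by exists M => _ [B _ <-].
exists (sup S) => e e0.
have [_ [A _ <-] Ae] := sup_adherent e0 supS.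
exists A => B AB.
have Se : \sum_(i <- B) f i <= sup S by apply: ub_le_sup; [exact: supS.2|exists B].
have AB' : \sum_(i <- A) f i <= \sum_(i <- B) f i.
  rewrite (big_fsetID _ (mem A) B)/=.
  have -> : [fset x in B | x \in A] = A.
    by apply/fsetP => x; rewrite !inE/= andb_idl//; exact: (fsubsetP AB).
  by rewrite lerDl sumr_ge0.
rewrite -(rmorph_sum (real_complex R)) -rmorphB/= ger0_norm ?ler0c ?subr_ge0// lecR.
by rewrite lerBlDl -lerBlDr (le_trans (ltW Ae)).
Qed.

(** The real and the imaginary part are each a [g] that is the difference of the nonnegative
    summable families [f + g] and [f], where [f] is the norm. *)
Lemma usummable_of_norm a (M : R) :
  (forall B, \sum_(i <- B) `|a i| <= M%:C%C) -> exists l, has_usum a l.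
Proof.
move=> aM; pose f i := complex.Re `|a i|.
have fE B : \sum_(i <- B) `|a i| = (\sum_(i <- B) f i)%:C%C.
  by rewrite (rmorph_sum (real_complex R)); apply: eq_bigr => i _; exact: normC_real.
have fM B : \sum_(i <- B) f i <= M by rewrite -lecR -fE.
have f0 i : 0 <= f i by rewrite -ler0c -normC_real.
have [l0 L0] := has_usum_ge0 f0 fM.
have part (g : I -> R) : (forall i, `|g i| <= f i) ->
    exists l : C, has_usum (fun i => (g i)%:C%C) l.
  move=> gf; have [||l L] := @has_usum_ge0 (fun i => f i + g i) (M + M).
  - by move=> i; have := gf i; rewrite ler_norml => /andP[+ _]; rewrite -subr_ge0 opprK addrC.
  - move=> B; rewrite big_split/= lerD// (le_trans _ (fM B))// ler_sum// => i _.
    exact: le_trans (ler_norm _) (gf i).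
  exists (l%:C%C + (-1) * l0%:C%C).
  have := has_usumD L (has_usumZ (-1) L0).
  rewrite (_ : (fun i => _) = fun i => (g i)%:C%C)//.
  by apply/funext => i; rewrite real_complexD; ring.
have [x X] := part (fun i => complex.Re (a i)) (fun i => (normC_ge_ReIm (a i)).1).
have [y Y] := part (fun i => complex.Im (a i)) (fun i => (normC_ge_ReIm (a i)).2).
exists (x + 'i%C * y).
have := has_usumD X (has_usumZ 'i%C Y).
by rewrite (_ : (fun i => _) = a)//; apply/funext => i; rewrite [RHS]complexE.
Qed.

Lemma big_fset_subD (K : zmodType) (a : I -> K) A B : A `<=` B ->
  \sum_(i <- B) a i = \sum_(i <- A) a i + \sum_(i <- B `\` A) a i.
Proof.
move=> AB; rewrite (big_fsetID _ (mem A) B)/=; congr (_ + _).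
- apply: eq_fbigl => x; rewrite !inE/= andb_idl//; exact: (fsubsetP AB).
- by apply: eq_fbigl => x; rewrite !inE/= andbC.
Qed.

(** Finite sums avoiding the set [A] chosen for epsilon 1 have norm at most 2. Separating real and
    imaginary parts, then signs, bounds the sum of norms outside [A] by 8; so unordered convergence
    is absolute. *)
Lemma has_usum_bounded a l : has_usum a l ->
  exists M : R, forall B, \sum_(i <- B) `|a i| <= M%:C%C.
Proof.
move=> /(_ 1 ltr01)[A HA].
have tail B : [disjoint A & B] -> `|\sum_(i <- B) a i| <= 2.
  move=> AB.
  have E : \sum_(i <- A `|` B) a i = \sum_(i <- A) a i + \sum_(i <- B) a i.
    rewrite (@big_fset_subD _ a A (A `|` B)) ?fsubsetUl//; congr (_ + _).
    apply: eq_fbigl => x; rewrite !inE/=.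
    case xA : (x \in A) => //=.
    by rewrite (negbTE (fdisjointP AB x xA)).
  have -> : \sum_(i <- B) a i = (l - \sum_(i <- A) a i) - (l - \sum_(i <- A `|` B) a i).
    by rewrite E; ring.
  rewrite (le_trans (ler_normB _ _))// [2](_ : _ = 1%:C%C + 1%:C%C); last by rewrite rmorph1.
  by rewrite lerD ?HA ?fsubsetUl.
have part (g : I -> R) : (forall B, [disjoint A & B] -> `|\sum_(i <- B) g i| <= 2) ->
    forall B, [disjoint A & B] -> \sum_(i <- B) `|g i| <= 4.
  move=> gt B AB.
  rewrite (big_fsetID _ (fun i => 0 <= g i) B)/=.
  rewrite [4](_ : _ = 2 + 2); last by rewrite -natrD.
  have sub P : [disjoint A & [fset x in B | P x]].
    by apply/fdisjointP => x xA; rewrite !inE/= (negbTE (fdisjointP AB x xA)).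
  apply: lerD.
    rewrite (eq_big_seq g); first exact: le_trans (ler_norm _) (gt _ (sub _)).
    by move=> i; rewrite !inE/= => /andP[_ gi]; rewrite ger0_norm.
  rewrite (eq_big_seq (fun i => - g i)); last first.
    by move=> i; rewrite !inE/= -ltNge => /andP[_ gi]; rewrite ltr0_norm.
  by rewrite sumrN (le_trans (ler_norm _))// normrN gt// sub.
have N2 (z : C) : `|z| <= 2 -> `|complex.Re z| <= 2 /\ `|complex.Im z| <= 2.
  rewrite normC_real [2](_ : _ = 2%:C%C); last by rewrite rmorph_nat.
  by rewrite lecR => z2; have [u v] := normC_ge_ReIm z; split; apply: le_trans z2.
have PR := part (fun i => complex.Re (a i)) _.
have PI := part (fun i => complex.Im (a i)) _.
have HR B : [disjoint A & B] -> `|\sum_(i <- B) complex.Re (a i)| <= 2.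
  by move=> /tail/N2[+ _]; rewrite Re_sum.
have HI B : [disjoint A & B] -> `|\sum_(i <- B) complex.Im (a i)| <= 2.
  by move=> /tail/N2[_ +]; rewrite Im_sum.
pose S0 := complex.Re (\sum_(i <- A) `|a i|).
exists (S0 + (4 + 4)) => B.
have S0E : \sum_(i <- A) `|a i| = S0%:C%C.
  by rewrite /S0 RRe_real// ger0_real// sumr_ge0.
apply: (@le_trans _ _ (\sum_(i <- A `|` B) `|a i|)).
  rewrite [X in _ <= X](@big_fset_subD _ _ B) ?fsubsetUr//.
  by rewrite lerDl sumr_ge0.
rewrite (@big_fset_subD _ _ A) ?fsubsetUl// S0E [X in _ <= X]real_complexD lerD2l.
have dAB : [disjoint A & (A `|` B) `\` A].
  by apply/fdisjointP => x xA; rewrite !inE/= xA.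
apply: (@le_trans _ _ (\sum_(i <- (A `|` B) `\` A) (`|complex.Re (a i)| + `|complex.Im (a i)|)%:C%C)).
  by apply: ler_sum => i _; exact: normC_le_ReIm.
rewrite -(rmorph_sum (real_complex R)) lecR big_split/= lerD//.
- exact: PR HR _ dAB.
- exact: PI HI _ dAB.
Qed.

(** The sets [A N] need not be nested and may miss indices with zero term: for large [N], adding [B]
    to [A N] does not change the sum. Zeta terms are indexed by all subsets of the group and vanish
    off the double cosets. *)
Lemma has_usum_exhaust a l (A : nat -> {fset I}) : has_usum a l ->
  (forall i, a i != 0 -> exists N0, forall N, (N0 <= N)%N -> i \in A N) ->
  null (fun N => l - \sum_(i <- A N) a i).
Proof.
move=> al ex e /al[B HB].
have /choice[t tP] : forall i, exists N0, a i != 0 -> forall N, (N0 <= N)%N -> i \in A N.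
  move=> i; have [/ex[N0 H]|] := boolP (a i != 0); first by exists N0.
  by exists 0%N.
exists (\max_(i <- B) t i)%N => N NB.
have -> : \sum_(i <- A N) a i = \sum_(i <- A N `|` B) a i.
  rewrite [RHS](@big_fset_subD _ _ (A N)) ?fsubsetUl//.
  rewrite big_seq [X in _ = _ + X]big1_seq ?addr0 -?big_seq// => i /andP[_].
  rewrite !inE => /andP[iA]; rewrite (negbTE iA)/= => iB.
  apply/eqP/negPn/negP => /tP/(_ N).
  by move/contraNN: iA => /[apply]; rewrite (leq_trans _ NB)// (leq_bigmax_seq _ iB).
by apply: HB; exact: fsubsetUr.
Qed.

End UnorderedSums.

(** * Dirichlet series of polynomial growth *)

Section Growth.
Variables (R : realType) (G : groupType) (H K : set G).
Local Notation C := R[i].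
Local Notation size D := (Defs.card (lcosets_of D K)).

Lemma npow_real n (x : R) : npow n x%:C%C = (expR (- x * ln n%:R))%:C%C :> C.
Proof.
rewrite /npow -real_complexN -real_complexM /cexp; simpl.
by rewrite cos0 sin0 complexr0 -real_complexM mulr1.
Qed.

Lemma norm_npow n (s : C) : `|npow n s| = npow n (complex.Re s)%:C%C.
Proof.
rewrite npow_real norm_cexp; congr (expR _)%:C%C.
by case: s => x y; simpl; rewrite mulr0 subr0.
Qed.

Lemma npowM m n (s : C) : (0 < m)%N -> (0 < n)%N ->
  npow (m * n) s = npow m s * npow n s.
Proof.
move=> m0 n0; rewrite /npow natrM lnM ?posrE ?ltr0n// real_complexD mulrDr.
by rewrite cexpD.
Qed.

Lemma npow_gt0 n (x : R) : 0 < npow n x%:C%C :> C.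
Proof. by rewrite npow_real ltcR expR_gt0. Qed.

(** An orbit of [n] points weighted n^(-s-1) each amounts to one term n^(-s); this trades double
    cosets for points. *)
Lemma npow_shift1 n (s : C) : (0 < n)%N -> n%:R * npow n (s + 1) = npow n s.
Proof.
move=> n0; rewrite /npow opprD mulrDl cexpD mulrCA mulN1r.
suff -> : n%:R * cexp (- (ln n%:R)%:C%C) = 1 :> C by rewrite mulr1.
rewrite -real_complexN /cexp; simpl.
rewrite cos0 sin0 complexr0 expRN lnK ?posrE ?ltr0n//.
by rewrite -(rmorph_nat (real_complex R)) -!real_complexM mulr1 divff// pnatr_eq0 -lt0n.
Qed.

Lemma sum_inv_sqr_le N : \sum_(n < N) (n.+1%:R ^- 2 : R) <= 2.
Proof.
(* Telescoping form of the bound. For [N = 0] it reads 0 <= 2, because the inverse of 0 is 0. *)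
suff : \sum_(n < N) (n.+1%:R ^- 2 : R) <= 2 - (N%:R)^-1.
  by move=> /le_trans; apply; rewrite lerBlDr lerDl invr_ge0.
elim: N => [|[|N] IH]; first by rewrite big_ord0 invr0 subr0.
  by rewrite big_ord1 expr1n invr1 lerBrDr.
rewrite big_ord_recr/= (le_trans (lerD IH (lexx _)))//.
have a0 : (0 : R) < N.+1%:R by rewrite ltr0n.
rewrite -addrA lerD2l [N.+2%:R](_ : _ = N.+1%:R + 1); last by rewrite natr1.
move: (N.+1%:R) a0 => x x0.
have x1 : 0 < x + 1 by rewrite ltr_wpDr.
rewrite -subr_ge0 (_ : _ - _ = x^-1 * (x + 1) ^- 2).
  by rewrite divr_ge0 ?invr_ge0 ?exprn_ge0// ltW.
by field; rewrite !gt_eqF.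
Qed.

Hypothesis growthP : polynomial_growth R H K.
Hypotheses (H1 : H 1%g) (K1 : K 1%g).

Lemma size_dcoset_gt0 D : dcosets H K D -> (0 < size D)%N.
Proof.
move=> DD; have [fin _ _] := growthP; have := fin D DD => finD.
have [g _ DE] := DD.
rewrite /card cardfs_gt0; apply/fset0Pn.
exists (lcoset g K); rewrite in_fset_set// inE; exists g => //.
by rewrite -DE; exists 1%g, 1%g; rewrite mul1g mulg1.
Qed.

(** The finitely many sizes below the threshold of the O-bound are absorbed into the constant
    through [S], since n^alpha >= 1. *)
Lemma growth_bound : exists2 alpha : R, 0 <= alpha & exists M : R,
  0 <= M /\ forall n, (growth H K n.+1)%:R <= M * expR (alpha * ln n.+1%:R).
Proof.
have [_ _ [alpha a0 /eqO_exP[k k0 [N _ HN]]]] := growthP.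
exists alpha => //; pose S : R := \sum_(m < N) (growth H K m)%:R.
have S0 : 0 <= S by rewrite sumr_ge0.
exists (k + S); split; first by rewrite addr_ge0// ltW.
move=> n; have e1 : 1 <= expR (alpha * ln n.+1%:R).
  by rewrite -[leLHS]expR0 ler_expR mulr_ge0// ln_ge0// ler1n.
have [nN|nN] := leqP N n.+1.
  have := HN _ nN => /=; rewrite !ger0_norm ?powR_ge0//.
  rewrite /powR pnatr_eq0/= => /le_trans; apply.
  by rewrite ler_wpM2r ?expR_ge0// lerDl.
apply: (@le_trans _ _ S); last by rewrite (le_trans _ (ler_peMr _ e1)) ?lerDr ?addr_ge0 // ltW.
rewrite /S (bigD1 (Ordinal nN))//= lerDl sumr_ge0//.
Qed.

Lemma zeta_converges_halfplane :
  exists sigma : R, forall s, sigma < complex.Re s -> zeta_converges H K s.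
Proof.
have [alpha a0 [M [M0 HM]]] := growth_bound.
(* Beyond this abscissa the double cosets of size n contribute at most M n^(-2) in total. *)
exists (alpha + 2) => s sP.
suff [l /has_usum_cvg lP] : exists l, has_usum (zeta_term H K s : set G -> C) l.
  by apply/cvg_ex; exists l.
apply: (@usummable_of_norm _ _ _ (M * 2)) => B.
pose f n : R := expR (- complex.Re s * ln n%:R).
pose B' := [fset D in B | `[< dcosets H K D >]]%fset.
have -> : \sum_(D <- B) `|zeta_term H K s D : C| = (\sum_(D <- B') f (size D))%:C%C.
  rewrite (rmorph_sum (real_complex R)) big_fset/= big_mkcond/=.
  rewrite [RHS]big_mkcond /=; apply: eq_bigr => D _; rewrite /zeta_term.
  by case: ifP; rewrite ?normr0// norm_npow npow_real.
rewrite lecR; pose N := (\max_(D <- B') size D)%N.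
have sz D : D \in B' -> (0 < size D <= N)%N.
  move=> DB; rewrite (leq_bigmax_seq _ DB)// andbT size_dcoset_gt0//.
  by move: DB; rewrite !inE/= => /andP[_ /asboolP].
apply: (@le_trans _ _ (\sum_(n < N) (growth H K n.+1)%:R * f n.+1)).
  rewrite (eq_big_seq (fun D => \sum_(n < N) (size D == n.+1)%:R * f n.+1)); last first.
    move=> D /sz/andP[D0 DN].
    have Dlt : ((size D).-1 < N)%N by rewrite prednK.
    rewrite (bigD1 (Ordinal Dlt))//= prednK// eqxx mul1r big1 ?addr0//.
    move=> i /negP iD; rewrite (_ : (_ == _) = false) ?mul0r//.
    apply/negP => /eqP Di; apply: iD; apply/eqP/val_inj => /=.
    by rewrite Di.
  rewrite exchange_big/=; apply: ler_sum => n _.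
  rewrite -mulr_suml ler_wpM2r ?expR_ge0//.
  rewrite -natr_sum ler_nat /growth /card.
  rewrite (eq_bigr (fun D => if size D == n.+1 then 1%N else 0%N)); last by move=> D _; case: eqP.
  rewrite -big_mkcond sum1_count -size_filter.
  apply: uniq_leq_size; first exact/filter_uniq/fset_uniq.
  move=> D; rewrite mem_filter !inE/= => /andP[/eqP Dn /andP[_ /asboolP DD]].
  have [_ fin _] := growthP.
  by rewrite in_fset_set ?inE//; exact: fin.
apply: (@le_trans _ _ (\sum_(n < N) M * n.+1%:R ^- 2)); last first.
  by rewrite -mulr_sumr ler_wpM2l// sum_inv_sqr_le.
apply: ler_sum => n _.
apply: (@le_trans _ _ (M * expR (alpha * ln n.+1%:R) * f n.+1)).
  by rewrite ler_wpM2r ?expR_ge0.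
rewrite -mulrA ler_wpM2l// -expRD -mulrDl.
rewrite -[X in _ <= X ^- 2]lnK ?posrE ?ltr0n// -expRM_natl -expRN ler_expR.
by rewrite -mulNr ler_wpM2r ?ln_ge0 ?ler1n// lerBlDr -lerBlDl opprK addrC ltW// addrC.
Qed.

Lemma norm_zeta_term (s : C) D :
  `|zeta_term H K s D : C| = zeta_term H K (complex.Re s)%:C%C D :> C.
Proof. by rewrite /zeta_term; case: ifP; rewrite ?normr0// norm_npow. Qed.

(** * From partial sums to the determinant formula *)

Section Assembly.
Variables (n : nat) (E : C -> 'M[C]_n) (a : C -> 'rV[C]_n) (b : 'cV[C]_n).
Variables (c : C -> C) (A : nat -> {fset set G}).
Hypotheses (Ep : forall i j, expoly (fun s => E s i j))
  (ap : forall j, expoly (fun s => a s 0 j)) (cp : expoly c).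
Hypothesis exhaust : forall D, dcosets H K D ->
  exists N0, forall N, (N0 <= N)%N -> D \in A N.
Hypothesis partial : forall s N, \sum_(D <- A N) (zeta_term H K s D : C) =
  c s + \sum_(k < N) (a s *m E s ^+ k *m b) 0 0.
Hypothesis normE : forall s i j, `|E s i j| = E (complex.Re s)%:C%C i j.
Hypothesis a_ge0 : forall (x : R) j, 0 <= a x%:C%C 0 j.
Hypothesis c_ge0 : forall x : R, 0 <= c x%:C%C.
Hypothesis b_ge0 : forall i, 0 <= b i 0.
Hypothesis reach : forall x : R, let Ex := E x%:C%C in
  null (fun k => (a x%:C%C *m Ex ^+ k *m b) 0 0) -> null_mx (fun k => Ex ^+ k *m b).
Hypothesis reach_pos : forall (x : R) i, exists k, 0 < (E x%:C%C ^+ k *m b) i 0.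

(** The norms of the terms at [s] are the terms at its real part, and their bounded partial sums
    dominate the nonnegative series of the scalars a E^k b. These scalars therefore tend to 0, and
    [reach] turns this into decay of the columns E^k b. *)
Lemma null_powers_of_converges s : zeta_converges H K s -> null_mx (fun k => E s ^+ k).
Proof.
move=> /has_usum_sum/has_usum_bounded[M HM].
pose x := complex.Re s.
have Ex0 i j : 0 <= E x%:C%C i j by rewrite -normE.
have Ek0 k i j : 0 <= (E x%:C%C ^+ k) i j.
  elim: k i j => [|k IH] i j; first by rewrite expr0 mxE ler0n.
  by rewrite exprS mxE sumr_ge0// => l _; rewrite mulr_ge0.
apply: (@null_powers_of_reach _ _ _ (E x%:C%C) b) => //.
- by move=> i j; rewrite normE.
- apply: reach; apply: (@null_bounded_series _ _ M) => [k|N].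
    rewrite mxE sumr_ge0// => l _; rewrite mulr_ge0// mxE sumr_ge0// => l' _.
    by rewrite mulr_ge0.
  apply: le_trans (HM (A N)).
  rewrite (eq_bigr _ (fun D _ => norm_zeta_term s D)) partial.
  by rewrite lerDr.
Qed.

(** The sums over [A N] converge to the zeta value and, by the geometric series, to the quotient of
    determinants plus [c s - 1]. *)
Lemma zeta_determinant s : zeta_converges H K s ->
  \det (1%:M - E s) <> 0 /\
  zeta H K s = \det (1%:M - E s + b *m a s) / \det (1%:M - E s) + (c s - 1).
Proof.
move=> zc; have EN := null_powers_of_converges zc.
split; first exact/eqP/det_1sub_neq0.
have ex D : zeta_term H K s D != 0 -> exists N0, forall N, (N0 <= N)%N -> D \in A N.

  rewrite /zeta_term; case: ifP => [/asboolP /exhaust//|_]; by rewrite eqxx.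
have := has_usum_exhaust (has_usum_sum zc) ex => /null_limit_unique; apply.
apply: (null_ext _ (geometric_limit (a s) b EN)) => N.
by rewrite partial; ring.
Qed.

Lemma determinant_formula_of_series :
  determinant_formula H K E (fun s => b *m a s) (fun s => c s - 1).
Proof.
have bap i j : expoly (fun s => (b *m a s) i j).
  apply: expoly_mulmx => [k l|k l]; first exact: expoly_cst.
  by rewrite ord1; exact: ap.
have [sigma sigmaP] := zeta_converges_halfplane.
split.
- by move=> i j; split; apply: expoly_entire.
- by exists sigma.
- exact: zeta_determinant.
- exists (fun s => \det (1%:M - E s + b *m a s) / \det (1%:M - E s) + (c s - 1)).
  split; last by move=> s /zeta_determinant[].
  have Dp i j : expoly (fun s => (1%:M - E s) i j).
    apply: (@expoly_ext _ (fun s => (1%:M : 'M[C]_n) i j + - E s i j)) => [s|].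
      by rewrite !mxE.
    by apply: expolyD; [exact: expoly_cst|exact: expolyN].
  apply: expoly_meromorphic.
  + apply: expoly_det => i j.
    apply: (@expoly_ext _ (fun s => (1%:M - E s) i j + (b *m a s) i j)) => [s|].
      by rewrite !mxE.
    by apply: expolyD.
  + exact: expoly_det.
  + by apply: expolyD => //; exact: expoly_cst.
  (* The denominator is not identically 0, since the series converges at this point. *)
  + exists (sigma + 1)%:C%C; apply/eqP.
    have [|+ _] := @zeta_determinant (sigma + 1)%:C%C; last by [].
    by apply: sigmaP; rewrite ltrDl.
Qed.

End Assembly.

End Growth.

(** * Geodesics and branches in a tree *)

Section TreeGeodesics.
Variables (V E : eqType) (T : graph V E).
Implicit Types (v w : V) (e f : E) (p : seq E).

Lemma ter_bar e : ter T (bar T e) = org T e.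
Proof. by rewrite -org_bar (barK T). Qed.

Lemma walk_cat v p p' : walk T v (p ++ p') = walk T v p && walk T (walk_end T v p) p'.
Proof.
elim: p v => [|e p IH] v //=.
by rewrite IH andbA.
Qed.

Lemma walk_end_cat v p p' : walk_end T v (p ++ p') = walk_end T (walk_end T v p) p'.
Proof. by rewrite /walk_end map_cat last_cat. Qed.

Lemma walk_end_rcons v p e : walk_end T v (rcons p e) = ter T e.
Proof. by rewrite -cats1 walk_end_cat. Qed.

Lemma walk_end_cons v e p : walk_end T v (e :: p) = ter T (last e p).
Proof. by rewrite /walk_end/= (last_map (ter T)). Qed.

Definition rev_path p := rev (map (bar T) p).

Lemma rev_path_cons e p : rev_path (e :: p) = rcons (rev_path p) (bar T e).
Proof. by rewrite /rev_path/= rev_cons. Qed.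

Lemma walk_rev v p : walk T v p ->
  walk T (walk_end T v p) (rev_path p) /\ walk_end T (walk_end T v p) (rev_path p) = v.
Proof.
elim: p v => [|e p IH] v //= /andP[/eqP ev /IH[W1 W2]].
rewrite rev_path_cons -cats1 walk_cat walk_end_cat.
rewrite [walk_end _ v _]/walk_end/= -/(walk_end T (ter T e) p) W1 W2/=.
by rewrite org_bar eqxx /walk_end/= ter_bar ev.
Qed.

Lemma reduced_rev p : reduced T (rev_path p) = reduced T p.
Proof.
rewrite /reduced /rev_path rev_sorted sorted_map; apply: eq_sorted => e f /=.
by rewrite (barK T) eq_sym.
Qed.

Lemma geodesic_rev v p : geodesic T v p -> geodesic T (walk_end T v p) (rev_path p).
Proof. by move=> /andP[/walk_rev[W _] red]; rewrite /geodesic W reduced_rev. Qed.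

Lemma geodesic_catr v p p' : geodesic T v (p ++ p') -> geodesic T (walk_end T v p) p'.
Proof.
by rewrite /geodesic walk_cat => /andP[/andP[_ ->]] /cat_sorted2[].
Qed.

Lemma geodesic_catl v p p' : geodesic T v (p ++ p') -> geodesic T v p.
Proof.
by rewrite /geodesic walk_cat => /andP[/andP[-> _]] /cat_sorted2[].
Qed.

Lemma geodesic_cons2 v e f p :
  geodesic T v (e :: f :: p) = [&& org T e == v, f != bar T e & geodesic T (ter T e) (f :: p)].
Proof. by rewrite /geodesic/= -!andbA; do !bool_congr. Qed.

Lemma geodesic_rcons2 v p e f :
  geodesic T v (rcons (rcons p e) f) =
  [&& geodesic T v (rcons p e), org T f == ter T e & f != bar T e].
Proof.
rewrite /geodesic -[rcons (rcons p e) f]cats1 walk_cat walk_end_rcons/= andbT.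
rewrite cats1 /reduced -[rcons (rcons _ _) _]cats1 cat_rcons sorted_cat_cons/= andbT.
by rewrite -!andbA; congr (_ && _); rewrite andbCA.
Qed.

Hypothesis treeT : is_tree T.

(** If the first edges differ, the reverse of one path followed by the other is reduced, closed and
    not empty, which a tree forbids. *)
Lemma geodesic_unique v p p' : geodesic T v p -> geodesic T v p' ->
  walk_end T v p = walk_end T v p' -> p = p'.
Proof.
have [_ _ closed] := treeT.
elim: p v p' => [|e p IH] v [|e' p'] //.
- by move=> _ G E1; rewrite (closed _ _ G)// -E1.
- by move=> G _ E1; rewrite (closed _ _ G).
move=> G G' E1; have [ee'|ee'] := eqVneq e e'.
  subst e'; congr (_ :: _); apply: (IH (ter T e)) => //.
  - exact: (@geodesic_catr v [:: e]).
  - exact: (@geodesic_catr v [:: e]).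
have := geodesic_rev G; set x := walk_end T v _ => GR.
have [_ EndR] := walk_rev (andP G).1.
suff /closed : geodesic T x (rev_path (e :: p) ++ e' :: p').
  by rewrite walk_end_cat EndR -E1 => /(_ erefl) => //; case: (rev_path _).
move: GR G'; rewrite /geodesic walk_cat EndR => /andP[-> R1] /andP[-> R2]/=.
rewrite rev_path_cons cat_rcons /reduced sorted_cat_cons -rev_path_cons.
by rewrite [sorted _ _]R1/= (barK T) eq_sym ee'.
Qed.

Lemma org_neq_ter e : org T e <> ter T e.
Proof.
have [_ _ closed] := treeT => ee.
by have := closed (org T e) [:: e]; rewrite /geodesic/= eqxx => /(_ erefl (esym ee)).
Qed.

Lemma exists_org v : [set: E] !=set0 -> exists e, org T e = v.
Proof.
move=> [e0 _]; have [_ conn _] := treeT.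
have [[|e p] W EndP] := conn v (org T e0); first by exists e0; rewrite -EndP.
by exists e; move: W => /= /andP[/eqP].
Qed.

Lemma edge_ext e f : org T e = org T f -> ter T e = ter T f -> e = f.
Proof.
move=> oe te; suff [] : [:: e] = [:: f] by [].
by apply: (@geodesic_unique (org T e)); rewrite // /geodesic/= ?oe ?eqxx.
Qed.

(* coreV and coreE are the vertices and the edges of a subtree; branch n lists
   the edges that point away from it, at distance n. *)
Section Core.
Variables (coreV : seq V) (coreE : seq E) (star : V -> seq E).
Hypothesis mem_star : forall v e, (e \in star v) = (org T e == v).
Hypothesis uniq_star : forall v, uniq (star v).
Hypothesis uniq_coreV : uniq coreV.
Hypothesis core_edge : forall c d, c \in coreV -> d \in coreV -> c != d ->
  exists2 e, e \in coreE & org T e = c /\ ter T e = d.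
Hypothesis core_org : forall e, e \in coreE -> org T e \in coreV.
Hypothesis core_bar : forall e, e \in coreE -> bar T e \in coreE.
Hypothesis core_neq0 : exists c, c \in coreV.

Definition next_edges e := [seq f <- star (ter T e) | f != bar T e].

Lemma mem_next_edges e f : (f \in next_edges e) = (f != bar T e) && (org T f == ter T e).
Proof. by rewrite mem_filter mem_star. Qed.

Fixpoint branch n : seq E :=
  if n is m.+1 then flatten [seq next_edges e | e <- branch m]
  else [seq e <- flatten [seq star c | c <- coreV] | e \notin coreE].

Lemma branch0P e : reflect (org T e \in coreV /\ e \notin coreE) (e \in branch 0).
Proof.
rewrite /= mem_filter; apply: (iffP andP) => [[-> /flatten_mapP[c cV]]|[oV ->]].
  by rewrite mem_star => /eqP ->.
by split=> //; apply/flatten_mapP; exists (org T e); rewrite ?mem_star.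
Qed.

Lemma branchSP n f :
  reflect (exists2 e, e \in branch n & f \in next_edges e) (f \in branch n.+1).
Proof. exact: flatten_mapP. Qed.

(** Recovers the path behind an edge of [branch n]; it leaves the core with its very first edge. *)
Lemma branch_geodesic n e : e \in branch n -> exists c f p,
  [/\ c \in coreV, geodesic T c (f :: p), f \notin coreE, last f p = e & size p = n].
Proof.
elim: n e => [|n IH] e.
  by move=> /branch0P[oV eC]; exists (org T e), e, [::]; split; rewrite // /geodesic/= eqxx.
move=> /branchSP[d /IH[c [f [p [cV G fC lp sp]]]]]; rewrite mem_next_edges => /andP[ed oe].
exists c, f, (rcons p e); split=> //; rewrite ?last_rcons ?size_rcons ?sp//.
case/lastP: p G lp {sp} => [|p d'] G /=.
  by move=> df; subst f; rewrite geodesic_cons2 ed /geodesic/= oe (andP (andP G).1).1.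
rewrite last_rcons => dd; subst d'.
by rewrite -rcons_cons -rcons_cons geodesic_rcons2 rcons_cons G oe ed.
Qed.

(** If the two geodesics leave the core at different vertices, prefixing a core edge to one of them
    gives both the same ends; uniqueness then makes the other start with a core edge, a
    contradiction. *)
Lemma branch_ter_inj n m e e' : e \in branch n -> e' \in branch m ->
  ter T e = ter T e' -> e = e' /\ n = m.
Proof.
move=> /branch_geodesic[c [f [p [cV G fC <- <-]]]].
move=> /branch_geodesic[c' [f' [p' [cV' G' fC' <- <-]]]] tt.
have [cc|cc] := eqVneq c c'.
  subst c'; have := geodesic_unique G G'.
  by rewrite !walk_end_cons => /(_ tt)[-> ->].
have [ee eC [oe te]] := core_edge cV cV' cc.
have G2 : geodesic T c (ee :: f' :: p').
  rewrite geodesic_cons2 oe te eqxx G' andbT/=.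
  by apply: contraNneq fC' => ->; exact: core_bar.
have := geodesic_unique G G2; rewrite !walk_end_cons => /(_ tt)[fe _].
by rewrite fe eC in fC.
Qed.

Lemma branch_ter n e : e \in branch n -> ter T e \notin coreV.
Proof.
move=> /branch_geodesic[c [f [p [cV G fC <- _]]]]; apply/negP => tV.
have [_ _ closed] := treeT.
have [cc|cc] := eqVneq c (ter T (last f p)).
  by have := closed _ _ G; rewrite walk_end_cons => /(_ (esym cc)).
have [ee eC [oe te]] := core_edge cV tV cc.
have G2 : geodesic T c [:: ee] by rewrite /geodesic/= oe eqxx.
have := geodesic_unique G G2; rewrite !walk_end_cons te => /(_ erefl)[fe _].
by rewrite fe eC in fC.
Qed.

Lemma branch_notin_core n e : e \in branch n -> e \notin coreE.
Proof.
case: n => [/branch0P[]//|n /branchSP[d dB]].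
rewrite mem_next_edges => /andP[_ /eqP oe].
by apply: contra (branch_ter dB); rewrite -oe; exact: core_org.
Qed.

Lemma branch_bar n m e : e \in branch n -> bar T e \in branch m -> False.
Proof.
move=> eB; case: m => [/branch0P[+ _]|m /branchSP[d dB]].
  by rewrite org_bar => eV; have := branch_ter eB; rewrite eV.
rewrite mem_next_edges org_bar => /andP[/eqP ned /eqP ted]; apply: ned.
by have [->] := branch_ter_inj eB dB ted.
Qed.

Lemma core_ter e : e \in coreE -> ter T e \in coreV.
Proof. by move=> /core_bar/core_org; rewrite org_bar. Qed.

(** Induction on a path from the core: beyond the core, its next edge either leads on to the next
    level or reverses the edge [d] just reached, and then it returns to the origin of [d]. *)
Lemma branch_vertex v : v \in coreV \/ exists n e, e \in branch n /\ ter T e = v.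
Proof.
have [c cV] := core_neq0; have [_ conn _] := treeT.
have [p] := conn c v; move: p v; apply: last_ind => [|p e IH] v; first by move=> _ <-; left.
rewrite -cats1 walk_cat walk_end_cat /= andbT => /andP[/IH /(_ erefl) + /eqP oe].
rewrite -oe /walk_end/= => + <- {v}.
case=> [oV|[n [d [dB td]]]].
  have [eC|eC] := boolP (e \in coreE); first by left; exact: core_ter.
  by right; exists 0, e; split=> //; apply/branch0P.
have [ed|ed] := eqVneq e (bar T d).
  rewrite ed ter_bar; case: n dB => [/branch0P[]|n /branchSP[d' dB' ]]; first by left.
  by rewrite mem_next_edges => /andP[_ /eqP ->]; right; exists n, d'.
by right; exists n.+1, e; split=> //; apply/branchSP; exists d; rewrite // mem_next_edges ed td eqxx.
Qed.

Lemma branch_edge e : [\/ e \in coreE, exists n, e \in branch n | exists n, bar T e \in branch n].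
Proof.
have [oV|[n [d [dB td]]]] := branch_vertex (org T e).
  have [eC|eC] := boolP (e \in coreE); first by apply: Or31.
  by apply: Or32; exists 0; apply/branch0P.
have [ed|ed] := eqVneq e (bar T d).
  by apply: Or33; exists n; rewrite ed (barK T).
by apply: Or32; exists n.+1; apply/branchSP; exists d; rewrite // mem_next_edges ed td eqxx.
Qed.

Lemma uniq_flatten_map (I J : eqType) (F : I -> seq J) (s : seq I) : uniq s ->
  (forall i, uniq (F i)) ->
  (forall i j x, i \in s -> j \in s -> x \in F i -> x \in F j -> i = j) ->
  uniq (flatten [seq F i | i <- s]).
Proof.
move=> + uF; elim: s => [|i s IH] //= /andP[ins us] dF.
rewrite cat_uniq uF IH// ?andbT/=; last first.
  by move=> j k x js ks; apply: dF; rewrite inE ?js ?ks orbT.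
apply/hasPn => x /flatten_mapP[j js xj]; apply/negP => xi.
move/negP: ins; apply.
by rewrite (dF i j x _ _ xi xj)// inE ?eqxx// js orbT.
Qed.

Lemma uniq_branch n : uniq (branch n).
Proof.
elim: n => [|n IH] /=.
  rewrite filter_uniq// uniq_flatten_map// => c d e _ _.
  by rewrite !mem_star => /eqP -> /eqP.
apply: uniq_flatten_map => // [e|e e' f eB eB']; first exact: filter_uniq.
rewrite !mem_next_edges => /andP[_ /eqP ->] /andP[_ /eqP tt].
by have [] := branch_ter_inj eB eB' tt.
Qed.

End Core.

End TreeGeodesics.

(** * Orbits and double cosets *)

(** The enclosing list supplies finiteness, without which [card] is 0 by convention, and turns
    cardinals into counts. *)
Lemma card_count (J : choiceType) (P : set J) (s : seq J) : uniq s ->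
  (forall x, P x -> x \in s) -> Defs.card P = count (fun x => `[< P x >]) s.
Proof.
move=> us Ps; have finP : finite_set P.
  by apply: (@sub_finite_set _ _ [set` s]) => [x /Ps//|]; exact: finite_seq.
rewrite /Defs.card -size_filter; apply: perm_size; apply: uniq_perm.
- exact: fset_uniq.
- exact: filter_uniq.
move=> x; rewrite in_fset_set// mem_filter; apply/idP/andP => [/set_mem Px|[/asboolP Px _]]; last exact: mem_set.
by split; [exact/asboolP|exact: Ps].
Qed.

Lemma card_image_inj (J L : choiceType) (P : set J) (F : J -> L) :
  finite_set P -> (forall x y, P x -> P y -> F x = F y -> x = y) ->
  Defs.card (F @` P) = Defs.card P.
Proof.
move=> finP inj; rewrite /Defs.card fset_set_image// card_in_imfset//=.
by move=> x y; rewrite !in_fset_set// !inE; exact: inj.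
Qed.

Section Action.
Variables (G : groupType) (V E : choiceType) (T : graph V E) (A : action G T).

Lemma actVK g v : actV A g^-1%g (actV A g v) = v.
Proof. by rewrite -actVM mulVg actV1. Qed.

Lemma actEK g e : actE A g^-1%g (actE A g e) = e.
Proof. by rewrite -actEM mulVg actE1. Qed.

Lemma actEKV g e : actE A g (actE A g^-1%g e) = e.
Proof. by rewrite -actEM mulgV actE1. Qed.

Lemma actE_inj g : injective (actE A g).
Proof. exact: can_inj (actEK g). Qed.

Lemma actV_inj g : injective (actV A g).
Proof. exact: can_inj (actVK g). Qed.

Lemma act_ter g e : ter T (actE A g e) = actV A g (ter T e).
Proof. by rewrite -org_bar -act_bar act_org org_bar. Qed.

Lemma act_mul g h t : act A (g * h)%g t = act A g (act A h t).
Proof. by case: t => x /=; rewrite ?actVM ?actEM. Qed.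

Lemma act_one t : act A 1%g t = t.
Proof. by case: t => x /=; rewrite ?actV1 ?actE1. Qed.

Lemma actK g t : act A g^-1%g (act A g t) = t.
Proof. by rewrite -act_mul mulVg act_one. Qed.

Lemma stab1 t : stab A t 1%g.
Proof. exact: act_one. Qed.

Lemma stabM t g h : stab A t g -> stab A t h -> stab A t (g * h)%g.
Proof. by rewrite /stab/= act_mul => gt ->. Qed.

Lemma stabV t g : stab A t g -> stab A t g^-1%g.
Proof. by rewrite /stab/= => gt; rewrite -{1}gt actK. Qed.

Definition act_orbit (H : set G) t : set (V + E) := [set act A h t | h in H].

Section DoubleCosetsAsOrbits.
Variables (t1 t2 : V + E).
Local Notation H := (stab A t1).
Local Notation K := (stab A t2).

(** The double coset attached to a point [t] of the orbit of [t2], described without choosing an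
    element that carries [t2] to [t]. *)
Definition coset_to t : set G := [set x | exists2 h, H h & act A x t2 = act A h t].

Lemma coset_toE g : coset_to (act A g t2) = dcoset H g K.
Proof.
apply/seteqP; split=> x /=.
  move=> [h Hh xh]; exists h, ((h * g)^-1 * x)%g; split=> //.
    by rewrite /stab/= act_mul xh -(act_mul h g) actK.
  by rewrite mulgA mulgV mul1g.
move=> [h [k [Hh Kk ->]]]; exists h => //.
by rewrite !act_mul (_ : act A k t2 = t2).
Qed.

Lemma coset_to_eq g t : coset_to (act A g t2) = coset_to t <-> act_orbit H t (act A g t2).
Proof.
split=> [E1|[h Hh ht]].
  have : coset_to (act A g t2) g by exists 1%g; [exact: stab1|rewrite act_one].
  by rewrite E1 => -[h Hh hg]; exists h.
apply/seteqP; split=> x [h' Hh' hx].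
  exists (h' * h)%g; first exact: stabM.
  by rewrite hx -ht act_mul.
exists (h' * h^-1)%g; first by apply: stabM => //; exact: stabV.
by rewrite hx act_mul -ht actK.
Qed.

(** A point of the orbit corresponds to the left coset of the elements carrying [t2] to it. *)
Lemma card_coset_to g : finite_set (act_orbit H (act A g t2)) ->
  Defs.card (lcosets_of (coset_to (act A g t2)) K) = Defs.card (act_orbit H (act A g t2)).
Proof.
move=> fin.
rewrite -(@card_image_inj _ _ (act_orbit H (act A g t2)) (fun t => [set x | act A x t2 = t]))//.
  congr Defs.card; apply/seteqP; split=> D.
    move=> [x [h Hh hx] <-]; exists (act A x t2); first by exists h.
    apply/seteqP; split=> y /= => [yx|[k Kk <-]]; last by rewrite act_mul (_ : act A k t2 = t2).
    exists (x^-1 * y)%g; last by rewrite mulgA mulgV mul1g.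
    by rewrite /stab/= act_mul yx actK.
  move=> [_ [h Hh <-] <-]; exists (h * g)%g.
    by exists h; rewrite // act_mul.
  apply/seteqP; split=> y /= => [[k Kk <-]|yx].
    by rewrite !act_mul (_ : act A k t2 = t2).
  exists ((h * g)^-1 * y)%g; last by rewrite mulgA mulgV mul1g.
  by rewrite /stab/= act_mul yx -(act_mul h g) actK.
move=> x y [h Hh <-] _ /seteqP[+ _] => /(_ (h * g)%g) /=.
by rewrite act_mul => /(_ erefl).
Qed.

Variable R : realType.
Local Notation C := R[i].

(* An orbit of size m contributes m terms m^-(s+1). *)
Lemma sum_zeta_terms (L : seq (V + E)) (s : C) : uniq L ->
  (forall t, t \in L -> exists g, t = act A g t2) ->
  (forall h t, H h -> t \in L -> act A h t \in L) ->
  \sum_(D <- [fset coset_to t | t in L]%fset) (zeta_term H K s D : C) =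
  \sum_(t <- L) npow (Defs.card (act_orbit H t)) (s + 1).
Proof.
move=> uL Lt2 LH.
have orbL t x : t \in L -> act_orbit H t x -> x \in L by move=> tL [h Hh <-]; exact: LH.
pose L' := [fset t in L]%fset.
have -> : [fset coset_to t | t in L]%fset = [fset coset_to t | t in L']%fset.
  apply/fsetP => D; apply/imfsetP/imfsetP => -[t /= tL ->]; exists t => //=.
    by rewrite !inE.
  by move: tL; rewrite !inE.
transitivity (\sum_(t <- L') npow (Defs.card (act_orbit H t)) (s + 1)); last first.
  apply: perm_big; apply: uniq_perm => // t; by rewrite !inE.
rewrite (partition_big_imfset _ coset_to)/=.
apply: eq_big_seq => D /imfsetP[t0 /=]; rewrite !inE => t0L ->.
have [g0 t0E] := Lt2 _ t0L.
have finO : finite_set (act_orbit H t0).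
  by apply: (@sub_finite_set _ _ [set` L]) => [x /(orbL _ _ t0L)//|]; exact: finite_seq.
have orbE t : t \in L -> (coset_to t == coset_to t0) = `[< act_orbit H t0 t >].
  move=> tL; have [g ->] := Lt2 _ tL.
  by apply/eqP/asboolP; rewrite coset_to_eq.
have eqO t : act_orbit H t0 t -> act_orbit H t = act_orbit H t0.
  move=> [h Hh <-]; apply/seteqP; split=> x [k Hk <-].
    by exists (k * h)%g; [exact: stabM|rewrite act_mul].
  exists (k * h^-1)%g; last by rewrite act_mul actK.
  by apply: stabM => //; exact: stabV.
have c0 : (0 < Defs.card (act_orbit H t0))%N.
  rewrite /Defs.card cardfs_gt0; apply/fset0Pn; exists t0.
  by rewrite in_fset_set// inE; exists 1%g; [exact: stab1|exact: act_one].
have -> : zeta_term H K s (coset_to t0) = npow (Defs.card (act_orbit H t0)) s :> C.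
  rewrite /zeta_term asboolT; first by rewrite t0E card_coset_to// -t0E.
  by exists g0; rewrite // t0E coset_toE.
rewrite -npow_shift1// (card_count (s := L'))//; last first.
  by move=> x /(orbL _ _ t0L); rewrite !inE.
rewrite big_seq_cond (eq_bigl (fun t => (t \in L') && `[< act_orbit H t0 t >])); last first.
  by move=> t; rewrite !inE; case tL : (t \in L) => //=; rewrite orbE.
rewrite -big_seq_cond (eq_bigr (fun=> npow (Defs.card (act_orbit H t0)) (s + 1))); last first.
  by move=> t /asboolP/eqO ->.
rewrite (card_count (s := L'))//; last by move=> x /(orbL _ _ t0L); rewrite !inE.
rewrite big_const_seq iter_addr_0 -[RHS]mulr_natl//.
Qed.

End DoubleCosetsAsOrbits.
End Action.

(** * Counting orbits along branches *)

Section Branches.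
Variables (R : realType) (G : groupType) (V E : choiceType) (T : graph V E).
Variables (A : action G T) (VG EG : finType) (Gam : graph VG EG).
Variable q : quotient_graph A Gam.
Local Notation C := R[i].
Hypothesis treeT : is_tree T.
Hypothesis finT : locally_finite T.

Definition star v : seq E := fset_set [set e | org T e = v].

Lemma mem_star v e : (e \in star v) = (org T e == v).
Proof.
rewrite /star in_fset_set; last exact: finT.
by apply/idP/eqP => [/set_mem|oe]; [|apply: mem_set].
Qed.

Lemma uniq_star v : uniq (star v).
Proof. exact: fset_uniq. Qed.

Lemma pi_ter e : ter Gam (piE q e) = piV q (ter T e).
Proof. by rewrite -org_bar -pi_bar pi_org org_bar. Qed.

Lemma piE_act g e : piE q (actE A g e) = piE q e.
Proof. by apply/esym/(piE_orbit q); exists g. Qed.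

Lemma piV_act g v : piV q (actV A g v) = piV q v.
Proof. by apply/esym/(piV_orbit q); exists g. Qed.

Local Notation succs := (next_edges T star).

Lemma succs_act g e f : (actE A g f \in succs (actE A g e)) = (f \in succs e).
Proof.
rewrite !(mem_next_edges mem_star) act_org act_ter -act_bar.
by rewrite (inj_eq (@actE_inj _ _ _ _ A g)) (inj_eq (@actV_inj _ _ _ _ A g)).
Qed.

Lemma perm_succs_act g e : perm_eq (succs (actE A g e)) (map (actE A g) (succs e)).
Proof.
apply: uniq_perm.
- exact/filter_uniq/uniq_star.
- by rewrite map_inj_uniq; [exact/filter_uniq/uniq_star|exact: actE_inj].
move=> f; apply/idP/mapP => [fs|[f' fs ->]]; last by rewrite succs_act.
by exists (actE A g^-1%g f); rewrite ?actEKV// -(succs_act g) actEKV.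
Qed.

(** The full stabiliser of [e] acts here, not only that of a geodesic ending with [e]; so the number
    is invariant under [G] and does not depend on the position of [e] in the branches. *)
Definition step (e f : E) : nat :=
  Defs.card [set actE A g f | g in [set g | actE A g e = e]].

Lemma step_count e f : f \in succs e ->
  step e f = count (fun f' => `[< exists2 g, actE A g e = e & actE A g f = f' >]) (succs e).
Proof.
move=> fs; apply: card_count; first exact/filter_uniq/uniq_star.
by move=> _ [g /= ge <-]; rewrite -{1}ge succs_act.
Qed.

Lemma step_gt0 e f : f \in succs e -> (0 < step e f)%N.
Proof.
move=> fs; rewrite step_count// -has_count; apply/hasP; exists f => //.
by apply/asboolP; exists 1%g; rewrite actE1.
Qed.

Variables (coreV : seq V) (coreE : seq E).
Hypothesis uniq_coreV : uniq coreV.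
Hypothesis core_edge : forall c d, c \in coreV -> d \in coreV -> c != d ->
  exists2 e, e \in coreE & org T e = c /\ ter T e = d.
Hypothesis core_bar : forall e, e \in coreE -> bar T e \in coreE.

Local Notation branch := (branch T coreV coreE star).

Variable H : set G.
Hypothesis H1 : H 1%g.
Hypothesis HM : forall g h, H g -> H h -> H (g * h)%g.
Hypothesis HV : forall g, H g -> H g^-1%g.
Hypothesis H_coreV : forall h c, H h -> c \in coreV -> actV A h c = c.
Hypothesis H_coreE : forall h e, H h -> e \in coreE -> actE A h e = e.

Lemma uniq_branch_star n : uniq (branch n).
Proof. by apply: uniq_branch => //; [exact: mem_star|exact: uniq_star]. Qed.

Lemma branch_act h n e : H h -> e \in branch n -> actE A h e \in branch n.
Proof.
move=> Hh; elim: n e => [|n IH] e.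
  move=> /(branch0P _ _ mem_star)[oV eC]; apply/(branch0P _ _ mem_star); split.
    by rewrite act_org H_coreV.
  apply: contra eC => eC.
  by rewrite -(actEK A h e) H_coreE//; exact: HV.
move=> /branchSP[d dB es]; apply/branchSP; exists (actE A h d); first exact: IH.
by rewrite succs_act.
Qed.

Definition orbE e : set E := [set actE A h e | h in H].

Lemma orbE_refl e : orbE e e.
Proof. by exists 1%g; rewrite // actE1. Qed.

Lemma card_orbE n e : e \in branch n ->
  Defs.card (orbE e) = count (fun f => `[< orbE e f >]) (branch n).
Proof.
move=> eB; apply: card_count; first exact: uniq_branch_star.
by move=> _ [h Hh <-]; exact: branch_act.
Qed.

Lemma finite_orbE n e : e \in branch n -> finite_set (orbE e).
Proof.
move=> eB; apply: (@sub_finite_set _ _ [set` branch n]); last exact: finite_seq.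
by move=> _ [h Hh <-]; exact: branch_act.
Qed.

Lemma card_orbE_gt0 n e : e \in branch n -> (0 < Defs.card (orbE e))%N.
Proof.
move=> eB; rewrite (card_orbE eB) -has_count; apply/hasP; exists e => //.
exact/asboolP/orbE_refl.
Qed.

(* The only consequence of weak local transitivity or of property (P) that is
   needed to count orbits. *)
Hypothesis independence : forall n e f h, e \in branch n -> f \in succs e ->
  actE A h e = e -> exists2 k, H k & actE A k e = e /\ actE A k f = actE A h f.

(** An edge determines its predecessor, so the [H]-orbit of [f] is fibred over that of [e]. By
    [independence] the fibre over [e] is the whole orbit of [f] under the stabiliser of [e]. *)
Lemma card_orbE_succ n e f : e \in branch n -> f \in succs e ->
  Defs.card (orbE f) = (Defs.card (orbE e) * step e f)%N.
Proof.
move=> eB fs; have fB : f \in branch n.+1 by apply/branchSP; exists e.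
rewrite (card_orbE fB) (card_orbE eB) /= count_flatten sumnE !big_map.
rewrite -sum1_count big_distrl/= [RHS]big_mkcond/=.
apply: eq_big_seq => e' e'B; case: ifPn => [/asboolP[h Hh he]|/asboolP ne]; last first.
  apply/eqP; rewrite -leqn0 leqNgt -has_count; apply/hasPn => f' f's.
  apply/asboolP => -[h Hh hf]; apply: ne; exists h => //.
  have fB' : actE A h e \in branch n by exact: branch_act.
  have [] // := branch_ter_inj treeT mem_star core_edge core_bar fB' e'B.
  move: fs f's; rewrite -hf !(mem_next_edges mem_star) => /andP[_ /eqP fe] /andP[_ /eqP <-].
  by rewrite act_ter -fe act_org.
(* Translation by [h] carries the fibre over [e] to the fibre over [e']. *)
rewrite -he (permP (perm_succs_act h e)) count_map mul1n step_count//.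
apply: eq_in_count => x xs /=; apply/asboolP/asboolP => [[k Hk kf]|[g ge gf]].
  exists (h^-1 * k)%g; last by rewrite actEM kf actEK.
  have kB : actE A (h^-1 * k)%g e \in branch n.
    by apply: branch_act => //; apply: HM => //; exact: HV.
  have [] // := branch_ter_inj treeT mem_star core_edge core_bar kB eB.
  move: fs xs; rewrite !(mem_next_edges mem_star) => /andP[_ /eqP fe] /andP[_ /eqP <-].
  by rewrite act_ter -fe -act_org actEM kf actEK.
have [k Hk [_ kf]] := independence eB fs ge.
by exists (h * k)%g; [exact: HM|rewrite actEM kf gf].
Qed.

Variables (I : finType) (lab : I -> EG) (mE : C -> 'M[C]_#|I|).
Hypothesis lab_surj : forall b, exists i, lab i = b.

(** The recurrence only involves columns that are constant on each label, so the index set may be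
    finer than the set of edges of the quotient. *)
Definition label_col (z : EG -> C) : 'cV[C]_#|I| := \col_i z (lab (enum_val i)).

Hypothesis transfer : forall s z i e, piE q e = lab (enum_val i) ->
  (mE s *m label_col z) i 0 = \sum_(f <- succs e) npow (step e f) (s + 1) * z (piE q f).

Definition label_rep b : 'I_#|I| := enum_rank (sval (cid (lab_surj b))).

Lemma lab_label_rep b : lab (enum_val (label_rep b)) = b.
Proof. by rewrite /label_rep enum_rankK; case: cid. Qed.

(** By [transfer] all rows with the label [b] give the same entry, so the choice of representative
    does not matter. *)
Definition transfer_op s (z : EG -> C) : EG -> C := fun b => (mE s *m label_col z) (label_rep b) 0.

Lemma transfer_opE s z e : transfer_op s z (piE q e) =
  \sum_(f <- succs e) npow (step e f) (s + 1) * z (piE q f).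
Proof. by rewrite /transfer_op; apply: transfer; rewrite lab_label_rep. Qed.

Lemma mul_label_col s z : mE s *m label_col z = label_col (transfer_op s z).
Proof.
apply/colP => i; rewrite [RHS]mxE.
have [e ei] := piE_surj q (lab (enum_val i)).
by rewrite -ei transfer_opE; exact: transfer.
Qed.

Lemma mulX_label_col s z k : mE s ^+ k *m label_col z = label_col (iter k (transfer_op s) z).
Proof.
elim: k => [|k IH]; first by rewrite expr0 mul1mx.
by rewrite exprS -[_ * _]/(_ *m _) -mulmxA IH mul_label_col.
Qed.

Definition branch_sum s n (z : EG -> C) : C :=
  \sum_(e <- branch n) npow (Defs.card (orbE e)) (s + 1) * z (piE q e).

(** Orbit sizes multiply from an edge to its successors, so propagating the weights by one level is
    dual to the transfer operator. *)
Lemma branch_sumS s n z : branch_sum s n.+1 z = branch_sum s n (transfer_op s z).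
Proof.
rewrite /branch_sum /= big_flatten big_map; apply: eq_big_seq => e eB.
rewrite transfer_opE mulr_sumr; apply: eq_big_seq => f fs.
rewrite (card_orbE_succ eB fs) npowM ?mulrA//; first exact: card_orbE_gt0 eB.
exact: step_gt0.
Qed.

Lemma branch_sumD s n k z : branch_sum s (n + k) z = branch_sum s n (iter k (transfer_op s) z).
Proof.
elim: k z => [|k IH] z; first by rewrite addn0.
by rewrite addnS branch_sumS IH -iterSr.
Qed.

Variables (ra : C -> 'rV[C]_#|I|) (S : pred EG).
Hypothesis start : forall s z, (ra s *m label_col z) 0 0 = branch_sum s 0 z.

Definition char_fun : EG -> C := fun b => (S b)%:R.

Lemma series_term s k : (ra s *m mE s ^+ k *m label_col char_fun) 0 0 = branch_sum s k char_fun.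
Proof. by rewrite -mulmxA mulX_label_col start -branch_sumD add0n. Qed.

Hypothesis two_lifts : forall v b e, piV q v = org Gam b ->
  exists2 f, f != e & org T f = v /\ piE q f = b.

(** A path of the tree is followed in the quotient. The closure condition also lets [a] be followed
    by its inverse: with two lifts at each vertex, a geodesic can continue over the reversed
    edge. *)
Lemma EG_reach (P : EG -> Prop) : (exists b, P b) ->
  (forall a b, P a -> ter Gam a = org Gam b -> P b) -> forall b, P b.
Proof.
move=> [a Pa] PS b.
have [e ea] := piE_surj q a; have [f fb] := piE_surj q b.
have [_ conn _] := treeT; have [p W EndP] := conn (ter T e) (org T f).
have {a Pa ea} : P (piE q e) by rewrite ea.
elim: p e W EndP => [|d p IH] e /=.
  by rewrite /walk_end/= => _ te Pe; rewrite -fb; apply: PS Pe _; rewrite pi_ter pi_org te.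
move=> /andP[/eqP od W] EndP Pe; apply: (IH d W EndP).
by apply: PS Pe _; rewrite pi_ter pi_org od.
Qed.

Hypothesis branch_neq0 : exists e, e \in branch 0.

Lemma branch_over b : exists n e, e \in branch n /\ piE q e = b.
Proof.
move: b; apply: EG_reach; first by have [e eB] := branch_neq0; exists (piE q e), 0%N, e.
move=> a b [n [e [eB ea]]] ab.
have vb : piV q (ter T e) = org Gam b by rewrite -ab -ea pi_ter.
have [f fe [of_ fb]] := two_lifts (bar T e) vb.
exists n.+1, f; split=> //; apply/branchSP; exists e => //.
by rewrite (mem_next_edges mem_star) fe of_ eqxx.
Qed.

Section RealExponent.
Variable x : R.
Local Notation s := (x%:C%C).

Lemma npow_real_gt0 n : 0 < npow n (s + 1) :> C.
Proof. by rewrite -(rmorph1 (real_complex R)) -real_complexD npow_gt0. Qed.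

Lemma transfer_op_ge0 z : (forall b, 0 <= z b) -> forall b, 0 <= transfer_op s z b.
Proof.
move=> z0 b; have [e <-] := piE_surj q b; rewrite transfer_opE sumr_ge0// => f _.
by rewrite mulr_ge0// ltW// npow_real_gt0.
Qed.

Lemma iter_transfer_op_ge0 k b : 0 <= iter k (transfer_op s) char_fun b.
Proof. by elim: k b => [|k IH] b; [rewrite ler0n|apply: transfer_op_ge0]. Qed.

(** All terms are nonnegative, so a single edge [e] of level n over a given label bounds the
    matching coordinate of the k-th column by a constant times the scalar of index n + k. *)
Lemma series_reach :
  null (fun k => (ra s *m mE s ^+ k *m label_col char_fun) 0 0) ->
  null_mx (fun k => mE s ^+ k *m label_col char_fun).
Proof.
move=> N i j; rewrite (ord1 j).
have [n [e [eB ei]]] := branch_over (lab (enum_val i)).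
pose w := npow (Defs.card (orbE e)) (s + 1) : C.
have w0 : 0 < w by exact: npow_real_gt0.
apply: null_le (nullZ w^-1 (null_shift n N)) => k.
rewrite mulX_label_col mxE -ei series_term addnC branch_sumD.
rewrite normrM normfV (ger0_norm (ltW w0)) mulrC ler_pdivlMr//.
have t0 f : 0 <= npow (Defs.card (orbE f)) (s + 1) * iter k (transfer_op s) char_fun (piE q f) :> C.
  by rewrite mulr_ge0 ?iter_transfer_op_ge0// ltW// npow_real_gt0.
have W0 : 0 <= branch_sum s n (iter k (transfer_op s) char_fun) by apply: sumr_ge0 => f _; exact: t0.
rewrite (ger0_norm W0) (ger0_norm (iter_transfer_op_ge0 k _)) /branch_sum (bigD1_seq e)//=; last exact: uniq_branch_star.
by rewrite mulrC lerDl; apply: sumr_ge0 => f _; exact: t0.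
Qed.

Hypothesis S_neq0 : exists b, S b.

(** By contradiction: the labels that never lead to [S] are closed under continuation, so if there
    is one then all are such, against [S_neq0]. *)
Lemma series_reach_pos i : exists k, 0 < (mE s ^+ k *m label_col char_fun) i 0.
Proof.
suff [k kP] : exists k, 0 < iter k (transfer_op s) char_fun (lab (enum_val i)).
  by exists k; rewrite mulX_label_col mxE.
move: (lab _); apply: contrapT => /existsNP[b Nb].
have [c Sc] := S_neq0.
have : forall d, ~ exists k, 0 < iter k (transfer_op s) char_fun d.
  apply: EG_reach; first by exists b.
  move=> a d Na ad [k kd]; apply: Na; exists k.+1.
  have [e ea] := piE_surj q a; rewrite iterS -ea transfer_opE.
  have vd : piV q (ter T e) = org Gam d by rewrite -ad -ea pi_ter.
  have [f fe [of_ fb]] := two_lifts (bar T e) vd.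
  have fs : f \in succs e by rewrite (mem_next_edges mem_star) fe of_ eqxx.
  rewrite (bigD1_seq f)//=; last exact/filter_uniq/uniq_star.
  rewrite ltr_pwDl//; first by rewrite fb mulr_gt0// npow_real_gt0.
  by rewrite sumr_ge0// => f' _; rewrite mulr_ge0 ?iter_transfer_op_ge0// ltW// npow_real_gt0.
by move=> /(_ c); apply; exists 0%N; rewrite /= /char_fun Sc ltr01.
Qed.

End RealExponent.

(** * The orbit of [t2] enumerated by the branches *)

Section Endpoints.
Variables (t1 t2 : V + E) (tau : E -> V + E) (coreL : seq (V + E)).
Local Notation K := (stab A t2).
Hypothesis HE : H = stab A t1.
Hypothesis tau_orbit : forall e, S (piE q e) -> exists g, tau e = act A g t2.
Hypothesis tau_inj : forall n m e f, e \in branch n -> f \in branch m ->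
  S (piE q e) -> S (piE q f) -> tau e = tau f -> e = f.
Hypothesis tau_act : forall h e, S (piE q e) -> tau (actE A h e) = act A h (tau e).
Hypothesis tau_onto : forall g, act A g t2 \in coreL \/
  exists n e, [/\ e \in branch n, S (piE q e) & act A g t2 = tau e].
Hypothesis uniq_coreL : uniq coreL.
Hypothesis coreL_orbit : forall t, t \in coreL -> exists g, t = act A g t2.
Hypothesis coreL_fix : forall h t, H h -> t \in coreL -> act A h t = t.
Hypothesis tau_notin : forall n e, e \in branch n -> S (piE q e) -> tau e \notin coreL.

(** [tau e] stands for the point of the orbit of [t2] that is reached through the edge [e]. *)
Definition level n : seq (V + E) := [seq tau e | e <- branch n & S (piE q e)].

(** [coreL] holds the points of the orbit of [t2] that belong to the core. They are fixed by [H], so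
    each contributes 1 to the series. *)
Definition level_points N : seq (V + E) := coreL ++ flatten [seq level n | n <- iota 0 N].

Lemma levelP n t :
  reflect (exists e, [/\ e \in branch n, S (piE q e) & t = tau e]) (t \in level n).
Proof.
apply: (iffP mapP) => [[e]|[e [eB Se ->]]].
  by rewrite mem_filter => /andP[Se eB] ->; exists e.
by exists e; rewrite // mem_filter Se.
Qed.

Lemma uniq_points N : uniq (level_points N).
Proof.
rewrite cat_uniq uniq_coreL/=; apply/andP; split.
  apply/hasPn => t /flatten_mapP[n _ /levelP[e [eB Se ->]]]; exact: tau_notin eB Se.
apply: uniq_flatten_map; first exact: iota_uniq.
  move=> n; rewrite map_inj_in_uniq; first exact/filter_uniq/uniq_branch_star.
  by move=> e f; rewrite !mem_filter => /andP[Se eB] /andP[Sf fB]; exact: tau_inj eB fB Se Sf.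
move=> n m t _ _ /levelP[e [eB Se ->]] /levelP[f [fB Sf ef]].
have eE := tau_inj eB fB Se Sf ef; subst f.
by have [] := branch_ter_inj treeT mem_star core_edge core_bar eB fB erefl.
Qed.

Lemma points_act N h t : H h -> t \in level_points N -> act A h t \in level_points N.
Proof.
move=> Hh; rewrite !mem_cat => /orP[tC|/flatten_mapP[n nN /levelP[e [eB Se ->]]]].
  by rewrite coreL_fix// tC.
apply/orP; right; apply/flatten_mapP; exists n => //; apply/levelP.
exists (actE A h e); split; first exact: branch_act.
  by rewrite piE_act.
by rewrite tau_act.
Qed.

Lemma points_orbit N t : t \in level_points N -> exists g, t = act A g t2.
Proof.
rewrite mem_cat => /orP[/coreL_orbit//|/flatten_mapP[n _ /levelP[e [_ Se ->]]]].
exact: tau_orbit.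
Qed.

Lemma card_orbit_tau n e : e \in branch n -> S (piE q e) ->
  Defs.card (act_orbit A H (tau e)) = Defs.card (orbE e).
Proof.
move=> eB Se; rewrite -(@card_image_inj _ _ (orbE e) tau).
- congr Defs.card; apply/seteqP; split=> t.
    by move=> [h Hh <-]; exists (actE A h e); [exists h|rewrite tau_act].
  by move=> [_ [h Hh <-] <-]; exists h; rewrite // tau_act.
- exact: finite_orbE eB.
move=> _ _ [h Hh <-] [k Hk <-].
by apply: tau_inj; try exact: (branch_act _ eB); rewrite piE_act.
Qed.

Lemma card_orbit_core t : t \in coreL -> Defs.card (act_orbit A H t) = 1%N.
Proof.
move=> tC; rewrite (_ : act_orbit A H t = [set t]) /Defs.card ?fset_set1 ?cardfs1//.
apply/seteqP; split=> [_ [h Hh <-]/=|_ ->]; first exact: coreL_fix.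
by exists 1%g; rewrite // act_one.
Qed.

Lemma npow1 (s : C) : npow 1 s = 1.
Proof. by rewrite /npow ln1 mulr0 cexp0. Qed.

Lemma partial_sums s N :
  \sum_(D <- [fset coset_to A t1 t2 t | t in level_points N]%fset)
     (zeta_term (stab A t1) K s D : C) =
  (seq.size coreL)%:R + \sum_(k < N) (ra s *m mE s ^+ k *m label_col char_fun) 0 0.
Proof.
rewrite sum_zeta_terms -?HE; last 3 first.
- exact: uniq_points.
- exact: points_orbit.
- by move=> h t Hh; exact: points_act.
rewrite /level_points big_cat/=; congr (_ + _).
  rewrite (eq_big_seq (fun=> 1)) => [|t tC]; last by rewrite card_orbit_core// npow1.
  by rewrite big_const_seq count_predT iter_addr_0.
rewrite big_flatten big_map -(big_mkord xpredT (fun k => (ra s *m mE s ^+ k *m label_col char_fun) 0 0)).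
rewrite /index_iota subn0; apply: eq_bigr => n _.
rewrite series_term /level big_map big_filter /branch_sum big_mkcond/=.
apply: eq_big_seq => e eB; rewrite /char_fun; case: ifPn => [Se|_]; last by rewrite mulr0.
by rewrite mulr1 (card_orbit_tau eB Se).
Qed.

Lemma points_exhaust D : dcosets (stab A t1) K D -> exists N0, forall N, (N0 <= N)%N ->
  D \in [fset coset_to A t1 t2 t | t in level_points N]%fset.
Proof.
move=> [g _ <-]; rewrite -coset_toE.
have [gC|[n [e [eB Se ge]]]] := tau_onto g.
  by exists 0%N => N _; apply/imfsetP; exists (act A g t2); rewrite //= mem_cat gC.
exists n.+1 => N nN; apply/imfsetP; exists (act A g t2) => //=.
rewrite mem_cat; apply/orP; right; apply/flatten_mapP; exists n; first by rewrite mem_iota.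
by apply/levelP; exists e.
Qed.

Hypothesis growthP : polynomial_growth R (stab A t1) K.
Hypothesis mE_expoly : forall i j, expoly (fun s => mE s i j).
Hypothesis mE_norm : forall s i j, `|mE s i j| = mE (complex.Re s)%:C%C i j.
Hypothesis ra_expoly : forall j, expoly (fun s => ra s 0 j).
Hypothesis ra_ge0 : forall (x : R) j, 0 <= ra x%:C%C 0 j.
Hypothesis S_neq0 : exists b, S b.

Lemma char_fun_col_ge0 i : 0 <= label_col char_fun i 0.
Proof. by rewrite mxE ler0n. Qed.

Lemma branch_formula : determinant_formula (stab A t1) K mE
  (fun s => label_col char_fun *m ra s) (fun=> (seq.size coreL)%:R - 1).
Proof.
apply: (@determinant_formula_of_series R G (stab A t1) K growthP _ _ #|I| mE ra (label_col char_fun)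
  (fun=> (seq.size coreL)%:R) (fun N => [fset coset_to A t1 t2 t | t in level_points N]%fset)) => //.
- exact: stab1.
- exact: stab1.
- exact: expoly_cst.
- exact: points_exhaust.
- exact: partial_sums.
- exact: char_fun_col_ge0.
- exact: series_reach.
- by move=> x i; apply: series_reach_pos.
Qed.

(* If t1 is a vertex and t2 an edge, Uw has an extra factor Ew and epsw contains
   the first term of the series. *)
Lemma branch_formula_shift : determinant_formula (stab A t1) K mE
  (fun s => label_col char_fun *m (ra s *m mE s))
  (fun s => (seq.size coreL)%:R + branch_sum s 0 char_fun - 1).
Proof.
have Ex0 (x : R) i j : 0 <= mE x%:C%C i j.
  by rewrite -[x]/(complex.Re x%:C%C) -mE_norm.
(* Level 0 moves into the constant, so a sum of [N] shifted terms needs [N.+1] levels. *)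
apply: (@determinant_formula_of_series R G (stab A t1) K growthP _ _ #|I| mE
  (fun s => ra s *m mE s) (label_col char_fun)
  (fun s => (seq.size coreL)%:R + branch_sum s 0 char_fun)
  (fun N => [fset coset_to A t1 t2 t | t in level_points N.+1]%fset)) => //.
- exact: stab1.
- exact: stab1.
- by move=> j; apply: expoly_mulmx => // k l; rewrite ord1.
- apply: expolyD; first exact: expoly_cst.
  apply: (@expoly_ext _ (fun s => (ra s *m label_col char_fun) 0 0)) => [s|]; first exact: start.
  apply: expoly_mulmx => k l; last exact: expoly_cst.
  by rewrite ord1.
- move=> D /points_exhaust[N0 H0]; exists N0 => N NN0; apply: H0.
  exact: leqW.
- move=> s N; rewrite partial_sums big_ord_recl expr0 mulmx1 start addrA.
  congr (_ + _); apply: eq_bigr => k _.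
  by rewrite /bump/= exprS -[_ * _]/(_ *m _) !mulmxA.
- by move=> x j; rewrite mxE sumr_ge0// => k _; rewrite mulr_ge0.
- move=> x; rewrite addr_ge0// sumr_ge0// => e _.
  by rewrite mulr_ge0// ?ler0n// ltW// npow_real_gt0.
- exact: char_fun_col_ge0.
(* The scalars of the shifted series are those of [series_reach] from index 1 on. *)
- move=> x /= N; apply: series_reach; apply: (@null_unshift _ _ 1).
  apply: null_ext N => k; rewrite addn1 exprS -[_ * _]/(_ *m _) !mulmxA//.
- by move=> x i; apply: series_reach_pos.
Qed.

Lemma branch_formulas :
  determinant_formula (stab A t1) K mE
    (fun s => label_col char_fun *m ra s) (fun=> (seq.size coreL)%:R - 1) /\
  determinant_formula (stab A t1) K mE
    (fun s => label_col char_fun *m (ra s *m mE s))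
    (fun s => (seq.size coreL)%:R + branch_sum s 0 char_fun - 1).
Proof. by split; [exact: branch_formula|exact: branch_formula_shift]. Qed.

End Endpoints.
End Branches.

(** * Independence of stabilisers *)

Section Independence.
Variables (G : groupType) (V E : choiceType) (T : graph V E).
Variables (A : action G T) (VG EG : finType) (Gam : graph VG EG).
Variable q : quotient_graph A Gam.
Hypothesis treeT : is_tree T.

(** Fixing a whole geodesic up to [e] restricts the motion of the next edge no more than fixing [e]
    alone. *)
Definition independent : Prop := forall v p e f h,
  geodesic T v (rcons (rcons p e) f) -> actE A h e = e ->
  exists k, [/\ actV A k v = v, map (actE A k) (rcons p e) = rcons p e &
                actE A k f = actE A h f].

Lemma walk_piE v p : walk T v p -> walk Gam (piV q v) (map (piE q) p).
Proof.
elim: p v => [|e p IH] v //= /andP[/eqP <- W].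
by rewrite pi_org eqxx/= pi_ter; exact: IH.
Qed.

(** The geodesics ending with [f] and with its image under [h] agree up to [e] and have the same
    image in the quotient. *)
Lemma weakly_transitive_independent : weakly_locally_infty_transitive q -> independent.
Proof.
move=> wli v p e f h Gf he.
have [/= Ge oe fe] := and3P (etrans (esym (geodesic_rcons2 T v p e f)) Gf).
have G' : geodesic T v (rcons (rcons p e) (actE A h f)).
  rewrite geodesic_rcons2 Ge act_org (eqP oe) -act_ter he eqxx/=.
  by rewrite -{1}he -act_bar (inj_eq (@actE_inj _ _ _ _ A h)).
have [|k kv kr] := wli v _ (walk_piE (andP Gf).1) _ _ Gf G' erefl.
  by rewrite !map_rcons piE_act.
have [kp kf] := rcons_inj (etrans (esym (map_rcons _ _ _)) kr).
exists k; split=> //.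
by case: kv.
Qed.

(** Property (P) is applied to the line made of the single edge [e], with [h] assigned to its
    terminus and 1 to its origin. The resulting [k] is trivial on the half-tree behind [e] and acts
    like [h] on the one ahead. *)
Lemma tits_P_independent : tits_P A -> independent.
Proof.
move=> tits v p e f h Gf he.
have [/= Ge /eqP oe fe] := and3P (etrans (esym (geodesic_rcons2 T v p e f)) Gf).
pose L : set V := [set` [:: org T e; ter T e]].
pose M : set E := [set` [:: e]].
have lineLM : is_line T L M.
  by left; exists (org T e), [:: e]; rewrite /geodesic/= eqxx.
have ne := @org_neq_ter _ _ _ treeT e.
pose h' w := if w == ter T e then h else 1%g.
have h'fix w : L w -> fixes A L M (h' w).
  move=> _; rewrite /h'; case: ifP => _; split=> [x|d] /=; rewrite ?actV1 ?actE1//.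
    by rewrite /L/= !inE => /orP[]/eqP ->; rewrite -?act_org -?act_ter he.
  by rewrite /M/= inE => /eqP ->.
have [k [kV kE] kP] := tits L M lineLM h' h'fix.
have LO : L (org T e) by rewrite /L/= !inE eqxx.
have LT : L (ter T e) by rewrite /L/= !inE eqxx orbT.
(* Vertices behind [e] project to its origin, where the assigned element is 1. *)
have back x r : geodesic T x (rcons r e) -> actV A k x = x /\ map (actE A k) r = r.
  elim: r x => [|d r IH] x.
    by move=> /andP[/= /andP[/eqP <- _] _]; rewrite kV.
  rewrite rcons_cons => Gx.
  have [kd kr] := IH _ (@geodesic_catr _ _ T x [:: d] _ Gx).
  have Gd : geodesic T x (d :: r).
    by apply: (@geodesic_catl _ _ T _ _ [:: e]); rewrite cat_cons cats1.
  have Er : walk_end T x (d :: r) = org T e.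
    by move: Gx => /andP[+ _]; rewrite -rcons_cons -cats1 walk_cat/= andbT => /andP[_ /eqP ->].
  have kx : actV A k x = x.
    rewrite (kP (org T e) x LO); first by rewrite /h' (introF eqP ne) actV1.
    split=> // w' r1 r2 Lw' G1 E1 G2 E2.
    have -> : r1 = d :: r by apply: (geodesic_unique treeT G1 Gd); rewrite E1 Er.
    move: Lw'; rewrite /L/= !inE => /orP[]/eqP we.
      by have -> : r2 = d :: r by apply: (geodesic_unique treeT G2 Gd); rewrite E2 Er.
    have -> : r2 = d :: rcons r e.
      by apply: (geodesic_unique treeT G2 Gx); rewrite E2 -rcons_cons walk_end_rcons.
    by rewrite /= size_rcons.
  split=> //=; rewrite kr; congr (_ :: _); apply: (edge_ext treeT).
    by rewrite act_org; move: Gx => /andP[/= /andP[/eqP -> _] _].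
  by rewrite act_ter kd.
have [kv kp] := back v p Ge.
exists k; split=> //; first by rewrite map_rcons kp kE// /M/= inE.
(* Property (P) prescribes the action on vertices; an edge of a tree is determined by its ends. *)
apply: (edge_ext treeT); first by rewrite !act_org oe -[in RHS]act_ter he kV.
rewrite !act_ter (kP (ter T e) (ter T f) LT); first by rewrite /h' eqxx.
have G1 : geodesic T (ter T f) [:: bar T f] by rewrite /geodesic/= org_bar eqxx.
have G2 : geodesic T (ter T f) [:: bar T f; bar T e].
  rewrite geodesic_cons2 org_bar eqxx (barK T) eq_sym fe/=.
  by rewrite /geodesic/= org_bar ter_bar oe eqxx.
have E1 : walk_end T (ter T f) [:: bar T f] = ter T e by rewrite /walk_end/= ter_bar.
have E2 : walk_end T (ter T f) [:: bar T f; bar T e] = org T e by rewrite /walk_end/= ter_bar.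
split=> // w' r1 r2 Lw' H1 E3 H2 E4.
have -> : r1 = [:: bar T f] by apply: (geodesic_unique treeT H1 G1); rewrite E3 E1.
move: Lw'; rewrite /L/= !inE => /orP[]/eqP we.
  by have -> : r2 = [:: bar T f; bar T e] by apply: (geodesic_unique treeT H2 G2); rewrite E4 E2.
by have -> : r2 = [:: bar T f] by apply: (geodesic_unique treeT H2 G1); rewrite E4 E1.
Qed.

(** An element fixing the origin but not the terminus of a lift moves it to another lift at the same
    vertex. The edge [e] to avoid is mostly the reverse of the edge just crossed. *)
Lemma two_lifts_of_incomparable : incomparable_stabilisers A ->
  forall v b e, piV q v = org Gam b -> exists2 f, f != e & org T f = v /\ piE q f = b.
Proof.
move=> inc v b e vb; have [e0 e0b] := piE_surj q b.
have /(piV_orbit q)[g gv] : piV q (org T e0) = piV q v by rewrite -pi_org e0b vb.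
pose f := actE A g e0.
have of_ : org T f = v by rewrite act_org gv.
have fb : piE q f = b by rewrite piE_act.
have [fe|fe] := eqVneq f e; last by exists f.
have [/existsNP[h /not_implyP[ho ht]] _] := inc f.
exists (actE A h f); last first.
  by rewrite act_org piE_act; split=> //; move: ho => [->].
rewrite -fe; apply/eqP => hf; apply: ht.
by rewrite /stab/= -act_ter hf.
Qed.

End Independence.

(** * The core given by a vertex or an edge *)

Section Cores.
Variables (G : groupType) (V E : choiceType) (T : graph V E).
Variables (A : action G T) (VG EG : finType) (Gam : graph VG EG).
Variable q : quotient_graph A Gam.
Hypothesis treeT : is_tree T.
Hypothesis finT : locally_finite T.
Hypothesis indA : independent A.
Hypothesis two_lifts : forall v b e, piV q v = org Gam b ->
  exists2 f, f != e & org T f = v /\ piE q f = b.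

Definition coreV (t : V + E) : seq V :=
  match t with inl v => [:: v] | inr e => [:: org T e; ter T e] end.

(** Both orientations, so that neither of them counts as leaving the core. *)
Definition coreE (t : V + E) : seq E :=
  match t with inl v => [::] | inr e => [:: e; bar T e] end.

Lemma bar_neqb e : (bar T e == e) = false.
Proof. by apply/eqP; exact: bar_neq. Qed.

Lemma org_neqb e : (org T e == ter T e) = false.
Proof. by apply/eqP; exact: org_neq_ter. Qed.

Lemma uniq_coreV t : uniq (coreV t).
Proof. by case: t => [v|e] //=; rewrite inE org_neqb. Qed.

Lemma uniq_coreE t : uniq (coreE t).
Proof. by case: t => [v|e] //=; rewrite inE eq_sym bar_neqb. Qed.

Lemma core_edge t c d : c \in coreV t -> d \in coreV t -> c != d ->
  exists2 e, e \in coreE t & org T e = c /\ ter T e = d.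
Proof.
case: t => [v|e] /=; rewrite !inE.
  by move=> /eqP -> /eqP ->; rewrite eqxx.
move=> /orP[]/eqP -> /orP[]/eqP ->; rewrite ?eqxx// => _.
  by exists e; rewrite // inE eqxx.
by exists (bar T e); rewrite ?inE ?eqxx ?orbT// org_bar ter_bar.
Qed.

Lemma core_org t e : e \in coreE t -> org T e \in coreV t.
Proof.
case: t => [v|d] //=; rewrite !inE => /orP[]/eqP ->; rewrite ?org_bar eqxx//.
by rewrite orbT.
Qed.

Lemma core_bar t e : e \in coreE t -> bar T e \in coreE t.
Proof.
case: t => [v|d] //=; rewrite !inE => /orP[]/eqP ->; rewrite ?(barK T) eqxx//.
by rewrite orbT.
Qed.

Lemma core_neq0 t : exists c, c \in coreV t.
Proof. by case: t => [v|e]; [exists v|exists (org T e)]; rewrite inE eqxx. Qed.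

Lemma stab_coreV t h c : stab A t h -> c \in coreV t -> actV A h c = c.
Proof.
case: t => [v|e] [ht]; rewrite /= !inE; first by move=> /eqP ->.
by move=> /orP[]/eqP ->; rewrite -?act_org -?act_ter ht.
Qed.

Lemma stab_coreE t h e : stab A t h -> e \in coreE t -> actE A h e = e.
Proof.
case: t => [v|d] [ht] //; rewrite /= !inE.
by move=> /orP[]/eqP ->; rewrite ?act_bar ht.
Qed.

(** A geodesic leaving an edge [t] is prolonged backwards across [t]. An element fixing the
    prolonged path then lies in the stabiliser of [t], which is where [branch_independence] needs
    it. *)
Lemma core_extension t c : c \in coreV t -> exists v0 p0,
  (forall f p, geodesic T c (f :: p) -> f \notin coreE t -> geodesic T v0 (p0 ++ f :: p)) /\
  (forall k, actV A k v0 = v0 -> map (actE A k) p0 = p0 -> stab A t k).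
Proof.
case: t => [v|e]; rewrite /= !inE.
  move=> /eqP ->; exists v, [::]; split=> // k kv _.
  by rewrite /stab/= kv.
move=> /orP[]/eqP ->; [exists (ter T e), [:: bar T e]|exists (org T e), [:: e]]; split.
- move=> f p Gf; rewrite !inE negb_or => /andP[fe _].
  by rewrite /= geodesic_cons2 org_bar ter_bar eqxx (barK T) fe Gf.
- by move=> k _ /= [ke]; rewrite /stab/= -[e in LHS](barK T) act_bar ke (barK T).
- move=> f p Gf; rewrite !inE negb_or => /andP[_ fe].
  by rewrite /= geodesic_cons2 eqxx fe Gf.
- by move=> k _ /= [ke]; rewrite /stab/= ke.
Qed.

Lemma branch_independence t n e f h :
  e \in branch T (coreV t) (coreE t) (star T) n -> f \in next_edges T (star T) e ->
  actE A h e = e -> exists2 k, stab A t k & actE A k e = e /\ actE A k f = actE A h f.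
Proof.
move=> eB; rewrite (mem_next_edges (mem_star finT)) => /andP[fe of_] he.
have [c [f0 [p [cV G0 f0C lp _]]]] := branch_geodesic (mem_star finT) eB.
have [v0 [p0 [ext kst]]] := core_extension cV.
have eE : p0 ++ f0 :: p = rcons (p0 ++ belast f0 p) e.
  by rewrite rcons_cat -lp -lastI.
have Gf : geodesic T v0 (rcons (rcons (p0 ++ belast f0 p) e) f).
  by rewrite geodesic_rcons2 -eE ext// of_ fe.
have [k [kv kp kf]] := indA Gf he.
move: kp; rewrite -eE map_cat => /eqP; rewrite eqseq_cat ?size_map// => /andP[/eqP kp0 /eqP kp].
exists k; first exact: kst.
split=> //; move: kp; by rewrite lastI lp map_rcons => /rcons_inj[_ ->].
Qed.

Section Instance.
Variables (R : realType) (t1 : V + E).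
Local Notation C := R[i].
Local Notation H := (stab A t1).
Variables (I : finType) (lab : I -> EG) (mE : C -> 'M[C]_#|I|) (ra : C -> 'rV[C]_#|I|).
Hypothesis lab_surj : forall b, exists i, lab i = b.
Hypothesis transfer : forall s z i e, piE q e = lab (enum_val i) ->
  (mE s *m label_col lab z) i 0 =
  \sum_(f <- next_edges T (star T) e) npow (step A e f) (s + 1) * z (piE q f).
Hypothesis start : forall s z,
  (ra s *m label_col lab z) 0 0 = branch_sum q (coreV t1) (coreE t1) H s 0 z.
Hypothesis mE_expoly : forall i j, expoly (fun s => mE s i j).
Hypothesis mE_norm : forall s i j, `|mE s i j| = mE (complex.Re s)%:C%C i j.
Hypothesis ra_expoly : forall j, expoly (fun s => ra s 0 j).
Hypothesis ra_ge0 : forall (x : R) j, 0 <= ra x%:C%C 0 j.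
Hypothesis edge_neq0 : [set: E] !=set0.

Lemma branch0_neq0 : exists e, e \in branch T (coreV t1) (coreE t1) (star T) 0.
Proof.
case: t1 => [v|e].
  have [e oe] := exists_org treeT v edge_neq0.
  by exists e; apply/(branch0P _ _ (mem_star finT)); rewrite /= inE oe eqxx.
have [f fe [of_ _]] := two_lifts e (esym (pi_org q e)).
exists f; apply/(branch0P _ _ (mem_star finT)); rewrite /= !inE of_ eqxx negb_or fe.
split=> //=; apply: contra_not_neq (@org_neq_ter _ _ _ treeT e) => fbe.
by rewrite -of_ fbe org_bar.
Qed.

Variable t2 : V + E.
Local Notation K := (stab A t2).
Local Notation br := (branch T (coreV t1) (coreE t1) (star T)).

(** Both orientations for an edge: a geodesic may run through a point of the orbit of [t2] along it
    or against it. *)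
Definition ends_at (w : VG + EG) : pred EG := fun b =>
  match w with inl d => ter Gam b == d | inr b' => b \in [:: b'; bar Gam b'] end.

Local Notation S := (ends_at (piT q t2)).

(** An edge of the quotient differs from its inverse, so when [e] lies over an edge [t2] or its
    inverse, exactly one orientation of [e] is in the orbit of [t2]. *)
Definition endpoint (e : E) : V + E :=
  match t2 with
  | inl _ => inl (ter T e)
  | inr e2 => if piE q e == piE q e2 then inr e else inr (bar T e)
  end.

(** If [t1] is an edge over a loop, both its ends can be in the orbit of [t2]; they are then two
    points. *)
Definition core_points : seq (V + E) :=
  match t2 with
  | inl v2 => [seq inl c | c <- coreV t1 & piV q c == piV q v2]
  | inr e2 => [seq inr e | e <- coreE t1 & piE q e == piE q e2]
  end.

Lemma bar_Gam_neq b : (bar Gam b == b) = false.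
Proof. by apply/eqP; exact: bar_neq. Qed.

Lemma endpoint_orbit e : S (piE q e) -> exists g, endpoint e = act A g t2.
Proof.
rewrite /endpoint /ends_at; case: t2 => [v2|e2] /=.
  by rewrite pi_ter => /eqP/esym/(piV_orbit q)[g ->]; exists g.
rewrite !inE => /orP[/eqP ee|/eqP ee].
  by rewrite ee eqxx; move/esym/(piE_orbit q): ee => [g ->]; exists g.
rewrite ee bar_Gam_neq.
have /esym/(piE_orbit q)[g ->] : piE q (bar T e) = piE q e2 by rewrite pi_bar ee (barK Gam).
by exists g.
Qed.

Lemma endpoint_inj n m e f : e \in br n -> f \in br m ->
  S (piE q e) -> S (piE q f) -> endpoint e = endpoint f -> e = f.
Proof.
move=> eB fB; rewrite /endpoint /ends_at; case: t2 => [v2|e2] /=.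
  move=> _ _ [tt]; have ce := @core_edge t1; have cb := @core_bar t1.
  by have [] := branch_ter_inj treeT (mem_star finT) ce cb eB fB tt.
move=> _ _; case: ifP => _; case: ifP => _ [] // ef.
- exfalso; move: eB; rewrite ef; apply: branch_bar fB => //.
  + exact: mem_star.
  + exact: core_edge.
  + exact: core_bar.
- exfalso; move: fB; rewrite -ef; apply: branch_bar eB => //.
  + exact: mem_star.
  + exact: core_edge.
  + exact: core_bar.
- exact: (can_inj (barK T)).
Qed.

Lemma endpoint_act h e : endpoint (actE A h e) = act A h (endpoint e).
Proof.
rewrite /endpoint; case: t2 => [v2|e2] /=; first by rewrite act_ter.
by rewrite piE_act; case: ifP => _ //=; rewrite act_bar.
Qed.

Lemma core_pointsP t : t \in core_points -> piT q t = piT q t2 /\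
  match t with inl c => c \in coreV t1 | inr e => e \in coreE t1 end.
Proof.
rewrite /core_points; case: t2 => [v2|e2] /mapP[x].
  by rewrite mem_filter => /andP[/eqP xv xc] ->; rewrite /= xv.
by rewrite mem_filter => /andP[/eqP xv xc] ->; rewrite /= xv.
Qed.

Lemma endpoint_onto g : act A g t2 \in core_points \/
  exists n e, [/\ e \in br n, S (piE q e) & act A g t2 = endpoint e].
Proof.
have ce := @core_edge t1; have cb := @core_bar t1; have co := @core_org t1.
rewrite /core_points /endpoint /ends_at; case: t2 => [v2|e2] /=.
  have [gV|[n [e [eB te]]]] :=
      branch_vertex treeT (mem_star finT) co cb (core_neq0 t1) (actV A g v2).
    by left; apply/mapP; exists (actV A g v2); rewrite // mem_filter piV_act eqxx.
  by right; exists n, e; split; rewrite ?te// pi_ter te piV_act.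
case: (branch_edge treeT (mem_star finT) co cb (core_neq0 t1) (actE A g e2)).
- move=> gC; left; apply/mapP; exists (actE A g e2) => //.
  by rewrite mem_filter piE_act eqxx.
- move=> [n gB]; right; exists n, (actE A g e2); split=> //.
    by rewrite piE_act inE eqxx.
  by rewrite piE_act eqxx.
- move=> [n gB]; right; exists n, (bar T (actE A g e2)); split=> //.
    by rewrite pi_bar piE_act !inE eqxx orbT.
  by rewrite pi_bar piE_act bar_Gam_neq (barK T).
Qed.

Lemma uniq_core_points : uniq core_points.
Proof.
rewrite /core_points; case: t2 => [v2|e2]; rewrite map_inj_uniq ?filter_uniq//.
- exact: uniq_coreV.
- by move=> x y [].
- exact: uniq_coreE.
- by move=> x y [].
Qed.

Lemma core_points_orbit t : t \in core_points -> exists g, t = act A g t2.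
Proof.
move=> /core_pointsP[+ _]; case: t t2 => [v|e] [v2|e2] //= [].
  by move=> /esym/(piV_orbit q)[g ->]; exists g.
by move=> /esym/(piE_orbit q)[g ->]; exists g.
Qed.

Lemma core_points_fix h t : H h -> t \in core_points -> act A h t = t.
Proof.
move=> Hh /core_pointsP[_]; case: t => [c|e] cC /=.
  by rewrite (stab_coreV Hh cC).
by rewrite (stab_coreE Hh cC).
Qed.

Lemma endpoint_notin n e : e \in br n -> S (piE q e) -> endpoint e \notin core_points.
Proof.
have ce := @core_edge t1; have cb := @core_bar t1; have co := @core_org t1.
move=> eB _; apply/negP => /core_pointsP[_]; rewrite /endpoint; case: t2 => [v2|e2].
  by have /negP := branch_ter treeT (mem_star finT) ce eB.
have eC := branch_notin_core treeT (mem_star finT) ce co eB.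
by move/negP: eC; case: ifP => _ // eC /cb; rewrite (barK T).
Qed.

Hypothesis growthP : polynomial_growth R H K.
Hypothesis ends_neq0 : exists b, S b.

Lemma core_formulas :
  determinant_formula H K mE
    (fun s => label_col lab (char_fun R S) *m ra s)
    (fun=> (seq.size core_points)%:R - 1) /\
  determinant_formula H K mE
    (fun s => label_col lab (char_fun R S) *m (ra s *m mE s))
    (fun s => (seq.size core_points)%:R +
      branch_sum q (coreV t1) (coreE t1) H s 0 (char_fun R S) - 1).
Proof.
apply: (@branch_formulas _ _ _ _ _ _ _ _ _ q treeT finT (coreV t1) (coreE t1)
  _ _ _ _ _ _ _ _ _ _ I lab mE _ _ ra S _ _ _ t1 t2 endpoint) => //.
- exact: uniq_coreV.
- exact: core_edge.
- exact: core_bar.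
- exact: stab1.
- exact: stabM.
- exact: stabV.
- exact: stab_coreV.
- exact: stab_coreE.
- exact: branch_independence.
- exact: branch0_neq0.
- exact: endpoint_orbit.
- exact: endpoint_inj.
- by move=> h e _; exact: endpoint_act.
- exact: endpoint_onto.
- exact: uniq_core_points.
- exact: core_points_orbit.
- exact: core_points_fix.
- exact: endpoint_notin.
Qed.

End Instance.
End Cores.

(** * The weakly locally transitive case *)

Lemma sum_enum_val (C : nmodType) (I : finType) (F : I -> C) :
  \sum_(j < #|I|) F (enum_val j) = \sum_i F i.
Proof. by rewrite [RHS](reindex _ (onW_bij _ (@enum_val_bij I))). Qed.

Lemma row_sum_basis (C : comNzRingType) (I : finType) (P : pred I) i :
  (\sum_(b | P b) basis_row C b) 0 i = (P (enum_val i))%:R.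
Proof.
rewrite summxE; under eq_bigr do rewrite mxE eqxx/=.
have [Pi|Pi] := boolP (P (enum_val i)).
  rewrite (bigD1 (enum_val i))//= enum_valK eqxx big1 ?addr0// => b /andP[_ bi].
  by rewrite -(inj_eq enum_val_inj) enum_rankK eq_sym (negbTE bi).
rewrite big1// => b Pb; rewrite -(inj_eq enum_val_inj) enum_rankK.
by case: eqP => // ib; rewrite ib Pb in Pi.
Qed.

Lemma determinant_formula_ext (R : realType) (G : groupType) (H K : set G) n
    (E U U' : R[i] -> 'M[R[i]]_n) (eps eps' : R[i] -> R[i]) :
  (forall s, U s = U' s) -> (forall s, eps s = eps' s) ->
  determinant_formula H K E U eps -> determinant_formula H K E U' eps'.
Proof. by move=> /funext -> /funext ->. Qed.

(** * Sums over edges grouped by label *)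

Section Labels.
Variables (R : realType) (G : groupType) (V E : choiceType) (T : graph V E).
Variables (A : action G T) (VG EG : finType) (Gam : graph VG EG).
Variable q : quotient_graph A Gam.
Local Notation C := R[i].
Hypothesis treeT : is_tree T.
Hypothesis finT : locally_finite T.
Local Notation star := (star T).
Local Notation succs := (next_edges T star).
Local Notation om := (omega q).

Lemma sum_by_label (L : seq E) (phi : EG -> C) :
  \sum_(e <- L) phi (piE q e) = \sum_b (count (fun e => piE q e == b) L)%:R * phi b.
Proof.
elim: L => [|e L IH].
  by rewrite big_nil big1// => b _; rewrite mul0r.
rewrite big_cons IH /=.
under [RHS]eq_bigr do rewrite natrD mulrDl.
rewrite big_split/=; congr (_ + _).
rewrite (bigD1 (piE q e))//= eqxx mul1r big1 ?addr0// => b be.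
by rewrite eq_sym (negbTE be) mul0r.
Qed.

Lemma omega_count v b : piV q v = org Gam b ->
  om b = count (fun e => piE q e == b) (star v).
Proof.
move=> vb; rewrite (omegaE vb) (card_count (s := star v)).
- apply: eq_in_count => e; rewrite (mem_star finT) => /eqP oe.
  by apply/asboolP/eqP => [[]|].
- exact: uniq_star.
- by move=> e [oe _]; rewrite (mem_star finT) oe.
Qed.

Lemma omega_gt0 b : (0 < om b)%N.
Proof.
have [e eb] := piE_surj q b.
have vb : piV q (org T e) = org Gam b by rewrite -pi_org eb.
rewrite (omega_count vb) -has_count; apply/hasP; exists e; rewrite ?eb//.
by rewrite (mem_star finT).
Qed.

Lemma count_star_neq v b : piV q v <> org Gam b ->
  count (fun e => piE q e == b) (star v) = 0%N.
Proof.
move=> vb; apply/eqP; rewrite -leqn0 leqNgt -has_count; apply/hasPn => e.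
by rewrite (mem_star finT) => /eqP oe; apply: contra_notN vb => /eqP <-; rewrite pi_org oe.
Qed.

(** The stabiliser of [v] is transitive on the lifts of [b] at [v]; the [om b] lifts, each of weight
    om(b)^(-s-1), add up to om(b)^(-s). *)
Lemma branch_sum0_vertex v s z :
  branch_sum q (coreV T (inl v)) (coreE T (inl v)) (stab A (inl v)) s 0 z =
  \sum_(b | org Gam b == piV q v) npow (om b) s * z b :> C.
Proof.
rewrite /branch_sum /branch /= cats0 (eq_filter (a2 := predT)) ?filter_predT//.
rewrite (eq_big_seq (fun e => npow (om (piE q e)) (s + 1) * z (piE q e))); last first.
  move=> e; rewrite (mem_star finT) => /eqP oe.
  suff -> : orbE A (stab A (inl v)) e = star_over q v (piE q e).
    by rewrite -(@omegaE _ _ _ _ _ _ _ _ q (piE q e) v)// pi_org oe.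
  apply/seteqP; split=> [_ [h [hv] <-]|f [of_ fe]].
    by split; [rewrite act_org oe|rewrite piE_act].
  have /(piE_orbit q)[g fg] : piE q e = piE q f by rewrite fe.
  by exists g => //; rewrite /stab/= -[in LHS]oe -act_org -fg of_.
rewrite (sum_by_label _ (fun b => npow (om b) (s + 1) * z b)) [RHS]big_mkcond/=.
apply: eq_bigr => b _; case: eqP => [ob|ob].
  by rewrite -omega_count// mulrA npow_shift1// omega_gt0.
by rewrite count_star_neq ?mul0r// => /esym.
Qed.

(** The edges leaving the core at its two ends are the successors of [e] and of [bar T e], and both
    orientations have the same stabiliser. *)
Lemma branch_sum0_edge e s z :
  branch_sum q (coreV T (inr e)) (coreE T (inr e)) (stab A (inr e)) s 0 z =
  \sum_(f <- succs e) npow (step A e f) (s + 1) * z (piE q f) +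
  \sum_(f <- succs (bar T e)) npow (step A (bar T e) f) (s + 1) * z (piE q f) :> C.
Proof.
have stabE f : orbE A (stab A (inr e)) f = [set actE A g f | g in [set g | actE A g e = e]].
  apply/seteqP; split=> [_ [h [he] <-]|_ [h he <-]]; exists h => //.
  by rewrite /stab/= he.
have stabE' f : orbE A (stab A (inr e)) f =
    [set actE A g f | g in [set g | actE A g (bar T e) = bar T e]].
  rewrite stabE; congr image; apply/seteqP; split=> g /=; first by rewrite act_bar => ->.
  by rewrite act_bar => /(can_inj (barK T)).
rewrite /branch_sum /branch /= cats0 filter_cat big_cat/= addrC; congr (_ + _).
- rewrite /next_edges; rewrite (@eq_in_filter _ (fun f => f \notin [:: e; bar T e]) (fun f => f != bar T e)).
    by apply: eq_bigr => f _; rewrite /step stabE.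
  move=> f; rewrite (mem_star finT) !inE negb_or => /eqP of_.
  rewrite andb_idl// => _; apply: contra_not_neq (@org_neq_ter _ _ _ treeT e) => fe.
  by rewrite -of_ fe.
- rewrite /next_edges ter_bar (barK T) (@eq_in_filter _ (fun f => f \notin [:: e; bar T e]) (fun f => f != e)).
    by apply: eq_bigr => f _; rewrite /step stabE'.
  move=> f; rewrite (mem_star finT) !inE negb_or => /eqP of_.
  rewrite andb_idr// => _; apply: contra_not_neq (@org_neq_ter _ _ _ treeT e) => fe.
  by rewrite -of_ fe org_bar.
Qed.

Lemma size_core_points (t1 t2 : V + E) : (seq.size (core_points q t1 t2))%:R =
  match piT q t1, piT q t2 with
  | inl c, inl d => (d == c)%:R
  | inl _, inr _ => 0
  | inr a, inl d => (org Gam a == d)%:R + (ter Gam a == d)%:R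
  | inr a, inr b => (b \in [:: a; bar Gam a])%:R
  end :> C.
Proof.
case: t1 t2 => [v1|e1] [v2|e2] //=.
- by rewrite eq_sym; case: eqP.
- by rewrite -!pi_org -pi_ter; case: eqP => _; case: eqP => _ /=; rewrite ?addr0 ?add0r// -natrD.
- rewrite pi_bar !inE eq_sym; case: eqP => [->|_]/=; first by rewrite bar_Gam_neq.
  by rewrite [_ == bar _ _]eq_sym; case: eqP.
Qed.

End Labels.

Section WeaklyLocallyTransitive.
Variables (R : realType) (G : groupType) (V E : choiceType) (T : graph V E).
Variables (A : action G T) (VG EG : finType) (Gam : graph VG EG).
Variable q : quotient_graph A Gam.
Local Notation C := R[i].
Hypothesis treeT : is_tree T.
Hypothesis finT : locally_finite T.
Hypothesis wliT : weakly_locally_infty_transitive q.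
Hypothesis two_lifts : forall v b e, piV q v = org Gam b ->
  exists2 f, f != e & org T f = v /\ piE q f = b.
Local Notation star := (star T).
Local Notation succs := (next_edges T star).
Local Notation om := (omega q).

(** Weak transitivity on geodesics of length 2 makes the fibres of the projection the orbits of the
    stabiliser of [e] on its successors. *)
Lemma step_wli e f : f \in succs e ->
  step A e f = count (fun f' => piE q f' == piE q f) (succs e).
Proof.
move=> fs; rewrite (step_count A finT)//; apply: eq_in_count => f' f's.
apply/asboolP/eqP => [[g _ <-]|ff]; first by rewrite piE_act.
have geo d : d \in succs e -> geodesic T (org T e) [:: e; d].
  rewrite (mem_next_edges (mem_star finT)) => /andP[de /eqP od].
  by rewrite geodesic_cons2 eqxx de /geodesic/= od eqxx.
have := wliT (walk_piE q (andP (geo _ fs)).1) (geo _ fs) (geo _ f's) erefl.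
by rewrite /= ff => /(_ erefl)[g _ [ge gf]]; exists g.
Qed.

(** Only [bar T e] is removed from the star, and its label is the inverse of that of [e]. *)
Lemma count_succs e b : piV q (ter T e) = org Gam b ->
  count (fun f => piE q f == b) (succs e) = (om b - (b == bar Gam (piE q e)))%N.
Proof.
move=> eb; rewrite (omega_count finT eb) -[X in (_ - X)%N]/(nat_of_bool _) -pi_bar /next_edges.
have bs : bar T e \in star (ter T e) by rewrite (mem_star finT) org_bar.
rewrite (permP (perm_to_rem bs)) /= -(rem_filter _ (uniq_star T _)).
by rewrite (rem_filter _ (uniq_star T _)) eq_sym addKn.
Qed.

(** Needed because [npow 0 s] is 1, ln 0 being 0, whereas an empty fibre contributes 0. *)
Lemma omega_sub_gt0 e b : piV q (ter T e) = org Gam b ->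
  (0 < om b - (b == bar Gam (piE q e)))%N.
Proof.
move=> eb; rewrite -(count_succs eb) -has_count; apply/hasP.
have [f fe [of_ fb]] := two_lifts (bar T e) eb.
by exists f; rewrite ?fb// (mem_next_edges (mem_star finT)) fe of_ eqxx.
Qed.

(** The m successors over one label all have weight m^(-s-1), which is why the entries of [Ew] have
    exponent [s]. *)
Lemma Ew_transfer s z i e : piE q e = id (enum_val i) ->
  (Ew q s *m label_col id z) i 0 =
  \sum_(f <- succs e) npow (step A e f) (s + 1) * z (piE q f) :> C.
Proof.
move=> /= ei.
rewrite (eq_big_seq (fun f => npow (count (fun f' => piE q f' == piE q f) (succs e)) (s + 1)
    * z (piE q f))); last by move=> f fs; rewrite step_wli.
rewrite (sum_by_label q _
  (fun b => npow (count (fun f' => piE q f' == b) (succs e)) (s + 1) * z b)).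
rewrite mxE -(sum_enum_val (fun b =>
  (count (fun f => piE q f == b) (succs e))%:R *
  (npow (count (fun f => piE q f == b) (succs e)) (s + 1) * z b))).
apply: eq_bigr => j _; rewrite !mxE /= -ei; move: (enum_val j) => b.
case: eqP => [eb|eb].
  have {}eb : piV q (ter T e) = org Gam b by rewrite -pi_ter.
  by rewrite count_succs// mulrA npow_shift1// omega_sub_gt0.
rewrite (_ : count _ _ = 0%N) ?mul0r//; apply/eqP; rewrite -leqn0 leqNgt -has_count.
apply/hasPn => f; rewrite (mem_next_edges (mem_star finT)) => /andP[_ /eqP of_].
by apply: contra_notN eb => /eqP <-; rewrite pi_org of_ pi_ter.
Qed.

Lemma Ew_expoly i j : expoly (fun s : C => Ew q s i j).
Proof.
pose a : EG := enum_val i; pose b : EG := enum_val j.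
apply: (@expoly_ext _ (fun s => if ter Gam a == org Gam b
    then npow (om b - (b == bar Gam a))%N s else 0)) => [s|]; first by rewrite mxE.
by case: (ter Gam a == org Gam b); [exact: expoly_npow|exact: expoly_cst].
Qed.

Lemma Ew_norm (s : C) i j : `|Ew q s i j| = Ew q (complex.Re s)%:C%C i j.
Proof. by rewrite !mxE; case: ifP; rewrite ?normr0// norm_npow. Qed.

Lemma Ew_ge0 (x : R) i j : 0 <= Ew q x%:C%C i j.
Proof. by rewrite -[x]/(complex.Re x%:C%C) -Ew_norm. Qed.

(* Uw u w is the product of the indicator column of the edges ending at w and
   of this row, up to the extra factor Ew if u is a vertex and w an edge. *)
Definition row_w (u : VG + EG) (s : C) : 'rV[C]_#|EG| :=
  match u with
  | inl c => \sum_(a | org Gam a == c) npow (om a) s *: basis_row C a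
  | inr a => (basis_row C a + basis_row C (bar Gam a)) *m Ew q s
  end.

Lemma basis_row_label_col (a : EG) z : (basis_row C a *m label_col id z) 0 0 = z a.
Proof.
rewrite mxE (bigD1 (enum_rank a))//= big1 => [|j ja]; last first.
  by rewrite mxE (negbTE ja) andbF mul0r.
by rewrite !mxE !eqxx mul1r enum_rankK addr0.
Qed.

Lemma row_w_start t1 s z : (row_w (piT q t1) s *m label_col id z) 0 0 =
  branch_sum q (coreV T t1) (coreE T t1) (stab A t1) s 0 z.
Proof.
case: t1 => [v|e] /=.
  rewrite branch_sum0_vertex// mulmx_suml summxE; apply: eq_bigr => b _.
  by rewrite -scalemxAl mxE basis_row_label_col.
rewrite branch_sum0_edge// -mulmxA mulmxDl mxE.
have row a : (basis_row C a *m (Ew q s *m label_col id z)) 0 0 = (Ew q s *m label_col id z) (enum_rank a) 0.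
  by rewrite -rowE mxE.
rewrite !row; congr (_ + _); apply: Ew_transfer; rewrite enum_rankK//.
by rewrite pi_bar.
Qed.

Lemma row_w_expoly u j : expoly (fun s => row_w u s 0 j).
Proof.
case: u => [c|a] /=.
  apply: (@expoly_ext _ (fun s => \sum_(b | org Gam b == c) npow (om b) s * basis_row C b 0 j)).
    by move=> s; rewrite summxE; apply: eq_bigr => b _; rewrite [RHS]mxE.
  by apply: expoly_sum => b _; apply: expolyM; [exact: expoly_npow|exact: expoly_cst].
by apply: expoly_mulmx => k l; [exact: expoly_cst|exact: Ew_expoly].
Qed.

Lemma row_w_ge0 u (x : R) j : 0 <= row_w u x%:C%C 0 j.
Proof.
have b0 (a : EG) k : 0 <= basis_row C a 0 k by rewrite mxE ler0n.
case: u => [c|a] /=.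
  by rewrite summxE sumr_ge0// => b _; rewrite mxE mulr_ge0// ltW// npow_gt0.
by rewrite mxE sumr_ge0// => k _; rewrite mulr_ge0 ?Ew_ge0// mxE addr_ge0.
Qed.

Lemma label_col_ends_vertex d : label_col id (char_fun R (ends_at Gam (inl d))) = (e_ R Gam (inl d))^T.
Proof. by apply/colP => i; rewrite [RHS]mxE row_sum_basis mxE. Qed.

Lemma label_col_ends_edge b :
  label_col id (char_fun R (ends_at Gam (inr b))) = (e_ R Gam (inr b) + e_ R Gam (inr (bar Gam b)))^T.
Proof.
apply/colP => i; rewrite !mxE eqxx/= /char_fun/= !inE -!(inj_eq enum_val_inj) !enum_rankK.
case: eqP => [->|_]; last by case: eqP; rewrite add0r.
by rewrite [b == _]eq_sym bar_Gam_neq addr0.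
Qed.

Hypothesis edge_neq0 : [set: E] !=set0.

Lemma ends_at_neq0 t : exists b, ends_at Gam (piT q t) b.
Proof.
case: t => [v|e] /=; last by exists (piE q e); rewrite inE eqxx.
have [e oe] := exists_org treeT v edge_neq0; exists (piE q (bar T e)) => /=.
by rewrite pi_ter ter_bar oe.
Qed.

Lemma wli_formula t1 t2 : polynomial_growth R (stab A t1) (stab A t2) ->
  determinant_formula (stab A t1) (stab A t2)
       (Ew (R := R) q) (Uw q (piT q t1) (piT q t2)) (epsw q (piT q t1) (piT q t2)).
Proof.
move=> gr; have lab_surj (b : EG) : exists i, id i = b by exists b.
have ind_w := weakly_transitive_independent wliT.
have [F1 F2] := core_formulas treeT finT ind_w two_lifts lab_surj
  (fun s z i e => @Ew_transfer s z i e) (row_w_start t1) Ew_expoly Ew_norm (row_w_expoly _)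
  (row_w_ge0 _) edge_neq0 gr (ends_at_neq0 t2).
have label_col_ends w : label_col id (char_fun R (ends_at Gam w)) =
    match w with inl d => (e_ R Gam (inl d))^T
               | inr b => (e_ R Gam (inr b) + e_ R Gam (inr (bar Gam b)))^T end.
  by case: w => [d|b]; [exact: label_col_ends_vertex|exact: label_col_ends_edge].
rewrite size_core_points in F1; rewrite size_core_points in F2.
case: t1 t2 {gr} F1 F2 => [v1|e1] [v2|e2] F1 F2 /=.
- apply: determinant_formula_ext F1 => s //=.
  rewrite label_col_ends mulmx_sumr; apply: eq_bigr => b _.
  by rewrite -scalemxAr.
- apply: determinant_formula_ext F2 => s /=.
    rewrite label_col_ends mulmx_suml mulmx_sumr; apply: eq_bigr => b _.
    by rewrite -scalemxAl -scalemxAr mulmxA.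
  (* Among the labels, only those of [t2] and of its inverse contribute, and they are distinct. *)
  rewrite add0r branch_sum0_vertex//; congr (_ - 1); rewrite /char_fun/=.
  rewrite big_mkcond/= (bigD1 (piE q e2))//= (bigD1 (bar Gam (piE q e2)))//=; last first.
    by rewrite bar_Gam_neq.
  rewrite !inE !eqxx orbT !mulr1 big1 ?addr0 => [|b /andP[b1 b2]]; last first.
    by rewrite !inE (negbTE b1) (negbTE b2) mulr0; case: ifP.
  by congr (_ + _); case: ifP; rewrite ?mul1r ?mul0r.
- by apply: determinant_formula_ext F1 => s /=; rewrite ?label_col_ends ?mulmxA.
- by apply: determinant_formula_ext F1 => s /=; rewrite ?label_col_ends ?mulmxA.
Qed.
End WeaklyLocallyTransitive.

(** * The (P)-closed case *)

Section LocalActionDiagrams.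
Variables (R : realType) (G : groupType) (V E : choiceType) (T : graph V E).
Variables (A : action G T) (VG EG : finType) (Gam : graph VG EG).
Variable q : quotient_graph A Gam.
Local Notation C := R[i].
Hypothesis treeT : is_tree T.
Hypothesis finT : locally_finite T.
Hypothesis indA : independent A.
Hypothesis two_lifts : forall v b e, piV q v = org Gam b ->
  exists2 f, f != e & org T f = v /\ piE q f = b.
Hypothesis edge_neq0 : [set: E] !=set0.
Local Notation star := (star T).
Local Notation succs := (next_edges T star).
Local Notation om := (omega q).
Variable st : VG -> V.
Hypothesis stP : forall c, piV q (st c) = c.
Variable iota : Defs.X q st -> Defs.X q st.
Hypothesis iotaP : forall a x, X_ q st a (val x) -> X_ q st (bar Gam a) (val (iota x)).
Local Notation X := (Defs.X q st).

Lemma mem_X e : (e \in X) = (org T e == st (org Gam (piE q e))).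
Proof.
have finX : finite_set (Xset q st).
  apply: (@sub_finite_set _ _ [set` flatten [seq star (st c) | c <- enum VG]]).
    move=> e' [a _ [oe pe]] /=; apply/flatten_mapP; exists (org Gam a).
      by rewrite mem_enum.
    by rewrite (mem_star finT) oe.
  exact: finite_seq.
rewrite in_fset_set//; apply/idP/eqP => [/set_mem[a _ [oe pe]]|oe].
  by rewrite pe.
by apply: mem_set; exists (piE q e).
Qed.

Lemma X_edge (x : X) : X_ q st (piE q (val x)) (val x).
Proof. by split=> //; apply/eqP; rewrite -mem_X; exact: (valP x). Qed.

Lemma X_atP c e : X_at q st c e <-> org T e = st c.
Proof.
split=> [[a /= <-] [oe _]//|oe]; exists (piE q e) => /=.
  by rewrite pi_org oe stP.
by split; rewrite // pi_org oe stP.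
Qed.

(** Taking the closure does not enlarge the orbit, since an approximation on the two edges [x] and
    [y] suffices. The edge [bar T x] has the stabiliser of [x] and arrives at the common origin. *)
Lemma card_local_orbit c x y : org T x = st c -> org T y = st c ->
  Defs.card (local_orbit q st c x y) = step A (bar T x) y.
Proof.
move=> ox oy; rewrite /step; congr Defs.card; apply/seteqP; split=> [_ [f [[bijf app] fx] <-]|].
  have [|g sg gE] := app [fset x; y]%fset.
    by move=> e /=; rewrite !inE => /orP[]/eqP ->; apply/X_atP.
  exists g; last by apply: gE; rewrite !inE eqxx orbT.
  by rewrite /= act_bar gE ?fx// !inE eqxx.
move=> _ [g /= gx <-].
have {}gx : actE A g x = x by move: gx; rewrite act_bar => /(can_inj (barK T)).
have gc : actV A g (st c) = st c by rewrite -ox -act_org gx.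
exists (actE A g) => //; split=> //; split.
  split=> [e|e|e].
  - by move=> /X_atP oe; apply/X_atP; rewrite act_org oe.
  - by move=> e' _ _; exact: actE_inj.
  - move=> /X_atP oe; exists (actE A g^-1%g e); last exact: actEKV.
    by apply/X_atP; rewrite act_org oe -[in LHS]gc actVK.
by move=> F' _; exists g => //; rewrite /stab/= gc.
Qed.

Lemma sum_local c x' (phi : E -> C) : org T x' = st c ->
  \sum_(y : X | (org Gam (piE q (val y)) == c) && (val y != x')) phi (val y) =
  \sum_(f <- succs (bar T x')) phi f.
Proof.
move=> ox.
transitivity (\sum_(y <- X | (org Gam (piE q y) == c) && (y != x')) phi y).
  by rewrite big_seq_fsetE.
rewrite -big_filter; apply: perm_big; apply: uniq_perm.
- exact/filter_uniq/fset_uniq.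
- exact/filter_uniq/uniq_star.
move=> y; rewrite mem_filter mem_X (mem_next_edges (mem_star finT)) (barK T) ter_bar ox.
rewrite -andbA andbCA; congr (_ && _); rewrite pi_org.
by apply/andP/eqP => [[/eqP <- /eqP]//|->]; rewrite stP !eqxx.
Qed.

(** The sum depends only on the orbit of [e], so [e] may be moved to end at a representative
    vertex. *)
Lemma sum_succs_act g e (z : EG -> C) s :
  \sum_(f <- succs (actE A g e)) npow (step A (actE A g e) f) s * z (piE q f) =
  \sum_(f <- succs e) npow (step A e f) s * z (piE q f).
Proof.
rewrite (perm_big _ (perm_succs_act A finT g e))/= big_map; apply: eq_big_seq => f fs.
rewrite piE_act; suff -> : step A (actE A g e) (actE A g f) = step A e f by [].
rewrite (step_count A finT fs) (step_count A finT) ?(succs_act A finT)//.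
rewrite (permP (perm_succs_act A finT g e)) count_map; apply: eq_in_count => f' _ /=.
apply/asboolP/asboolP => [[k ke kf]|[k ke kf]].
  exists (g^-1 * k * g)%g; rewrite !actEM; first by rewrite ke actEK.
  by rewrite kf actEK.
by exists (g * k * g^-1)%g; rewrite !actEM actEK; [rewrite ke|rewrite kf].
Qed.

Definition labX (x : X) : EG := piE q (val x).

Lemma labX_surj b : exists x, labX x = b.
Proof.
have [e eb] := piE_surj q b.
have /(piV_orbit q)[g gv] : piV q (org T e) = piV q (st (org Gam b)).
  by rewrite stP -pi_org eb.
have gX : actE A g e \in X by rewrite mem_X piE_act eb act_org gv.
by exists [` gX]%fset; rewrite /labX/= piE_act.
Qed.

(** The reverse of [iota x] lies over the label of [x] and ends at a representative vertex, so its
    successors are local edges, and [e] is a translate of it. Hence the choice of [iota] does not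
    affect the values on label columns. *)
Lemma Ep_transfer s z i e : piE q e = labX (enum_val i) ->
  (Ep (R := R) iota s *m label_col labX z) i 0 =
  \sum_(f <- succs e) npow (step A e f) (s + 1) * z (piE q f).
Proof.
move=> ei; set x := enum_val i in ei *.
have [ox' px'] := iotaP (X_edge x).
have [g gx'] : exists g, val (iota x) = actE A g (bar T e).
  by apply/(piE_orbit q); rewrite px' pi_bar ei.
rewrite org_bar in ox'.
have -> : e = actE A g^-1%g (bar T (val (iota x))).
  by rewrite gx' -act_bar (barK T) actEK.
rewrite sum_succs_act -(sum_local (fun f => npow (step A (bar T (val (iota x))) f) (s + 1) * z (piE q f)) ox').
rewrite mxE; pose Fxy (y : X) : C :=
  (if (ter Gam (piE q (val x)) == org Gam (piE q (val y))) && (y != iota x)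
   then npow (W iota x y) (s + 1) else 0) * z (labX y).
rewrite (eq_bigr (fun j => Fxy (enum_val j))) => [|j _]; last by rewrite !mxE.
rewrite sum_enum_val [RHS]big_mkcond/=; apply: eq_bigr => y _; rewrite /Fxy.
rewrite [org _ _ == ter _ _]eq_sym val_eqE; case: ifP => [/andP[xy _]|_]; last by rewrite mul0r.
rewrite /W xy card_local_orbit//; apply/eqP; rewrite (eqP xy) -mem_X; exact: (valP y).
Qed.

Lemma Ep_expoly i j : expoly (fun s => Ep (R := R) iota s i j).
Proof.
pose x : X := enum_val i; pose y : X := enum_val j.
apply: (@expoly_ext _ (fun s =>
    if (ter Gam (piE q (val x)) == org Gam (piE q (val y))) && (y != iota x)
    then npow (W iota x y) (s + 1) else 0)) => [s|]; first by rewrite mxE.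
case: (_ && _); last exact: expoly_cst.
exact: (expoly_shift 1 (expoly_npow _ _)).
Qed.

Lemma Re_add1 (s : C) : (complex.Re (s + 1))%:C%C = (complex.Re s)%:C%C + 1 :> C.
Proof. by rewrite ReD real_complexD. Qed.

Lemma Ep_norm s i j : `|Ep (R := R) iota s i j| = Ep iota (complex.Re s)%:C%C i j.
Proof. by rewrite !mxE; case: ifP; rewrite ?normr0// norm_npow Re_add1. Qed.

Lemma Ep_ge0 (x : R) i j : 0 <= Ep (R := R) iota x%:C%C i j.
Proof. by rewrite -[x]/(complex.Re x%:C%C) -Ep_norm. Qed.

(** [Up] is the indicator column of [S_] times this row, for all kinds of [u] and [w]. *)
Definition row_p (u : VG + EG) (x : X) (s : C) : 'rV[C]_#|{: X}| :=
  match u with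
  | inl c => \sum_(a | org Gam a == c) npow (om a) (s + 1) *: f_ R q st (X_ q st a)
  | inr a => basis_row C x *m Ep iota s +
      \sum_(y : X | (org Gam (piE q (val y)) == org Gam a) && (y != x))
         npow (Wrev x y) (s + 1) *: basis_row C y
  end.

(** If [t1] is an edge, [x] is a translate of it: the successors of [t1] are read off the row of
    [x], those of its inverse off the other local edges at the origin of [x]. *)
Lemma row_p_start t1 (x : X) s z : (forall a, piT q t1 = inr a -> X_ q st a (val x)) ->
  (row_p (piT q t1) x s *m label_col labX z) 0 0 =
  branch_sum q (coreV T t1) (coreE T t1) (stab A t1) s 0 z.
Proof.
have basis (y : X) : (basis_row C y *m label_col labX z) 0 0 = z (labX y).
  by rewrite -rowE !mxE enum_rankK.
case: t1 => [v|e] xP /=.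
  rewrite branch_sum0_vertex// mulmx_suml summxE; apply: eq_bigr => b _.
  rewrite -scalemxAl mxE mulmx_suml summxE.
  rewrite (eq_bigr (fun=> z b)) => [|y /asboolP[_ yb]]; last by rewrite basis /labX yb.
  transitivity (npow (om b) (s + 1) * (\sum_(y <- X | `[< X_ q st b y >]) z b)).
    by rewrite [in RHS]big_seq_fsetE.
  have cnt : count (fun y => `[< X_ q st b y >]) X = om b.
    have vb : piV q (st (org Gam b)) = org Gam b by rewrite stP.
    rewrite (omegaE vb); apply/esym/card_count; first exact: fset_uniq.
    by move=> y [oy py]; rewrite mem_X py oy.
  rewrite big_const_seq cnt iter_addr_0 -[z b *+ _]mulr_natl mulrA.
  by rewrite [npow _ _ * _]mulrC npow_shift1 ?(omega_gt0 q finT).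
rewrite branch_sum0_edge// mulmxDl mxE.
have xe : X_ q st (piE q e) (val x) by apply: xP.
have [ox px] := xe.
congr (_ + _).
  rewrite -mulmxA -rowE mxE; apply: Ep_transfer.
  by rewrite enum_rankK /labX px.
rewrite mulmx_suml summxE.
have [g gx] : exists g, val x = actE A g e by apply/(piE_orbit q); rewrite px.
have -> : bar T e = actE A g^-1%g (bar T (val x)) by rewrite gx -act_bar actEK.
rewrite sum_succs_act.
rewrite -(sum_local (fun f => npow (step A (bar T (val x)) f) (s + 1) * z (piE q f)) ox).
apply: eq_big => [y|y /andP[/eqP xy _]]; first by rewrite val_eqE.
rewrite -scalemxAl mxE basis /Wrev px xy eqxx card_local_orbit//.
by apply/eqP; rewrite -xy -mem_X; exact: (valP y).
Qed.

Lemma row_p_expoly u x j : expoly (fun s => row_p u x s 0 j).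
Proof.
have Np n : expoly (fun s : C => npow n (s + 1)) := expoly_shift 1 (expoly_npow R n).
case: u => [c|a] /=.
  apply: (@expoly_ext _ (fun s => \sum_(b | org Gam b == c) npow (om b) (s + 1) * f_ R q st (X_ q st b) 0 j)).
    by move=> s; rewrite summxE; apply: eq_bigr => b _; rewrite [RHS]mxE.
  by apply: expoly_sum => b _; apply: expolyM; [exact: Np|exact: expoly_cst].
apply: (@expoly_ext _ (fun s => (basis_row C x *m Ep iota s) 0 j +
  \sum_(y : X | (org Gam (piE q (val y)) == org Gam a) && (y != x))
         npow (Wrev x y) (s + 1) * basis_row C y 0 j)).
  by move=> s; rewrite [RHS]mxE summxE; congr (_ + _); apply: eq_bigr => b _; rewrite [RHS]mxE.
apply: expolyD.
  by apply: expoly_mulmx => k l; [exact: expoly_cst|exact: Ep_expoly].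
by apply: expoly_sum => b _; apply: expolyM; [exact: Np|exact: expoly_cst].
Qed.

Lemma row_p_ge0 u x (r : R) j : 0 <= row_p u x r%:C%C 0 j.
Proof.
have b0 (y : X) k : 0 <= basis_row C y 0 k by rewrite mxE ler0n.
case: u => [c|a] /=.
  rewrite summxE sumr_ge0// => b _; rewrite mxE mulr_ge0//.
    exact: ltW (npow_real_gt0 _ _).
  by rewrite summxE sumr_ge0.
rewrite mxE addr_ge0//.
  rewrite mxE; apply: sumr_ge0 => k _; apply: mulr_ge0; [exact: b0|exact: Ep_ge0].
rewrite summxE; apply: sumr_ge0 => b _; rewrite mxE; apply: mulr_ge0; last exact: b0.
exact: ltW (npow_real_gt0 _ _).
Qed.

Lemma label_col_ends_X w : label_col labX (char_fun R (ends_at Gam w)) = (f_ R q st (S_ q st w))^T.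
Proof.
apply/colP => i; rewrite [RHS]mxE row_sum_basis mxE /char_fun; congr (_ %:R).
move: (enum_val i) => x; congr nat_of_bool; rewrite /labX.
have xX := X_edge x; case: w => [d|b] /=.
  apply/eqP/asboolP => [xd|[a /= ad [_ xa]]]; last by rewrite xa.
  by exists (piE q (val x)).
rewrite !inE; apply/orP/asboolP => [[/eqP xb|/eqP xb]|[[_ ->]|[_ ->]]].
- by left; rewrite -xb.
- by right; rewrite -xb.
- by left.
- by right.
Qed.

(** [Up] has no extra factor when [t1] is a vertex and [t2] an edge, so level 0 stays in the series
    and the unshifted formula serves in all four cases. *)
Lemma P_closed_formula t1 t2 (x : X) : polynomial_growth R (stab A t1) (stab A t2) ->
  (forall a, piT q t1 = inr a -> X_ q st a (val x)) ->
  determinant_formula (stab A t1) (stab A t2) (Ep (R := R) iota)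
    (Up iota (piT q t1) (piT q t2) x) (epsp Gam (piT q t1) (piT q t2)).
Proof.
move=> gr xP.
have [F1 _] := core_formulas treeT finT indA two_lifts labX_surj
  (fun s z i e => @Ep_transfer s z i e) (fun s z => @row_p_start t1 x s z xP) Ep_expoly Ep_norm
  (row_p_expoly _ x) (row_p_ge0 _ x) edge_neq0 gr (ends_at_neq0 q treeT edge_neq0 t2).
rewrite size_core_points in F1.
case: t1 t2 {gr xP} F1 => [v1|e1] [v2|e2] F1 /=.
- apply: determinant_formula_ext F1 => s //=.
  rewrite label_col_ends_X mulmx_sumr; apply: eq_bigr => b _.
  by rewrite -scalemxAr.
- apply: determinant_formula_ext F1 => s /=; last by rewrite sub0r.
  rewrite label_col_ends_X mulmx_sumr; apply: eq_bigr => b _.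
  by rewrite -scalemxAr.
- by apply: determinant_formula_ext F1 => s //=; rewrite label_col_ends_X.
- by apply: determinant_formula_ext F1 => s //=; rewrite label_col_ends_X.
Qed.

End LocalActionDiagrams.

Theorem theoremB (R : realType) (G : groupType) (V E : choiceType)
    (T : graph V E) (A : action G T)
    (VG EG : finType) (Gam : graph VG EG) (q : quotient_graph A Gam)
    (t1 t2 : V + E) :
  is_tree T ->
  locally_finite T ->
  [set: E] !=set0 ->
  no_inversion A ->
  incomparable_stabilisers A ->
  polynomial_growth R (stab A t1) (stab A t2) ->
  (weakly_locally_infty_transitive q ->
     determinant_formula (stab A t1) (stab A t2)
       (Ew (R := R) q) (Uw q (piT q t1) (piT q t2)) (epsw q (piT q t1) (piT q t2)))
  /\
  (P_closed A ->
     forall star : VG -> V, (forall c, piV q (star c) = c) ->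
     forall iota : X q star -> X q star,
       (forall a x, X_ q star a (val x) -> X_ q star (bar Gam a) (val (iota x))) ->
     forall x : X q star,
       (forall a, piT q t1 = inr a -> X_ q star a (val x)) ->
     determinant_formula (stab A t1) (stab A t2)
       (Ep (R := R) iota) (Up iota (piT q t1) (piT q t2) x)
       (epsp Gam (piT q t1) (piT q t2))).
Proof.
move=> treeT finT edges _ inc gr; have two := two_lifts_of_incomparable (q := q) inc.
split=> [wli|[_ _ tits] st stP iota iotaP x xP]; first exact: wli_formula.
by apply: P_closed_formula => //; exact: tits_P_independent.
Qed.
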